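(* Let $Y\subset\mathbb{P}^3_{\mathbb{Q}}\times\mathbb{P}^3_{\mathbb{Q}}$ be the biprojective hypersurface given by \[\sum_{i=0}^3 x_i y_i^3=0.\] For a rational point $(x,y)\in\mathbb{P}^3(\mathbb{Q})\times\mathbb{P}^3(\mathbb{Q})$ choose $\mathbf{x},\mathbf{y}\in\mathbb{Z}^4$ with coprime coordinates (unique up to sign) with $(x,y)=([\mathbf{x}],[\mathbf{y}])$, and define the (anticanonical) height $H(x,y)=|\mathbf{x}|^3|\mathbf{y}|$, where $|\cdot|$ is the supremum norm on $\mathbb{R}^4$. For a Zariski open subset $U\subset Y$ let $N(U,B)=\#\{P\in U(\mathbb{Q}): H(P)\le B\}$. Then for every nonempty Zariski open subset $U\subset Y$ there exist constants $c_U>0$ and $B_U\ge 1$ such that \[N(U,B)\ge c_U\,B(\log B)^3\quad\text{for all } B\ge B_U.\] *)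

(* Defs.v *)
From HB Require Import structures.
From mathcomp Require Import all_boot all_order all_algebra algC.
From mathcomp Require Import finmap.
From mathcomp Require Import -(notations) mpoly.
From mathcomp Require Import boolp classical_sets cardinality reals.
From mathcomp Require Import normedtype exp.
From mathcomp Require Import zify.

Set Implicit Arguments.
Unset Strict Implicit.
Unset Printing Implicit Defensive.

Import Order.TTheory GRing.Theory Num.Theory.
Import numFieldNormedType.Exports.
Local Open Scope classical_set_scope.
Local Open Scope ring_scope.

(* P^n(K) is the set of lines of K^(n+1); the point [x] is the line <[x]>. *)
Definition projsp (K : fieldType) (n : nat) :=
  {L : {vspace 'rV[K]_n.+1} | \dim L == 1%N}.

Definition hcoord (K : fieldType) (n : nat) (P : projsp K n) (x : 'rV[K]_n.+1) :=
  val P = <[x]>%VS.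

Definition biproj (K : fieldType) := (projsp K 3 * projsp K 3)%type.

(* Polynomials in x_0, ..., x_3, y_0, ..., y_3, in this order. *)
Definition bipoly := mpoly (4 + 4) rat.

Definition varx (i : 'I_4) : bipoly := mpolyX rat (mnm1 (lshift 4 i)).
Definition vary (i : 'I_4) : bipoly := mpolyX rat (mnm1 (rshift 4 i)).

Definition bihomog (d e : nat) (p : bipoly) : Prop :=
  forall m : multinom (4 + 4), m \in msupp p ->
    (\sum_(i < 4) m (lshift 4 i))%N = d /\ (\sum_(i < 4) m (rshift 4 i))%N = e.

Definition bieval (K : numFieldType) (x y : 'rV[K]_4) (p : bipoly) : K :=
  mmap (@ratr K) (fun i : 'I_(4 + 4) => row_mx x y 0 i) p.

Lemma bieval_homog (K : numFieldType) (d e : nat) (p : bipoly)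
    (x y : 'rV[K]_4) (a b : K) :
  bihomog d e p -> bieval (a *: x) (b *: y) p = a ^+ d * b ^+ e * bieval x y p.
Proof.
move=> hp; rewrite /bieval /mmap mulr_sumr; apply: eq_big_seq => m /hp[dm em].
rewrite mulrCA; congr (_ * _); rewrite /mmap1 !big_split_ord /=.
rewrite mulrACA -dm -em -!prodrXr.
by congr (_ * _); rewrite -big_split /=; apply: eq_bigr => i _;
  rewrite ?row_mxEl ?row_mxEr mxE exprMn.
Qed.

Definition vanishes (K : numFieldType) (p : bipoly) (P : biproj K) : Prop :=
  forall x y : 'rV[K]_4, hcoord P.1 x -> hcoord P.2 y -> bieval x y p = 0.

Definition eqY : bipoly := \sum_(i < 4) varx i * vary i ^+ 3.

Definition Ypts (K : numFieldType) : set (biproj K) := [set P | vanishes eqY P].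
Arguments Ypts K : clear implicits.

(* A Zariski open subset of Y is the complement in Y of the common zero locus
   of a family of bihomogeneous polynomials with rational coefficients. *)
Record zopen := ZOpen {
  zeqs : set bipoly;
  zeqs_bihomog : forall p, zeqs p -> exists d e, bihomog d e p }.

Definition Upts (U : zopen) (K : numFieldType) : set (biproj K) :=
  [set P | Ypts K P /\ exists2 p, zeqs U p & ~ vanishes p P].
Arguments Upts U K : clear implicits.

(* As a scheme over Q, U is nonempty if and only if it has a point over an
   algebraic closure of Q; this does not presuppose a rational point. *)
Definition zopen_nonempty (U : zopen) : Prop := Upts U algC !=set0.

Definition coprime_coords (n : nat) (x : 'rV[int]_n) : Prop :=
  (\big[gcdn/0]_i `|x ord0 i|)%N = 1%N.

Definition prim_rep (n : nat) (P : projsp rat n) : set 'rV[int]_n.+1 :=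
  [set x | coprime_coords x /\ hcoord P (map_mx intr x)].

Lemma hcoord_neq0 (K : fieldType) (n : nat) (P : projsp K n) x :
  hcoord P x -> x != 0.
Proof.
by move=> Px; move: (valP P); rewrite /= Px dim_vline; case: (x != 0).
Qed.

Lemma hcoordZ (K : fieldType) (n : nat) (P : projsp K n) x (c : K) :
  hcoord P x -> c != 0 -> hcoord P (c *: x).
Proof.
move=> Px c0; rewrite /hcoord Px; apply/eqP; rewrite eq_sym eqEdim.
rewrite !dim_vline scaler_eq0 (negbTE c0) leqnn andbT.
by rewrite -memvE; apply/vlineP; exists c.
Qed.

Lemma hcoord_ex (K : fieldType) (n : nat) (P : projsp K n) :
  exists x, hcoord P x.
Proof.
exists (vpick (val P)); have dP := eqP (valP P).
apply/eqP; rewrite eq_sym eqEdim -memvE memv_pick /= dP dim_vline vpick0.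
by rewrite -dimv_eq0 dP.
Qed.

Lemma prim_rep_exists (n : nat) (P : projsp rat n) : prim_rep P !=set0.
Proof.
have [v Pv] := hcoord_ex P.
pose D : rat := \prod_i (denq (v ord0 i))%:~R.
have D0 : D != 0 by apply/prodf_neq0 => i _; rewrite intr_eq0 denq_neq0.
have zE i : {z : int | z%:~R = D * v ord0 i}.
  exists (numq (v ord0 i) * \prod_(j | j != i) denq (v ord0 j)).
  rewrite intrM (rmorph_prod (intmul 1)) /D [in RHS](bigD1 i) //= mulrAC; congr (_ * _).
  by rewrite numqE mulrC.
pose g := (\big[gcdn/0]_i `|sval (zE i)|)%N.
have gz i : (g%:Z %| sval (zE i))%Z by rewrite dvdzE /= (biggcdn_inf i).
pose w := \row_i (sval (zE i) %/ g%:Z)%Z : 'rV[int]_n.+1.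
have wE i : w ord0 i * g%:Z = sval (zE i) by rewrite mxE divzK.
have wv : (g%:R : rat) *: map_mx intr w = D *: v.
  apply/rowP => i; rewrite mxE [_ i in LHS]mxE [RHS]mxE -(svalP (zE i)) -wE.
  by rewrite intrM mulrC.
have v0 := hcoord_neq0 Pv.
have g0 : g != 0%N.
  apply/eqP => g0; move/eqP: wv; rewrite g0 scale0r eq_sym scaler_eq0.
  by rewrite (negbTE D0) (negbTE v0).
exists w; split; last first.
  have -> : map_mx intr w = (g%:R^-1 * D : rat) *: v.
    by rewrite -scalerA -wv scalerA mulVf ?scale1r // pnatr_eq0.
  by apply: hcoordZ => //; rewrite mulf_neq0 // invr_eq0 pnatr_eq0.
rewrite /coprime_coords; set h := (\big[_/_]_i _)%N.
have : (g * h %| g)%N.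
  apply/dvdn_biggcdP => i _; rewrite -wE abszM mulnC /= dvdn_pmul2r ?lt0n //.
  exact: (biggcdn_inf i).
by rewrite -{2}[g]muln1 dvdn_pmul2l ?lt0n // dvdn1 => /eqP.
Qed.

Lemma biggcdZ (n : nat) (a : int) (x : 'rV[int]_n) :
  coprime_coords x -> (\big[gcdn/0]_i `|(a *: x) ord0 i|)%N = `|a|%N.
Proof.
move=> /(congr1 (muln `|a|%N)); rewrite muln1 => <-.
rewrite (big_morph (muln `|a|%N) (@muln_gcdr _) (muln0 _)).
by apply: eq_bigr => i _; rewrite mxE abszM.
Qed.

Lemma prim_rep_unique (n : nat) (P : projsp rat n) (x y : 'rV[int]_n.+1) :
  prim_rep P x -> prim_rep P y -> x = y \/ x = - y.
Proof.
move=> [x1 Px] [y1 Py].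
have /vlineP[c xy] : (map_mx intr x : 'rV[rat]_n.+1) \in <[map_mx intr y]>%VS.
  by rewrite -Py Px memv_line.
have xyE : denq c *: x = numq c *: y.
  apply/rowP => i; rewrite [LHS]mxE [RHS]mxE; apply: (@intr_inj rat).
  move/rowP: xy => /(_ i); rewrite !mxE => xyi.
  by rewrite !intrM xyi mulrA numqE [_ * c]mulrC.
have := biggcdZ (denq c) x1; rewrite xyE biggcdZ // => nd.
have d1 : `|denq c|%N = 1%N.
  by have := coprime_num_den c; rewrite nd /coprime gcdnn => /eqP.
have dE : denq c = 1 by rewrite -absz_denq d1.
rewrite dE scale1r in xyE; rewrite xyE.
move: nd; rewrite d1; case: (numq c) => [[|[|//]]|[|//]] // _.
  by left; rewrite scale1r.
by right; rewrite scaleN1r.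
Qed.

(* A choice of x in Z^(n+1) with coprime coordinates and P = [x]; the default
   value 0 is never used. *)
Definition rep (n : nat) (P : projsp rat n) : 'rV[int]_n.+1 := xget 0 (prim_rep P).

Lemma rep_prim (n : nat) (P : projsp rat n) : prim_rep P (rep P).
Proof. by have [x] := prim_rep_exists P; exact: xgetI. Qed.

(* The norm on 'rV[R]_4 is the supremum norm. *)
Definition height (R : realType) (P : biproj rat) : R :=
  `|map_mx intr (rep P.1) : 'rV[R]_4| ^+ 3 * `|map_mx intr (rep P.2) : 'rV[R]_4|.

Lemma rep_inj (n : nat) : injective (@rep n).
Proof.
move=> P Q PQ; apply/val_inj => /=.
by have [_ ->] := rep_prim P; have [_ ->] := rep_prim Q; rewrite PQ.
Qed.

Lemma ler_coord (R : realType) (x : 'rV[R]_4) i : `|x ord0 i| <= `|x|.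
Proof.
rewrite [leRHS]/Num.norm /= mx_normrE.
by apply: (le_bigmax _ (fun ij => `|x ij.1 ij.2|) (ord0, i)).
Qed.

Lemma rep_norm_ge1 (R : realType) (P : projsp rat 3) :
  1 <= `|map_mx intr (rep P) : 'rV[R]_4|.
Proof.
have [_ /hcoord_neq0/rV0Pn[i]] := rep_prim P; rewrite mxE intr_eq0 => ri.
apply: le_trans (ler_coord _ i); rewrite mxE -intr_norm ler1z.
by rewrite -gtz0_ge1 normr_gt0.
Qed.

Lemma finite_height (R : realType) (B : R) :
  finite_set [set P : biproj rat | height R P <= B].
Proof.
pose m := Num.truncn B.
pose S := [set x : 'rV[int]_4 | forall i, (`|x ord0 i| <= m)%N].
have finS : finite_set S.
  pose f (u : 'rV['I_(m + m).+1]_4) : 'rV[int]_4 :=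
    \row_i ((u ord0 i : nat)%:Z - m%:Z).
  apply: (@sub_finite_set _ _ (f @` setT)); last exact/finite_image/finite_finset.
  move=> x Sx; exists (\row_i inord (absz (x ord0 i + m%:Z))) => //.
  apply/rowP => i; have xi : (`|x ord0 i| <= m)%N by exact: Sx.
  rewrite !mxE; move: (x ord0 i) xi => z zm.
  by rewrite inordK; lia.
have fin2 := finite_setX finS finS.
pose r (P : biproj rat) := (rep P.1, rep P.2).
have rinj : injective r.
  by move=> [P1 P2] [Q1 Q2] [] /rep_inj -> /rep_inj ->.
apply: (@sub_finite_set _ _ (r @^-1` (S `*` S))); last first.
  apply: finite_preimage => // ? ? _ _; exact: rinj.
move=> P /= PB.
have key (x : 'rV[int]_4) : `|map_mx intr x : 'rV[R]_4| <= B -> S x.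
  move=> xB i; have B0 : 0 <= B by exact: le_trans xB.
  rewrite /m truncn_ge_nat //; apply: le_trans xB.
  by apply: le_trans (ler_coord _ i); rewrite mxE -intr_norm -abszE.
have h1 := rep_norm_ge1 R P.1; have h2 := rep_norm_ge1 R P.2.
split; apply: key; apply: le_trans PB; rewrite /height.
  rewrite -[leLHS]mulr1 ler_pM // exprS ler_peMr //.
  exact: exprn_ege1.
rewrite -[leLHS]mul1r ler_pM //; exact: exprn_ege1.
Qed.

(* fset_set would return the empty set on an infinite set; the set below is
   finite by finite_height. *)
Definition countN (R : realType) (U : zopen) (B : R) : nat :=
  #|` fset_set [set P | Upts U rat P /\ height R P <= B]|%fset.

(* Main.v *)
Require Import Defs.
From HB Require Import structures.
From mathcomp Require Import all_boot all_order all_algebra algC cyclotomic.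
From mathcomp Require Import finmap.
From mathcomp Require Import -(notations) mpoly.
From mathcomp Require Import boolp classical_sets cardinality reals.
From mathcomp Require Import normedtype sequences exp.
From mathcomp Require Import zify ring lra.

(* All the points counted lie in one fibre, over x = (e_0^3, ..., e_3^3): with
   y_i = Y_i / e_i it becomes the Fermat cubic, the sum of the Y_i^3 being 0,
   which is parametrized in degree 4 by pairs (u, v) of Eisenstein integers.
   Let g = a b m be squarefree and let s and t be roots of X^2 + X + 1 modulo b
   and m.  On the lattice where u = v mod a, u = s v mod b, and a third pair of
   congruences holds mod m (its index is g^2), the four coordinates Y_i are
   divisible by g.  Hence a box of side R with R^4 of order B g gives about B / g
   points of height at most B, and the sum of 1 / g over (a, b, s, m, t) has
   order (log B)^3, one logarithm for each of a, b and m.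
   A sieve discards the pairs (u, v) which are not coprime, or which satisfy a
   congruence of the same kind at a further prime, so that no point is counted
   twice, and the zeros of an equation of the complement of U (Schwartz-Zippel).
   All of this takes place in a fixed residue class modulo M = P! with g prime to
   M; on average over the tuples the sieve loses sums of 1 / p^2 over primes
   p > P, a small proportion once P is large. *)

Set Implicit Arguments.
Unset Strict Implicit.
Unset Printing Implicit Defensive.

Import Order.TTheory GRing.Theory Num.Theory.
Import numFieldNormedType.Exports.
Local Open Scope ring_scope.

(** * Eisenstein integers *)

(** The exponent 3 comes from the chosen fibre: when every x_i is a cube, the diagonal cubic surface
    over x is isomorphic over Q to the Fermat one, whose Picard group over Q has rank 4, and growth
    of order B (log B)^3 is to be expected on it. The three families of congruences are the ways in
    which D = v N(v) - u N(u) can vanish modulo p: either u = r v with r^3 = 1, where r = 1 gives a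
    and r = s gives b, or N(u) = N(v) = 0 with u and v in conjugate primes above p, which gives m.
    Only the order of magnitude is wanted, so a, b and m can be kept below a tiny power of B, about
    B^(2/211). Every box is then much larger than the index of its lattice, all counts reduce to
    elementary counts of residues, and the price is only a constant factor. *)

Definition eis : Type := (int * int)%type.
HB.instance Definition _ := GRing.Zmodule.copy eis (int * int)%type.

(* (a, b) stands for a + b w with w ^ 2 + w + 1 = 0. *)
Definition eis1 : eis := (1, 0).
Definition eis_mul (x y : eis) : eis :=
  (x.1 * y.1 - x.2 * y.2, x.1 * y.2 + x.2 * y.1 - x.2 * y.2).

Lemma eis_mulA : associative eis_mul.
Proof. by move=> [a b] [c d] [e f]; congr pair => /=; ring. Qed.
Lemma eis_mulC : commutative eis_mul.
Proof. by move=> [a b] [c d]; congr pair => /=; ring. Qed.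
Lemma eis_mul1 : left_id eis1 eis_mul.
Proof. by move=> [a b]; congr pair => /=; ring. Qed.
Lemma eis_mulD : left_distributive eis_mul +%R.
Proof. by move=> [a b] [c d] [e f]; congr pair => /=; ring. Qed.
Lemma eis1_neq0 : eis1 != 0.
Proof. by []. Qed.
HB.instance Definition _ := GRing.Zmodule_isComNzRing.Build eis
  eis_mulA eis_mulC eis_mul1 eis_mulD eis1_neq0.

Lemma eis_mulE (x y : eis) :
  x * y = (x.1 * y.1 - x.2 * y.2, x.1 * y.2 + x.2 * y.1 - x.2 * y.2).
Proof. by []. Qed.
Lemma eis_addE (x y : eis) : x + y = (x.1 + y.1, x.2 + y.2).
Proof. by []. Qed.
Lemma eis_oppE (x : eis) : - x = (- x.1, - x.2).
Proof. by []. Qed.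

Definition nrm (R : pzRingType) (a b : R) : R := a ^+ 2 - a * b + b ^+ 2.
Definition eN (x : eis) : int := nrm x.1 x.2.
Definition econj (x : eis) : eis := (x.1 - x.2, - x.2).

Lemma eN_mul (x y : eis) : eN (x * y) = eN x * eN y.
Proof. by rewrite /eN /nrm /=; ring. Qed.

Lemma mul_econj (x : eis) : x * econj x = (eN x, 0).
Proof. by rewrite eis_mulE /eN /nrm /=; congr pair; ring. Qed.

Lemma eN_conj (x : eis) : eN (econj x) = eN x.
Proof. by rewrite /eN /nrm /=; ring. Qed.

Lemma eN_ge0 (x : eis) : 0 <= eN x.
Proof. by rewrite /eN /nrm; nia. Qed.

Lemma eN_eq0 (x : eis) : (eN x == 0) = (x == 0).
Proof.
apply/eqP/eqP => [|->]; last by [].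
case: x => a b; rewrite /eN /nrm /= => h.
have -> : b = 0 by nia.
have -> : a = 0 by nia.
by [].
Qed.

Lemma eis_mulI (x y z : eis) : x != 0 -> x * y = x * z -> y = z.
Proof.
move=> x0 xyz; apply/eqP; rewrite -subr_eq0 -eN_eq0.
have : eN x * eN (y - z) == 0 by rewrite -eN_mul mulrBr xyz subrr.
by rewrite mulf_eq0 !eN_eq0 (negbTE x0).
Qed.

Lemma round_div (a n : int) : 0 < n -> exists q, `|(a - q * n) *+ 2| <= n.
Proof.
move=> n0; exists ((a *+ 2 + n) %/ (n *+ 2))%Z.
have := divz_eq (a *+ 2 + n) (n *+ 2).
have n2 : 0 < n *+ 2 by lia.
have := ltz_pmod (a *+ 2 + n) n2; have := modz_ge0 (a *+ 2 + n) (lt0r_neq0 n2).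
move: (_ %/ _)%Z (_ %% _)%Z => q r; nia.
Qed.

(** Round the two coordinates of x conj(y) / N(y) to nearest integers: an error of at most 1/2 in
    each has norm at most 3/4. *)
Lemma eis_div (x y : eis) : y != 0 -> exists q, eN (x - q * y) < eN y.
Proof.
move=> y0; have n0 : 0 < eN y by rewrite lt_def eN_eq0 y0 eN_ge0.
have [q1 h1] := round_div (x * econj y).1 n0.
have [q2 h2] := round_div (x * econj y).2 n0.
exists (q1, q2).
set r1 := (_ - _) in h1; set r2 := (_ - _) in h2.
have E : (x - ((q1, q2) : eis) * y) * econj y = (r1, r2).
  rewrite mulrBl -mulrA mul_econj; rewrite /r1 /r2.
  by rewrite eis_addE eis_oppE !eis_mulE /=; congr pair; ring.
have := congr1 eN E; rewrite eN_mul.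
rewrite eN_conj; move: (eN (_ - _)) n0 h1 h2 => e; rewrite /eN /nrm /=.
move: (_ + _) => n n0 h1 h2 E2.
have : 4 * (e * n) < 4 * (n * n) by nia.
by nia.
Qed.

Lemma eis_bezout (x y : eis) : exists k x' y' p q : eis,
  [/\ x = k * x', y = k * y' & k = p * x + q * y].
Proof.
have [n] := ubnP `|eN y|%N; elim: n x y => // n IHn x y yn.
have [->|y0] := eqVneq y 0.
  by exists x, 1, 0, 1, 0; split; ring.
have [q hq] := eis_div x y0.
have [|k [x' [y' [a [b [h1 h2 h3]]]]]] := IHn y (x - q * y).
  by have := eN_ge0 (x - q * y); have := eN_ge0 y; lia.
exists k, (y' + q * x'), x', b, (a - b * q); split=> //.
  by rewrite mulrDr -h2 mulrCA -h1 subrK.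
by rewrite h3; ring.
Qed.

(** Multiplication by a unit rotates x into the sector between 1 and w. This lets the sieve run over
    gcds indexed by pairs of natural numbers. *)
Lemma eis_assoc_nonneg (x : eis) : exists e f : eis,
  [/\ e * f = 1, 0 <= (e * x).1 & 0 <= (e * x).2].
Proof.
case: x => a b.
have [a0|a0] := leP 0 a; have [b0|b0] := leP 0 b.
- by exists 1, 1; rewrite !mul1r.
- exists (1, 1), (0, -1); split; rewrite ?eis_mulE //=; lia.
- exists (-1, -1), (0, 1); split; rewrite ?eis_mulE //=; lia.
- exists (-1), (-1); split; rewrite ?eis_mulE //=; lia.
Qed.

Lemma eis_gcd (x y : eis) : exists k x' y' p q : eis,
  [/\ x = k * x', y = k * y', k = p * x + q * y & 0 <= k.1 /\ 0 <= k.2].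
Proof.
have [k [x' [y' [p [q [h1 h2 h3]]]]]] := eis_bezout x y.
have [e [f [ef k1 k2]]] := eis_assoc_nonneg k.
have E z : k * z = e * k * (f * z).
  by transitivity (e * f * (k * z)); [rewrite ef mul1r | ring].
exists (e * k), (f * x'), (f * y'), (e * p), (e * q); split=> //.
- by rewrite -E.
- by rewrite -E.
- by rewrite h3; ring.
Qed.

Lemma eN1_unit (k : eis) : eN k = 1 -> econj k * k = 1.
Proof. by rewrite mulrC mul_econj => ->. Qed.

Lemma nrm_eq1_le (a b : int) : nrm a b = 1 -> `|b| <= 1.
Proof. by rewrite /nrm => h; nia. Qed.

(* Two coprime pairs with the same ratio differ by a unit, and only the unit 1
   is congruent to 1 modulo M. *)
Lemma eis_ratio_inj (M : int) (u v u' v' p q p' q' : eis) : 2 < M ->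
  p * u + q * v = 1 -> p' * u' + q' * v' = 1 -> u * v' = u' * v ->
  (M %| v.1 - 1)%Z -> (M %| v.2)%Z -> (M %| v'.1 - 1)%Z -> (M %| v'.2)%Z ->
  u = u' /\ v = v'.
Proof.
move=> M2 h h' uv c1 c2 c1' c2'.
(* These are v' / v and v / v', which the Bezout relations make Eisenstein integers. *)
set e := p * u' + q * v'; set f := p' * u + q' * v.
have ev : v' = e * v.
  rewrite -[LHS]mulr1 -h /e; transitivity (p * (u * v') + q * v * v'); first ring.
  by rewrite uv; ring.
have fv : v = f * v'.
  rewrite -[LHS]mulr1 -h' /f; transitivity (p' * (u' * v) + q' * v * v'); first ring.
  by rewrite -uv; ring.
have v0 : v != 0.
  apply/eqP => v0; move: c1; rewrite v0 /= dvdzE sub0r abszN dvdn1 => /eqP; lia.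
have fe : f * e = 1 by apply: (eis_mulI v0); rewrite mulr1 {2}fv ev; ring.
have Ne : eN e = 1.
  have : eN f * eN e = 1 by rewrite -eN_mul fe.
  have := eN_ge0 e; have := eN_ge0 f; move: (eN e) (eN f) => a b a0 b0 ab.
  have a1 : a <> 0 by move=> a1; rewrite a1 mulr0 in ab.
  have b1 : b <> 0 by move=> b1; rewrite b1 mul0r in ab.
  nia.
have e1 : e = 1.
  move: ev Ne c1 c2 c1' c2'; case: e {fe} => e1 e2; case: v {h uv v0 fv f h'} => a b.
  rewrite eis_mulE => -> /=; rewrite /eN /nrm /= => N1.
  move=> /dvdzP[x hx] /dvdzP[y hy] /dvdzP[z hz] /dvdzP[t ht].
  have ax : a = 1 + x * M by lia.
  rewrite hy ax in hz ht.
  have h2 : (M %| e2)%Z.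
    apply/dvdzP; exists (t - e1 * y - e2 * x + e2 * y); lia.
  have h1 : (M %| e1 - 1)%Z.
    apply/dvdzP; exists (z - e1 * x + e2 * y); lia.
  have small (x0 : int) : (M %| x0)%Z -> `|x0| <= 2 -> x0 = 0.
    move=> /dvdzP[r ->] {N1 h1 h2}; have [->|r0] := eqVneq r 0; first by rewrite mul0r.
    by rewrite normrM; nia.
  have e20 : e2 = 0.
    by apply: small => //; apply: le_trans (nrm_eq1_le N1) _.
  have e11 : e1 - 1 = 0.
    apply: small => //; move: N1; rewrite e20 /nrm mulr0 expr0n subr0 addr0.
    by clear; nia.
  by rewrite e20 -[e1](subrK 1) e11.
have vv : v' = v by rewrite ev e1 mul1r.
split=> //; apply: (eis_mulI v0); rewrite [RHS]mulrC -uv vv; ring.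
Qed.

(** * The Fermat cubic *)

(* With u = u1 + u2 w and v = v1 + v2 w, put D = v N(v) - u N(u) and
   k = conj(D) (1 - w); the point is given by Y0 + Y1 w = k v and
   -(Y2 + Y3 w) = k u. *)
Definition fermat_pt (R : pzRingType) (u1 u2 v1 v2 : R) (i : nat) : R :=
  let D1 := v1 * nrm v1 v2 - u1 * nrm u1 u2 in
  let D2 := v2 * nrm v1 v2 - u2 * nrm u1 u2 in
  let k1 := D1 - D2 *+ 2 in
  let k2 := - D1 - D2 in
  match i with
  | 0 => k1 * v1 - k2 * v2
  | 1 => k1 * v2 + k2 * v1 - k2 * v2
  | 2 => - (k1 * u1 - k2 * u2)
  | _ => - (k1 * u2 + k2 * u1 - k2 * u2)
  end.

(** For X = a + b w one has a^3 + b^3 = l(X) N(X) with the linear form l(X) = a + b. The sum is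
    therefore N(k) l(k v N(v) - k u N(u)) = N(k) l(k D), and k D = N(D) (1 - w) is killed by l. *)
Lemma fermat_pt_eq0 (R : comPzRingType) (u1 u2 v1 v2 : R) :
  \sum_(i < 4) fermat_pt u1 u2 v1 v2 i ^+ 3 = 0.
Proof.
rewrite !big_ord_recl big_ord0 /fermat_pt /=.
by rewrite /nrm; ring.
Qed.

(* Over an arbitrary ring, a point of the Fermat surface is recovered from
   its own coordinates, up to a scalar. *)
Lemma fermat_pt_section (R : comPzRingType) (y0 y1 y2 y3 : R) :
  y0 ^+ 3 + y1 ^+ 3 + y2 ^+ 3 + y3 ^+ 3 = 0 ->
  let c := (y0 * nrm y0 y1 + y2 * nrm y2 y3) *+ 3 in
  [/\ fermat_pt (- y2) (- y3) y0 y1 0%N = c * y0,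
      fermat_pt (- y2) (- y3) y0 y1 1%N = c * y1,
      fermat_pt (- y2) (- y3) y0 y1 2%N = c * y2 &
      fermat_pt (- y2) (- y3) y0 y1 3%N = c * y3].
Proof.
(* With v = y0 + y1 w and u = - (y2 + y3 w), the equation of the surface says that the coordinates
   of D are opposite, D = d (1 - w); then k is the scalar 3 d. *)
move=> h; have E : y1 * nrm y0 y1 + y3 * nrm y2 y3 =
  - (y0 * nrm y0 y1 + y2 * nrm y2 y3).
  by apply/eqP; rewrite -addr_eq0 -h /nrm; apply/eqP; ring.
rewrite /fermat_pt; have -> : nrm (- y2) (- y3) = nrm y2 y3 by rewrite /nrm; ring.
rewrite !mulNr !opprK E /=.
move: (y0 * _ + _) => d.
by split; ring.
Qed.

Definition eD (u v : eis) : eis := ((eN v, 0) : eis) * v - ((eN u, 0) : eis) * u.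
Definition ek (u v : eis) : eis := econj (eD u v) * (1, -1).

Lemma fermat_pt_eis (u v : eis) :
  let Y := fermat_pt u.1 u.2 v.1 v.2 in
  ek u v * v = (Y 0%N, Y 1%N) /\ ek u v * u = (- Y 2%N, - Y 3%N).
Proof.
case: u => u1 u2; case: v => v1 v2; rewrite /fermat_pt /ek /eD /econj.
rewrite eis_addE eis_oppE !eis_mulE /= /eN /=.
by split; congr pair; ring.
Qed.

(** The coordinates give back k u and k v, and k cancels in their ratio. *)
Lemma fermat_pt_ratio (u v u' v' : eis) (c c' : int) :
  let Y := fermat_pt u.1 u.2 v.1 v.2 in
  let Y' := fermat_pt u'.1 u'.2 v'.1 v'.2 in
  c != 0 -> ek u v != 0 -> (forall i, (i < 4)%N -> c * Y i = c' * Y' i) ->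
  u * v' = u' * v.
Proof.
move=> Y Y' c0 k0 h.
have [E1 E2] := fermat_pt_eis u v; have [E1' E2'] := fermat_pt_eis u' v'.
rewrite -/Y -/Y' in E1 E2 E1' E2'; clearbody Y Y'.
have H1 : ((c, 0) : eis) * (ek u v * v) = ((c', 0) : eis) * (ek u' v' * v').
  by rewrite E1 E1' !eis_mulE /= !mul0r !addr0 ?subr0 !h.
have H2 : ((c, 0) : eis) * (ek u v * u) = ((c', 0) : eis) * (ek u' v' * u').
  by rewrite E2 E2' !eis_mulE /= !mul0r !addr0 ?subr0 !mulrN !h.
have ck : ((c, 0) : eis) * ek u v != 0.
  rewrite -eN_eq0 eN_mul mulf_neq0 ?eN_eq0 //.
  by apply: contraNneq c0 => -[->].
apply: (eis_mulI ck).
transitivity (v' * (((c, 0) : eis) * (ek u v * u))); first by ring.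
rewrite H2; transitivity (u' * (((c', 0) : eis) * (ek u' v' * v'))); first by ring.
by rewrite -H1; ring.
Qed.

(** Under these congruences the first coordinate of D is 1 modulo M, so D is not 0, and N(k) = 3
    N(D). *)
Lemma ek_neq0 (M : int) (u v : eis) : 2 < M ->
  (M %| u.1)%Z -> (M %| v.1 - 1)%Z -> (M %| v.2)%Z -> ek u v != 0.
Proof.
move=> M2 hu hv1 hv2; apply/negP => /eqP k0.
have hN : eN (ek u v) = 3 * eN (eD u v).
  by rewrite /ek eN_mul /eN /nrm /=; ring.
have : eD u v == 0.
  by rewrite -eN_eq0; move: hN; rewrite k0 [eN 0]/eN /nrm /=; lia.
rewrite /eD eis_addE eis_oppE !eis_mulE /= => /eqP[] E _.
have : (M %| 1)%Z; last by rewrite dvdz1; lia.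
have -> : 1 = (- (v.1 ^+ 2 + v.1 + 1)) * (v.1 - 1) +
    1 * ((v.1 ^+ 2 - v.1 * v.2) * v.2 + eN u * u.1) :> int.
  by apply/eqP; rewrite -subr_eq0; apply/eqP; rewrite -[RHS]E /eN /nrm; ring.
by rewrite rpredD // dvdz_mull // rpredD // dvdz_mull.
Qed.

(** A format for divisibility certificates: the multipliers are given explicitly and the identity is
    left to [ring]. *)
Lemma dvdz_lc (d x y A B E : int) :
  E = x * A + y * B -> (d %| A)%Z -> (d %| B)%Z -> (d %| E)%Z.
Proof. by move=> -> hA hB; rewrite rpredD // dvdz_mull. Qed.

Lemma dvdz_lc3 (d x y z A B C E : int) :
  E = x * A + y * B + z * C ->
  (d %| A)%Z -> (d %| B)%Z -> (d %| C)%Z -> (d %| E)%Z.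
Proof. by move=> -> hA hB hC; rewrite !rpredD // dvdz_mull. Qed.

Lemma fermat_pt_dvd (d : int) (u v : eis) i :
  (d %| (eD u v).1)%Z -> (d %| (eD u v).2)%Z ->
  (d %| fermat_pt u.1 u.2 v.1 v.2 i)%Z.
Proof.
rewrite /eD eis_addE eis_oppE !eis_mulE /= !mul0r ?subr0 ?addr0.
rewrite /fermat_pt -/(eN u) -/(eN v) ![eN _ * _]mulrC.
move: (v.1 * _ - _) (v.2 * _ - _) => D1 D2 h1 h2.
have k1 : (d %| D1 - D2 *+ 2)%Z by rewrite rpredB // rpredMn.
have k2 : (d %| - D1 - D2)%Z by rewrite rpredB // rpredN.
by case: i => [|[|[|i]]] /=; rewrite ?rpredN ?(rpredB, rpredD) // dvdz_mulr.
Qed.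

Lemma nrm_bound (K a b : int) : 0 <= a <= K -> 0 <= b <= K -> 0 <= nrm a b <= K ^+ 2.
Proof. by rewrite /nrm; nia. Qed.

Lemma fermat_pt_le (K : int) (u1 u2 v1 v2 : int) i :
  0 <= u1 <= K -> 0 <= u2 <= K -> 0 <= v1 <= K -> 0 <= v2 <= K ->
  `|fermat_pt u1 u2 v1 v2 i| <= K ^+ 4 *+ 7.
Proof.
move=> hu1 hu2 hv1 hv2; have K0 : 0 <= K by lia.
have hN := @nrm_bound K.
have hM a b : 0 <= a <= K -> 0 <= b <= K ^+ 2 -> 0 <= a * b <= K ^+ 3.
  move=> /andP[a0 a1] /andP[b0 b1]; rewrite mulr_ge0 //= exprS.
  exact: ler_pM.
have hk (k a j : int) : `|k| <= K ^+ 3 * j -> 0 <= a <= K -> `|k * a| <= K ^+ 4 * j.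
  move=> hk /andP[a0 a1]; rewrite normrM (ger0_norm a0).
  have -> : K ^+ 4 * j = (K ^+ 3 * j) * K by ring.
  exact: ler_pM.
rewrite /fermat_pt.
have := hM _ _ hv1 (hN _ _ hv1 hv2); have := hM _ _ hv2 (hN _ _ hv1 hv2).
have := hM _ _ hu1 (hN _ _ hu1 hu2); have := hM _ _ hu2 (hN _ _ hu1 hu2).
move: (_ * nrm _ _) (_ * nrm _ _) (_ * nrm _ _) (_ * nrm _ _) => a b c e ha hb hc he.
set k1 := _ - _ *+ 2; set k2 := - _ - _.
(* The longest coordinates are sums of one term in k1 and two in k2, whence 7 = 3 + 2 + 2. *)
have h1 : `|k1| <= K ^+ 3 * 3 by rewrite /k1; lia.
have h2 : `|k2| <= K ^+ 3 * 2 by rewrite /k2; lia.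
move: k1 k2 h1 h2 => k1 k2 h1 h2.
have := hk _ _ _ h1 hu1; have := hk _ _ _ h1 hu2.
have := hk _ _ _ h1 hv1; have := hk _ _ _ h1 hv2.
have := hk _ _ _ h2 hu1; have := hk _ _ _ h2 hu2.
have := hk _ _ _ h2 hv1; have := hk _ _ _ h2 hv2.
move: (k1 * _) (k1 * _) (k1 * _) (k1 * _) (k2 * _) (k2 * _) (k2 * _) (k2 * _).
by case: i => [|[|[|i]]] /=; lia.
Qed.

(** * Lattices of pairs of Eisenstein integers *)

(* For n prime to 3, s stands for a cube root of unity, different from 1 modulo
   each prime factor of n. *)
Definition om_root (n s : nat) : bool := (s < n)%N && (n %| s ^ 2 + s + 1)%N.

Lemma om_rootP (n s : nat) : om_root n s -> (n%:Z %| s%:Z ^+ 2 + s%:Z + 1)%Z.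
Proof. by case/andP=> _; rewrite dvdzE; congr (_ %| _)%N; lia. Qed.

Definition om_roots (n : nat) : seq nat := [seq s <- iota 0 n | om_root n s].

Lemma mem_om_roots n s : (s \in om_roots n) = om_root n s.
Proof. by rewrite mem_filter mem_iota /= add0n andb_idr // => /andP[]. Qed.

Lemma om_root_mod (n d s : nat) : (0 < d)%N -> (d %| n)%N -> om_root n s -> om_root d (s %% d).
Proof.
move=> d0 dn /andP[_ h]; rewrite /om_root ltn_mod d0 /=.
have := dvdn_trans dn h.
have E (q r : nat) : ((q * d + r) ^ 2 + (q * d + r) + 1 =
  q * (q * d + r * 2 + 1) * d + (r ^ 2 + r + 1))%N by ring.
by rewrite {1 2}(divn_eq s d) E dvdn_addr // dvdn_mull.
Qed.

(* The last two congruences put u and v in the two conjugate ideals of norm m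
   determined by t. *)
Definition in_lat (a b s m t : nat) (u v : eis) : bool :=
  [&& (a %| u.1 - v.1)%Z, (a %| u.2 - v.2)%Z,
      (b %| u.1 - s%:Z * v.1)%Z, (b %| u.2 - s%:Z * v.2)%Z,
      (m %| u.1 + t%:Z * u.2)%Z & (m %| v.1 + t%:Z ^+ 2 * v.2)%Z].

(** The class u = 0, v = 1 modulo M singles out one pair among its unit multiples and makes D and
    N(v) equal to 1 modulo M, so that the primes dividing M need no sieving. *)
Definition in_class (M : nat) (u v : eis) : bool :=
  [&& (M %| u.1)%Z, (M %| u.2)%Z, (M %| v.1 - 1)%Z & (M %| v.2)%Z].

(* The ways in which a prime p other than 3 can divide v N(v) - u N(u) through
   congruences like those of in_lat. *)
Definition typed_at (p : nat) (u v : eis) : bool :=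
  has (fun r : nat => (p %| u.1 - r%:Z * v.1)%Z && (p %| u.2 - r%:Z * v.2)%Z)
    (1%N :: om_roots p)
  || ((p %| eN u)%Z && (p %| eN v)%Z).

Definition admissible (M a b s m t : nat) : bool :=
  [&& coprime (a * b * m) M, om_root b s & om_root m t].

Definition squarefree (n : nat) : Prop := forall p, prime p -> ~~ (p ^ 2 %| n)%N.

(* These conditions make (a, b, s, m, t) a function of (u, v), see lat_unique. *)
Definition exact_type (K M a b m : nat) (u v : eis) : Prop :=
  [/\ forall p, prime p -> (p <= K)%N -> coprime p (M * (a * b * m)) -> ~~ typed_at p u v,
      forall p, prime p -> (p %| a * b)%N -> ~~ (p %| eN v)%Z &
      forall p, prime p -> (p %| m)%N -> ~~ (p %| u.2)%Z /\ ~~ (p %| v.2)%Z].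

Lemma squarefree_dvd (n x : nat) : (0 < n)%N -> squarefree n ->
  (forall p, prime p -> (p %| n)%N -> (p %| x)%N) -> (n %| x)%N.
Proof.
move=> n0 sf h; have [->|x0] := posnP x; first exact: dvdn0.
apply/dvdn_partP => // p; rewrite mem_primes => /and3P[pp _ pn].
rewrite p_part; have : (logn p n <= 1)%N.
  by rewrite leqNgt -pfactor_dvdn // sf.
case: (logn p n) => [|[|//]] _; rewrite ?dvd1n // expn1; exact: h.
Qed.

Lemma squarefree_dvdn (d n : nat) : (d %| n)%N -> squarefree n -> squarefree d.
Proof. by move=> dn sf p pp; apply: contra (sf p pp) => /dvdn_trans; exact. Qed.

Lemma Euclid_dvdzM (p : nat) (x y : int) :
  prime p -> (p %| x * y)%Z = (p %| x)%Z || (p %| y)%Z.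
Proof. by move=> pp; rewrite !dvdzE abszM Euclid_dvdM. Qed.

Lemma dvdz3 (p : nat) (x : int) : coprime p 3 -> (p %| 3 * x)%Z -> (p %| x)%Z.
Proof. by move=> c; rewrite Gauss_dvdzr. Qed.

(** Modulo p the norm a^2 - a b + b^2 factors as (a + t b)(a + t^2 b). *)
Lemma lat_eN (p : nat) (t : int) (u v : eis) : (p %| t ^+ 2 + t + 1)%Z ->
  (p %| u.1 + t * u.2)%Z -> (p %| v.1 + t ^+ 2 * v.2)%Z ->
  (p %| eN u)%Z && (p %| eN v)%Z.
Proof.
move=> hP h1 h2; apply/andP; split.
  apply: (dvdz_lc (x := u.1 - (1 + t) * u.2) (y := u.2 ^+ 2) _ h1 hP).
  by rewrite /eN /nrm; ring.
apply: (dvdz_lc (x := v.1 + t * v.2) (y := - (v.1 + t * v.2) * v.2 + v.2 ^+ 2) _ h2 hP).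
by rewrite /eN /nrm; ring.
Qed.

(* The next lemmas say that two of the conditions defining the lattices force
   u or v to be degenerate at p. *)
Lemma clash_1_om (p : nat) (s : int) (u v : eis) : coprime p 3 ->
  (p %| s ^+ 2 + s + 1)%Z ->
  (p %| u.1 - v.1)%Z -> (p %| u.2 - v.2)%Z ->
  (p %| u.1 - s * v.1)%Z -> (p %| u.2 - s * v.2)%Z -> (p %| eN v)%Z.
Proof.
move=> p3 hS h1 h2 k1 k2.
(* (s + 2)(1 - s) = 3 - (s^2 + s + 1), so 1 - s is invertible modulo p while (1 - s) v = 0. *)
have H1 : (p %| v.1)%Z.
  by apply: (dvdz3 p3); apply: (dvdz_lc3 (x := - (s + 2)) (y := s + 2) (z := v.1) _ h1 k1 hS); ring.
have H2 : (p %| v.2)%Z.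
  by apply: (dvdz3 p3); apply: (dvdz_lc3 (x := - (s + 2)) (y := s + 2) (z := v.2) _ h2 k2 hS); ring.
by apply: (dvdz_lc (x := v.1 - v.2) (y := v.2) _ H1 H2); rewrite /eN /nrm; ring.
Qed.

(** (2 t + 1)^2 = -3 modulo p, the discriminant of X^2 + X + 1, which is invertible. *)
Lemma om_disc (p : nat) (t x : int) : coprime p 3 -> (p %| t ^+ 2 + t + 1)%Z ->
  (p %| (2 * t + 1) * x)%Z -> (p %| x)%Z.
Proof.
move=> p3 hP h; apply: (dvdz3 p3).
by apply: (dvdz_lc (x := 4 * x) (y := - (2 * t + 1)) _ hP h); ring.
Qed.

Lemma clash_1_inf (p : nat) (t : int) (u v : eis) : coprime p 3 ->
  (p %| t ^+ 2 + t + 1)%Z ->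
  (p %| u.1 - v.1)%Z -> (p %| u.2 - v.2)%Z ->
  (p %| u.1 + t * u.2)%Z -> (p %| v.1 + t ^+ 2 * v.2)%Z -> (p %| u.2)%Z.
Proof.
move=> p3 hP d1 d2 h1 h2; apply: (om_disc p3 hP).
have h3 := dvdz_lc (x := 1) (y := - 1) erefl h1 h2.
have h4 := dvdz_lc (x := 1) (y := t ^+ 2) erefl d1 d2.
by apply: (dvdz_lc3 (x := 1) (y := - 1) (z := u.2) _ h3 h4 hP); ring.
Qed.

Lemma clash_om_inf (p : nat) (s t : int) (u v : eis) : coprime p 3 ->
  (p %| s ^+ 2 + s + 1)%Z -> (p %| t ^+ 2 + t + 1)%Z ->
  (p %| u.1 - s * v.1)%Z -> (p %| u.2 - s * v.2)%Z ->
  (p %| u.1 + t * u.2)%Z -> (p %| v.1 + t ^+ 2 * v.2)%Z -> (p %| v.2)%Z.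
Proof.
move=> p3 hS hP d1 d2 h1 h2; apply: (om_disc p3 hP).
have h3 := dvdz_lc (x := 1) (y := - s) erefl h1 h2.
have h4 := dvdz_lc (x := 1) (y := t) erefl d1 d2.
have h5 := dvdz_lc (x := 1) (y := - 1) erefl h3 h4.
apply: (dvdz_lc3 (x := - (s + 1)) (y := (t - t ^+ 2) * v.2) (z := v.2) _ h5 hS hP).
by ring.
Qed.

Lemma clash_om_om (p : nat) (s s' : int) (u v : eis) : prime p ->
  (p %| u.1 - s * v.1)%Z -> (p %| u.2 - s * v.2)%Z ->
  (p %| u.1 - s' * v.1)%Z -> (p %| u.2 - s' * v.2)%Z ->
  (p %| s - s')%Z || (p %| eN v)%Z.
Proof.
move=> pp h1 h2 k1 k2; have [//|ns] := boolP (p %| s - s')%Z => /=.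
have H1 : (p %| v.1)%Z.
  have : (p %| (s - s') * v.1)%Z.
    by apply: (dvdz_lc (x := - 1) (y := 1) _ h1 k1); ring.
  by rewrite Euclid_dvdzM // (negbTE ns).
have H2 : (p %| v.2)%Z.
  have : (p %| (s - s') * v.2)%Z.
    by apply: (dvdz_lc (x := - 1) (y := 1) _ h2 k2); ring.
  by rewrite Euclid_dvdzM // (negbTE ns).
by apply: (dvdz_lc (x := v.1 - v.2) (y := v.2) _ H1 H2); rewrite /eN /nrm; ring.
Qed.

Lemma clash_inf_inf (p : nat) (t t' : int) (u : eis) : prime p ->
  (p %| u.1 + t * u.2)%Z -> (p %| u.1 + t' * u.2)%Z ->
  (p %| t - t')%Z || (p %| u.2)%Z.
Proof.
move=> pp h1 h2; rewrite -Euclid_dvdzM //.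
by apply: (dvdz_lc (x := 1) (y := - 1) _ h1 h2); ring.
Qed.

(** Since p divides N(k), k lies in one of the two conjugate primes attached to t. One of k u and k
    v is assumed to lie in the other prime too, hence is divisible by p. *)
Lemma clash_inf_gcd (p : nat) (t : int) (k u v : eis) : prime p -> coprime p 3 ->
  (p %| t ^+ 2 + t + 1)%Z -> (p %| eN k)%Z ->
  (p %| (k * u).1 + t * (k * u).2)%Z -> (p %| (k * v).1 + t ^+ 2 * (k * v).2)%Z ->
  (p %| (k * u).2)%Z || (p %| (k * v).2)%Z.
Proof.
move=> pp p3 hP hk h1 h2.
have : (p %| (k.1 + t * k.2) * (k.1 - (1 + t) * k.2))%Z.
  by apply: (dvdz_lc (x := 1) (y := - k.2 ^+ 2) _ hk hP); rewrite /eN /nrm; ring.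
rewrite Euclid_dvdzM // => /orP[] hf; apply/orP; [right|left].
  apply: (om_disc p3 hP); move: h2; rewrite !eis_mulE /= => h2.
  have h3 := dvdz_lc (x := v.1 + t * v.2) (y := - k.2 * v.2) erefl hf hP.
  apply: (dvdz_lc3 (x := 1) (y := - 1) (z := k.1 * v.2 + k.2 * v.1 - k.2 * v.2) _ h3 h2 hP).
  by ring.
apply: (om_disc p3 hP); move: h1; rewrite !eis_mulE /= => h1.
have h3 := dvdz_lc (x := u.1 - (1 + t) * u.2) (y := - k.2 * u.2) erefl hf hP.
apply: (dvdz_lc (x := - 1) (y := 1) _ h3 h1).
by ring.
Qed.

Lemma admissibleP (M a b s m t : nat) : admissible M a b s m t ->
  [/\ coprime (a * b * m) M, (b%:Z %| s%:Z ^+ 2 + s%:Z + 1)%Z &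
      (m%:Z %| t%:Z ^+ 2 + t%:Z + 1)%Z].
Proof. by case/and3P=> h /om_rootP hs /om_rootP ht. Qed.

Lemma dvdz_natl (d n : nat) (x : int) : (d %| n)%N -> (n%:Z %| x)%Z -> (d%:Z %| x)%Z.
Proof. by move=> dn; apply: dvdz_trans; rewrite dvdzE. Qed.

(** A prime of the second tuple makes (u, v) typed at p, so by exactness of the first tuple p
    divides a b m; the clash lemmas then rule out every type at p except the same one with the same
    root. *)
Lemma lat_type (K M p a b s m t a' b' s' m' t' : nat) (u v : eis) :
  prime p -> (p <= K)%N -> (3 %| M)%N ->
  admissible M a b s m t -> admissible M a' b' s' m' t' ->
  in_lat a b s m t u v -> in_lat a' b' s' m' t' u v ->
  exact_type K M a b m u v -> exact_type K M a' b' m' u v ->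
  [/\ (p %| a')%N -> (p %| a)%N,
      (p %| b')%N -> (p %| b)%N && (p %| s%:Z - s'%:Z)%Z &
      (p %| m')%N -> (p %| m)%N && (p %| t%:Z - t'%:Z)%Z].
Proof.
move=> pp pK M3 adm adm' /and5P[ha1 ha2 hb1 hb2 /andP[hm1 hm2]].
move=> /and5P[ha1' ha2' hb1' hb2' /andP[hm1' hm2']] [e1 e2 e3] [e1' e2' e3'].
have [cM hS hP] := admissibleP adm; have [cM' hS' hP'] := admissibleP adm'.
have cpM : (p %| a' * b' * m')%N -> coprime p M.
  by move=> /coprime_dvdl; apply.
have cp3 : (p %| a' * b' * m')%N -> coprime p 3.
  by move=> /cpM; apply: coprime_dvdr.
have untyped : (p %| a' * b' * m')%N -> typed_at p u v -> (p %| a * b * m)%N.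
  move=> /cpM c ty; apply: contraLR ty; rewrite -prime_coprime // => c'.
  by apply: e1 => //; rewrite coprimeMr c.
split=> pd.
- have pg : (p %| a' * b' * m')%N by rewrite -mulnA dvdn_mulr.
  have p3 := cp3 pg; move/(dvdz_natl pd): ha1' => h1; move/(dvdz_natl pd): ha2' => h2.
  have : (p %| a * b * m)%N.
    by apply: untyped => //; rewrite /typed_at /= !mul1r h1 h2.
  rewrite Euclid_dvdM // => /orP[pab|pm]; last first.
    have [/negP[]] := e3 _ pp pm.
    exact: (clash_1_inf p3 (dvdz_natl pm hP) h1 h2 (dvdz_natl pm hm1) (dvdz_natl pm hm2)).
  move: (pab); rewrite Euclid_dvdM // => /orP[//|pb].
  case/negP: (e2 _ pp pab).
  exact: (clash_1_om p3 (dvdz_natl pb hS) h1 h2 (dvdz_natl pb hb1) (dvdz_natl pb hb2)).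
- have pg : (p %| a' * b' * m')%N by rewrite mulnAC dvdn_mull.
  have p3 := cp3 pg; move: (dvdz_natl pd hb1') (dvdz_natl pd hb2') => h1 h2.
  have : (p %| a * b * m)%N.
    apply: untyped => //; rewrite /typed_at; apply/orP; left; apply/hasP.
    exists (s' %% p)%N.
      by rewrite inE mem_om_roots (om_root_mod (prime_gt0 pp) pd) ?orbT //; case/and3P: adm'.
    have E (x y : int) : (p %| x - s'%:Z * y)%Z -> (p %| x - (s' %% p)%N%:Z * y)%Z.
      move=> h; apply: (dvdz_lc (x := 1) (y := (s' %/ p)%N%:Z * y) _ h (dvdzz p)).
      have Es : s'%:Z = (s' %/ p)%N%:Z * p%:Z + (s' %% p)%N%:Z by rewrite -PoszM -PoszD -divn_eq.
      by rewrite Es; ring.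
    by rewrite !E.
  rewrite Euclid_dvdM // => /orP[pab|pm]; last first.
    have [_ /negP[]] := e3 _ pp pm.
    exact: (clash_om_inf p3 (dvdz_natl pd hS') (dvdz_natl pm hP) h1 h2
      (dvdz_natl pm hm1) (dvdz_natl pm hm2)).
  have nN := e2 _ pp pab.
  move: (pab); rewrite Euclid_dvdM // => /orP[pa|pb].
    case/negP: nN; exact: (clash_1_om p3 (dvdz_natl pd hS')
      (dvdz_natl pa ha1) (dvdz_natl pa ha2) h1 h2).
  by have := clash_om_om pp (dvdz_natl pb hb1) (dvdz_natl pb hb2) h1 h2; rewrite (negbTE nN) orbF pb.
- have pg : (p %| a' * b' * m')%N by rewrite dvdn_mull.
  have p3 := cp3 pg; move: (dvdz_natl pd hm1') (dvdz_natl pd hm2') => h1 h2.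
  have NN := lat_eN (dvdz_natl pd hP') h1 h2; case/andP: (NN) => N1 N2.
  have : (p %| a * b * m)%N by apply: untyped => //; rewrite /typed_at NN orbT.
  rewrite Euclid_dvdM // => /orP[pab|pm]; first by have := e2 _ pp pab; rewrite N2.
  have [n1 n2] := e3 _ pp pm.
  by have := clash_inf_inf pp (dvdz_natl pm hm1) h1; rewrite (negbTE n1) orbF pm.
Qed.

(** [lat_type] is applied in both directions at each prime. Squarefreeness lets the primes determine
    a, b, m and lets the congruences at primes determine s and t, which are reduced modulo b and
    m. *)
Lemma lat_unique (K M a b s m t a' b' s' m' t' : nat) (u v : eis) :
  (3 %| M)%N -> (0 < a * b * m <= K)%N -> (0 < a' * b' * m' <= K)%N ->
  squarefree (a * b * m) -> squarefree (a' * b' * m') ->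
  admissible M a b s m t -> admissible M a' b' s' m' t' ->
  in_lat a b s m t u v -> in_lat a' b' s' m' t' u v ->
  exact_type K M a b m u v -> exact_type K M a' b' m' u v ->
  [/\ a = a', b = b', s = s', m = m' & t = t'].
Proof.
move=> M3 /andP[g0 gK] /andP[g0' gK'] sf sf' adm adm' l l' e e'.
move: (g0) (g0'); rewrite !muln_gt0 => /andP[/andP[a0 b0] m0] /andP[/andP[a0' b0'] m0'].
have pK p : (p %| a * b * m)%N -> (p <= K)%N by move=> /(dvdn_leq g0) /leq_trans; apply.
have pK' p : (p %| a' * b' * m')%N -> (p <= K)%N by move=> /(dvdn_leq g0') /leq_trans; apply.
have da x y z : (x %| x * y * z)%N by rewrite -mulnA dvdn_mulr.
have db x y z : (y %| x * y * z)%N by rewrite mulnAC dvdn_mull.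
have dm x y z : (z %| x * y * z)%N by rewrite dvdn_mull.
have T p pp pk := lat_type (p := p) pp pk M3 adm adm' l l' e e'.
have T' p pp pk := lat_type (p := p) pp pk M3 adm' adm l' l e' e.
have Ea : a = a'.
  apply/eqP; rewrite eqn_dvd; apply/andP; split.
    apply: squarefree_dvd => // [|p pp pd]; first exact: squarefree_dvdn (da _ _ _) sf.
    by have [h _ _] := T' p pp (pK _ (dvdn_trans pd (da _ _ _))); apply: h.
  apply: squarefree_dvd => // [|p pp pd]; first exact: squarefree_dvdn (da _ _ _) sf'.
  by have [h _ _] := T p pp (pK' _ (dvdn_trans pd (da _ _ _))); apply: h.
have Eb : b = b'.
  apply/eqP; rewrite eqn_dvd; apply/andP; split.
    apply: squarefree_dvd => // [|p pp pd]; first exact: squarefree_dvdn (db _ _ _) sf.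
    by have [_ h _] := T' p pp (pK _ (dvdn_trans pd (db _ _ _))); case/andP: (h pd).
  apply: squarefree_dvd => // [|p pp pd]; first exact: squarefree_dvdn (db _ _ _) sf'.
  by have [_ h _] := T p pp (pK' _ (dvdn_trans pd (db _ _ _))); case/andP: (h pd).
have Em : m = m'.
  apply/eqP; rewrite eqn_dvd; apply/andP; split.
    apply: squarefree_dvd => // [|p pp pd]; first exact: squarefree_dvdn (dm _ _ _) sf.
    by have [_ _ h] := T' p pp (pK _ (dvdn_trans pd (dm _ _ _))); case/andP: (h pd).
  apply: squarefree_dvd => // [|p pp pd]; first exact: squarefree_dvdn (dm _ _ _) sf'.
  by have [_ _ h] := T p pp (pK' _ (dvdn_trans pd (dm _ _ _))); case/andP: (h pd).
have small (n x y : nat) : (x < n)%N -> (y < n)%N -> (n %| `|x%:Z - y%:Z|)%N -> x = y.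
  move=> xn yn; have : (`|x%:Z - y%:Z| < n)%N by lia.
  have [h|h] := posnP `|x%:Z - y%:Z|%N; first lia.
  by move=> lt /(dvdn_leq h); lia.
case/and3P: (adm) => _ /andP[sb _] /andP[tm _].
case/and3P: (adm') => _ /andP[sb' _] /andP[tm' _].
split=> //.
  apply: small sb _ _; first by rewrite Eb.
  apply: squarefree_dvd => // [|p pp pd]; first exact: squarefree_dvdn (db _ _ _) sf.
  have [_ h _] := T p pp (pK _ (dvdn_trans pd (db _ _ _))).
  by rewrite Eb in pd; case/andP: (h pd).
apply: small tm _ _; first by rewrite Em.
apply: squarefree_dvd => // [|p pp pd]; first exact: squarefree_dvdn (dm _ _ _) sf.
have [_ _ h] := T p pp (pK _ (dvdn_trans pd (dm _ _ _))).
by rewrite Em in pd; case/andP: (h pd).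
Qed.

(* For k = 0 this is always true. *)
Definition edvd (k x : eis) : bool :=
  (eN k %| (x * econj k).1)%Z && (eN k %| (x * econj k).2)%Z.

Lemma edvd_mul (k x : eis) : edvd k (k * x).
Proof.
rewrite /edvd; have -> : k * x * econj k = x * ((eN k, 0) : eis).
  by rewrite -mul_econj; ring.
by rewrite eis_mulE /= !mulr0 add0r !subr0 !dvdz_mull.
Qed.

Lemma edvdP (k x : eis) : k != 0 -> reflect (exists y, x = k * y) (edvd k x).
Proof.
move=> k0; apply: (iffP idP) => [/andP[/dvdzP[y1 h1] /dvdzP[y2 h2]]|[y ->]]; last exact: edvd_mul.
exists (y1, y2); have ck0 : econj k != 0.
  by rewrite -eN_eq0 eN_conj eN_eq0.
apply: (eis_mulI ck0); rewrite mulrC [RHS]mulrA [econj k * k]mulrC mul_econj.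
rewrite [LHS]surjective_pairing h1 h2 !eis_mulE /=; congr pair; ring.
Qed.

(** If the gcd k were not a unit, a prime P dividing N(k) would divide both norms. As N(v) is 1
    modulo M, P is prime to M; as the coordinates of k are at most J, P <= J^2 <= K, so exactness
    applies at P and each of its three clauses gives a contradiction. *)
Lemma lat_coprime (K J M a b s m t : nat) (u v : eis) :
  (1 < M)%N -> (3 %| M)%N -> (J ^ 2 <= K)%N -> admissible M a b s m t ->
  in_lat a b s m t u v -> in_class M u v -> exact_type K M a b m u v ->
  (forall x y : nat, (J < maxn x y)%N -> ~~ (edvd (x%:Z, y%:Z) u && edvd (x%:Z, y%:Z) v)) ->
  exists p q : eis, p * u + q * v = 1.
Proof.
move=> M1 M3 JK adm /and5P[ha1 ha2 hb1 hb2 /andP[hm1 hm2]].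
move=> /and4P[c1 c2 c3 c4] [e1 e2 e3] hbig.
have [cM hS hP] := admissibleP adm.
have [k [u' [v' [p [q [hu hv hk [k1 k2]]]]]]] := eis_gcd u v.
have hN : (M %| eN v - 1)%Z.
  apply: (dvdz_lc (x := v.1 + 1) (y := - v.1 + v.2) _ c3 c4).
  by rewrite /eN /nrm; ring.
have Nk : (eN k %| eN v)%Z by rewrite hv eN_mul dvdz_mulr.
have cNk : coprimez M (eN k).
  rewrite coprimezE; apply: (coprime_dvdr (Nk : (`|eN k| %| `|eN v|)%N)).
  rewrite -coprimezE.
  case/dvdzP: hN => z hz; apply/coprimezP; exists (- z, 1) => /=.
  by rewrite mul1r -[eN v](subrK 1) hz; ring.
have [k11|kn1] := eqVneq (eN k) 1.
  exists (econj k * p), (econj k * q).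
  by rewrite -!mulrA -mulrDr -hk eN1_unit.
have kne0 : eN k != 0.
  apply/eqP => k0; move: cNk M1; rewrite k0 /coprimez gcdz0 /=; clear; lia.
have [|P pP pk] := @pdivP `|eN k|%N.
  by have := eN_ge0 k; move: kne0 kn1; move: (eN k); clear; lia.
have small : (maxn `|k.1| `|k.2| <= J)%N.
  rewrite leqNgt; apply/negP => /hbig.
  rewrite !gez0_abs // -surjective_pairing; rewrite hu hv !edvd_mul //.
have PK : (P <= K)%N.
  apply: leq_trans (dvdn_leq _ pk) _; first by rewrite absz_gt0.
  apply: leq_trans JK; move: small; rewrite geq_max => /andP[s1 s2].
  have : 0 <= eN k <= J%:Z ^+ 2 by apply: nrm_bound; clear - s1 s2 k1 k2; lia.
  by move: (eN k) => n; rewrite -[J%:Z ^+ 2]PoszM; clear; lia.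
have cPM : coprime P M.
  by rewrite coprime_sym; apply: coprime_dvdr pk _; exact: cNk.
have P3 : coprime P 3 by apply: coprime_dvdr cPM.
have Nu : (P %| eN u)%Z by rewrite hu eN_mul dvdz_mulr.
have Nv : (P %| eN v)%Z by rewrite hv eN_mul dvdz_mulr.
have [pg|cg] := boolP (P %| a * b * m)%N; last first.
  rewrite -prime_coprime // in cg.
  have := e1 P pP PK; rewrite coprimeMr cPM => /(_ cg).
  by rewrite /typed_at Nu Nv orbT.
move: pg; rewrite Euclid_dvdM // => /orP[pab|pm].
  by have := e2 _ pP pab; rewrite Nv.
have [n1 n2] := e3 _ pP pm.
have := clash_inf_gcd (k := k) (u := u') (v := v') pP P3 (dvdz_natl pm hP) pk.
rewrite -hu -hv (negbTE n1) (negbTE n2) => H.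
by have := H (dvdz_natl pm hm1) (dvdz_natl pm hm2).
Qed.

(** If u = r v modulo d with an integer r such that r^3 = 1, then u N(u) = r^3 v N(v) = v N(v)
    modulo d; modulo m both norms vanish. Either way D is divisible, and the coordinates are
    multiples of D up to conjugation. *)
Lemma lat_dvd (a b s m t i : nat) (u v : eis) :
  coprime (a * b) m -> coprime a b ->
  (b%:Z %| s%:Z ^+ 2 + s%:Z + 1)%Z -> (m%:Z %| t%:Z ^+ 2 + t%:Z + 1)%Z ->
  in_lat a b s m t u v -> ((a * b * m)%N %| fermat_pt u.1 u.2 v.1 v.2 i)%Z.
Proof.
move=> cabm cab hS hP /and5P[ha1 ha2 hb1 hb2 /andP[hm1 hm2]].
have Dk (d : nat) (r : int) : (d %| r ^+ 3 - 1)%Z -> (d %| u.1 - r * v.1)%Z ->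
    (d %| u.2 - r * v.2)%Z -> (d %| (eD u v).1)%Z && (d %| (eD u v).2)%Z.
  move=> hr /dvdzP[x hx] /dvdzP[y hy]; case/dvdzP: hr => z hz.
  have ux : u.1 = r * v.1 + x * d by rewrite -hx; ring.
  have uy : u.2 = r * v.2 + y * d by rewrite -hy; ring.
  have r3 : r ^+ 3 = 1 + z * d by rewrite -hz; ring.
  set e : eis := (x, y).
  have ue : u = ((r, 0) : eis) * v + ((d%:Z, 0) : eis) * e.
    rewrite [LHS]surjective_pairing ux uy eis_addE !eis_mulE /=; congr pair; ring.
  have Nu : exists w : int, eN u = r ^+ 2 * eN v + w * d%:Z.
    exists (r * (v.1 * x *+ 2 - v.1 * y - v.2 * x + v.2 * y *+ 2) + d%:Z * nrm x y).
    by rewrite /eN ux uy /nrm; ring.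
  case: Nu => w Nu; rewrite /eD eis_addE eis_oppE !eis_mulE /= !mul0r !subr0 ?addr0 Nu.
  apply/andP; split; apply/dvdzP.
    exists (- z * eN v * v.1 - r ^+ 2 * eN v * x - w * u.1).
    transitivity ((1 - r ^+ 3) * eN v * v.1 - (r ^+ 2 * eN v * x + w * u.1) * d).
      by rewrite ux; ring.
    by rewrite r3; ring.
  exists (- z * eN v * v.2 - r ^+ 2 * eN v * y - w * u.2).
  transitivity ((1 - r ^+ 3) * eN v * v.2 - (r ^+ 2 * eN v * y + w * u.2) * d).
    by rewrite uy; ring.
  by rewrite r3; ring.
have [Da1 Da2] : (a %| (eD u v).1)%Z /\ (a %| (eD u v).2)%Z.
  by apply/andP; apply: (Dk a 1); rewrite ?mul1r // expr1n subrr dvdz0.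
have [Db1 Db2] : (b %| (eD u v).1)%Z /\ (b %| (eD u v).2)%Z.
  apply/andP; apply: (Dk b s) => //.
  have -> : s%:Z ^+ 3 - 1 = (s%:Z - 1) * (s%:Z ^+ 2 + s%:Z + 1) by ring.
  exact: dvdz_mull.
have [Dm1 Dm2] : (m %| (eD u v).1)%Z /\ (m %| (eD u v).2)%Z.
  have /andP[N1 N2] := lat_eN hP hm1 hm2.
  rewrite /eD eis_addE eis_oppE !eis_mulE /= !mul0r !subr0 ?addr0.
  by split; rewrite rpredB // dvdz_mulr.
have G (x : int) : (a %| x)%Z -> (b %| x)%Z -> (m %| x)%Z -> ((a * b * m)%N %| x)%Z.
  by move=> xa xb xm; rewrite !dvdzE in xa xb xm *; rewrite !Gauss_dvd // xa xb xm.
by apply: fermat_pt_dvd; apply: G.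
Qed.

Lemma crtE (q r : nat) (c d x : int) : coprime q r ->
  (q %| x - c)%Z && (r %| x - d)%Z = ((q * r)%N %| x - zchinese q r c d)%Z.
Proof.
move=> qr; rewrite -!eqz_mod_dvd PoszM zchinese_remainder //.
by rewrite zchinese_modl ?zchinese_modr.
Qed.

(** * Counting lattice points in a box *)

Definition residue (R q : nat) (c : int) : pred 'I_R :=
  fun x => (q %| x%:Z - c)%Z.
Arguments residue : clear implicits.

Lemma card_residue (R q K : nat) (c : int) : (0 < q)%N -> (R <= K * q)%N ->
  (#|residue R q c| <= K)%N.
Proof.
move=> q0 RK; have hlt (x : 'I_R) : (x %/ q < K)%N.
  by rewrite ltn_divLR //; apply: leq_trans (ltn_ord x) RK.
pose f (x : 'I_R) : 'I_K := Ordinal (hlt x).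
have finj : {in residue R q c &, injective f}.
  move=> x y; move=> hx hy /(congr1 val) /= xy; apply/val_inj => /=.
  have : (q %| x%:Z - y%:Z)%Z.
    by apply: (dvdz_lc (x := 1) (y := - 1) _ hx hy); ring.
  rewrite -eqz_mod_dvd !modz_nat eqz_nat => /eqP h.
  by rewrite (divn_eq x q) (divn_eq y q) xy h.
by rewrite -(card_in_imset finj) (leq_trans (max_card _)) // card_ord.
Qed.

Lemma card_residue_eq (R q : nat) (c : int) : (0 < q)%N -> (q %| R)%N ->
  #|residue R q c| = (R %/ q)%N.
Proof.
move=> q0 qR; apply/eqP; rewrite eqn_leq card_residue //=; last by rewrite divnK.
have q0z : q%:Z != 0 by rewrite eqz_nat -lt0n.
have [r rq hr] : exists2 r : nat, (r < q)%N & (q %| r%:Z - c)%Z.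
  exists `|(c %% q)%Z|%N; first by have := ltz_mod c q0z; have := modz_ge0 c q0z; lia.
  by rewrite gez0_abs ?modz_ge0 // -eqz_mod_dvd modz_mod.
have hlt (k : 'I_(R %/ q)) : (k * q + r < R)%N.
  have kq := ltn_ord k; have := divnK qR; move: (_ %/ _)%N k kq => n k kn <-.
  apply: (@leq_trans (k.+1 * q)); first by rewrite mulSn addnC ltn_add2r.
  by rewrite leq_pmul2r.
pose f (k : 'I_(R %/ q)) : 'I_R := Ordinal (hlt k).
have finj : injective f.
  move=> x y /(congr1 val) /= /eqP; rewrite eqn_add2r eqn_pmul2r // => /eqP; exact: val_inj.
rewrite -[leqLHS]card_ord -(card_imset _ finj); apply: subset_leq_card.
apply/fintype.subsetP => x /imsetP[k _ ->]; rewrite unfold_in /residue /= PoszD PoszM.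
have -> : k%:Z * q%:Z + r%:Z - c = (r%:Z - c) + k%:Z * q%:Z by ring.
by rewrite rpredD // dvdz_mull.
Qed.

Lemma card_dep (S T : finType) (P : pred S) (Q : S -> pred T) :
  #|[pred z : S * T | P z.1 && Q z.1 z.2]| = (\sum_(x | P x) #|Q x|)%N.
Proof.
under eq_bigr => x _ do rewrite -sum1_card.
by rewrite pair_big_dep -sum1_card; apply: eq_bigl.
Qed.

Lemma card_dep_le (S T : finType) (P : pred S) (Q : S -> pred T) (k l : nat) :
  (#|P| <= k)%N -> (forall x, #|Q x| <= l)%N ->
  (#|[pred z : S * T | P z.1 && Q z.1 z.2]| <= k * l)%N.
Proof.
move=> hk hl; rewrite card_dep; apply: (@leq_trans (\sum_(x | P x) l)).
  exact: leq_sum.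
by rewrite sum_nat_const leq_mul2r hk orbT.
Qed.

Lemma card_dep_eq (S T : finType) (P : pred S) (Q : S -> pred T) (k l : nat) :
  #|P| = k -> (forall x, #|Q x| = l)%N ->
  (#|[pred z : S * T | P z.1 && Q z.1 z.2]| = k * l)%N.
Proof.
move=> <- hl; rewrite card_dep; under eq_bigr => x _ do rewrite hl.
by rewrite sum_nat_const.
Qed.

Definition box (R : nat) : finType := ('I_R * 'I_R * 'I_R * 'I_R)%type.

(* The coordinates of a point of the box are, in this order, v2, v1, u2, u1. *)
Definition zv (R : nat) (z : box R) : eis := (z.1.1.2%:Z, z.1.1.1%:Z).
Definition zu (R : nat) (z : box R) : eis := (z.2%:Z, z.1.2%:Z).

(** A triangular system: the residue imposed on each coordinate depends only on earlier ones, so the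
    numbers of choices multiply. *)
Definition cell (R q1 q2 q3 q4 : nat) (c1 : int) (c2 : int -> int)
    (c3 : int -> int -> int) (c4 : int -> int -> int -> int) : pred (box R) :=
  [pred z : box R |
    (q1 %| (zv z).2 - c1)%Z && (q2 %| (zv z).1 - c2 (zv z).2)%Z &&
    (q3 %| (zu z).2 - c3 (zv z).2 (zv z).1)%Z &&
    (q4 %| (zu z).1 - c4 (zv z).2 (zv z).1 (zu z).2)%Z].

Arguments cell : clear implicits.

Lemma card_cell (R q1 q2 q3 q4 k1 k2 k3 k4 : nat) c1 c2 c3 c4 :
  (0 < q1)%N -> (0 < q2)%N -> (0 < q3)%N -> (0 < q4)%N ->
  (R <= k1 * q1)%N -> (R <= k2 * q2)%N -> (R <= k3 * q3)%N -> (R <= k4 * q4)%N ->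
  (#|cell R q1 q2 q3 q4 c1 c2 c3 c4| <= k1 * k2 * k3 * k4)%N.
Proof.
move=> *.
apply: (card_dep_le (S := ('I_R * 'I_R * 'I_R)%type)
  (P := fun y => residue R q1 c1 y.1.1 && residue R q2 (c2 y.1.1%:Z) y.1.2 &&
    residue R q3 (c3 y.1.1%:Z y.1.2%:Z) y.2)
  (Q := fun y => residue R q4 (c4 y.1.1%:Z y.1.2%:Z y.2%:Z))) => [|x]; last exact: card_residue.
apply: (card_dep_le (S := ('I_R * 'I_R)%type)
  (P := fun y => residue R q1 c1 y.1 && residue R q2 (c2 y.1%:Z) y.2)
  (Q := fun y => residue R q3 (c3 y.1%:Z y.2%:Z))) => [|x]; last exact: card_residue.
apply: (card_dep_le (P := residue R q1 c1) (Q := fun y : 'I_R => residue R q2 (c2 y%:Z))) => [|x];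
  exact: card_residue.
Qed.

Lemma card_cell_eq (R q1 q2 q3 q4 : nat) c1 c2 c3 c4 :
  (0 < q1)%N -> (0 < q2)%N -> (0 < q3)%N -> (0 < q4)%N ->
  (q1 %| R)%N -> (q2 %| R)%N -> (q3 %| R)%N -> (q4 %| R)%N ->
  #|cell R q1 q2 q3 q4 c1 c2 c3 c4| =
  ((R %/ q1) * (R %/ q2) * (R %/ q3) * (R %/ q4))%N.
Proof.
move=> *.
apply: (card_dep_eq (S := ('I_R * 'I_R * 'I_R)%type)
  (P := fun y => residue R q1 c1 y.1.1 && residue R q2 (c2 y.1.1%:Z) y.1.2 &&
    residue R q3 (c3 y.1.1%:Z y.1.2%:Z) y.2)
  (Q := fun y => residue R q4 (c4 y.1.1%:Z y.1.2%:Z y.2%:Z))) => [|x]; last exact: card_residue_eq.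
apply: (card_dep_eq (S := ('I_R * 'I_R)%type)
  (P := fun y => residue R q1 c1 y.1 && residue R q2 (c2 y.1%:Z) y.2)
  (Q := fun y => residue R q3 (c3 y.1%:Z y.2%:Z))) => [|x]; last exact: card_residue_eq.
apply: (card_dep_eq (P := residue R q1 c1) (Q := fun y : 'I_R => residue R q2 (c2 y%:Z))) => [|x];
  exact: card_residue_eq.
Qed.

Definition lat_c2 (M m : nat) (t v2 : int) : int := zchinese M m 1 (- t ^+ 2 * v2).
Definition lat_c3 (M a b : nat) (s v2 : int) : int :=
  zchinese (M * a)%N b (zchinese M a 0 v2) (s * v2).
Definition lat_c4 (M a b m : nat) (s t v1 u2 : int) : int :=
  zchinese (M * a * b)%N m
    (zchinese (M * a)%N b (zchinese M a 0 v1) (s * v1)) (- t * u2).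

Definition lat_pred (R M a b s m t : nat) : pred (box R) :=
  [pred z | in_class M (zu z) (zv z) && in_lat a b s m t (zu z) (zv z)].

Arguments lat_pred : clear implicits.

(** Solved in the order v2, v1, u2, u1, the congruences at m fall on v1 and u1, those at a and b on
    u2 and u1. The moduli have product M^4 (a b m)^2. That v is free at a b, and that v2 and u2 are
    free at m, is what the later sieve at primes dividing g relies on. *)
Lemma lat_pred_cell (R M a b s m t : nat) :
  coprime M a -> coprime (M * a) b -> coprime (M * a * b) m ->
  lat_pred R M a b s m t =1
  cell R M (M * m) (M * a * b) (M * a * b * m)
    0 (lat_c2 M m t) (fun v2 _ => lat_c3 M a b s v2)
    (fun _ v1 u2 => lat_c4 M a b m s t v1 u2).
Proof.
move=> cMa cab cm z; have cMm : coprime M m.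
  by move: cm; rewrite !coprimeMl => /andP[/andP[]].
rewrite /lat_pred /cell /= /lat_c2 /lat_c3 /lat_c4 -!crtE // !subr0.
rewrite /in_class /in_lat !mulNr !opprK.
rewrite /zu /zv /= -!andbA; do !bool_congr.
Qed.

Lemma lat_card_eq (R M a b s m t : nat) :
  coprime M a -> coprime (M * a) b -> coprime (M * a * b) m ->
  (0 < M * a * b * m)%N -> (M * a * b * m %| R)%N ->
  (#|lat_pred R M a b s m t| * (M ^ 4 * (a * b * m) ^ 2))%N = (R ^ 4)%N.
Proof.
move=> cMa cab cm g0 gR; rewrite (eq_card (@lat_pred_cell R M a b s m t cMa cab cm)).
have dR d : (d %| M * a * b * m)%N -> (d %| R)%N by move=> h; apply: dvdn_trans gR.
have d1 : (M %| M * a * b * m)%N by rewrite -!mulnA dvdn_mulr.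
have d2 : (M * m %| M * a * b * m)%N by rewrite dvdn_mul // -mulnA dvdn_mulr.
have d3 : (M * a * b %| M * a * b * m)%N by rewrite dvdn_mulr.
have p0 d : (d %| M * a * b * m)%N -> (0 < d)%N by move=> h; apply: dvdn_gt0 h.
rewrite card_cell_eq ?p0 ?dR //.
have E k : (k %| M * a * b * m)%N -> (R %/ k * k = R)%N by move=> /dR /divnK.
rewrite (_ : M ^ 4 * (a * b * m) ^ 2 = M * (M * m) * (M * a * b) * (M * a * b * m))%N; last by ring.
transitivity ((R %/ M * M) * (R %/ (M * m) * (M * m)) *
  (R %/ (M * a * b) * (M * a * b)) * (R %/ (M * a * b * m) * (M * a * b * m)))%N.
  by ring.
by rewrite !E //; ring.
Qed.

(** Rounding R / q up at most doubles it when q <= R; over four coordinates this is the factor 16 of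
    the upper bounds. *)
Lemma ceil_div (R q : nat) : (0 < q <= R)%N -> exists2 k, (R <= k * q)%N & (k * q <= 2 * R)%N.
Proof.
move=> /andP[q0 qR]; exists (R %/ q).+1.
  by apply: ltnW; rewrite -ltn_divLR.
by rewrite mulSn mul2n -addnn leq_add // leq_trunc_div.
Qed.

(** One further congruence per coordinate, triangular in the same order as [cell]; modulus 1 means
    no condition. *)
Definition extra (R d1 d2 d3 d4 : nat) (e1 : int) (e2 : int -> int)
    (e3 e4 : int -> int -> int) : pred (box R) :=
  [pred z : box R | [&& (d1 %| (zv z).2 - e1)%Z, (d2 %| (zv z).1 - e2 (zv z).2)%Z,
     (d3 %| (zu z).2 - e3 (zv z).2 (zv z).1)%Z &
     (d4 %| (zu z).1 - e4 (zv z).1 (zu z).2)%Z]].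
Arguments extra : clear implicits.

Lemma lat_card_extra (R M a b s m t d1 d2 d3 d4 : nat) (e1 : int) (e2 : int -> int)
    (e3 e4 : int -> int -> int) :
  coprime M a -> coprime (M * a) b -> coprime (M * a * b) m ->
  coprime M d1 -> coprime (M * m) d2 -> coprime (M * a * b) d3 ->
  coprime (M * a * b * m) d4 -> (0 < M * a * b * m)%N ->
  (0 < d1)%N -> (0 < d2)%N -> (0 < d3)%N -> (0 < d4)%N ->
  (M * a * b * m * (d1 * d2 * d3 * d4) <= R)%N ->
  (#|[predI lat_pred R M a b s m t & extra R d1 d2 d3 d4 e1 e2 e3 e4]|
   * (M ^ 4 * (a * b * m) ^ 2 * (d1 * d2 * d3 * d4)) <= 16 * R ^ 4)%N.
Proof.
move=> cMa cab cm c1 c2 c3 c4 g0 p1 p2 p3 p4 le.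
have cMm : coprime M m by move: cm; rewrite !coprimeMl => /andP[/andP[]].
rewrite (@eq_card _ _ (cell R (M * d1) (M * m * d2) (M * a * b * d3) (M * a * b * m * d4)
  (zchinese M d1 0 e1) (fun v2 => zchinese (M * m)%N d2 (lat_c2 M m t v2) (e2 v2))
  (fun v2 v1 => zchinese (M * a * b)%N d3 (lat_c3 M a b s v2) (e3 v2 v1))
  (fun _ v1 u2 => zchinese (M * a * b * m)%N d4 (lat_c4 M a b m s t v1 u2) (e4 v1 u2)))); last first.
  move=> z; apply: etrans (congr1 (fun c => c && extra R d1 d2 d3 d4 e1 e2 e3 e4 z)
    (@lat_pred_cell R M a b s m t cMa cab cm z)) _.
  rewrite unfold_in /cell /extra /= -!crtE //.
  by rewrite -!andbA; do !bool_congr.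
have dle q : (q %| M * a * b * m * (d1 * d2 * d3 * d4))%N -> (0 < q <= R)%N.
  move=> h; have g1 : (0 < M * a * b * m * (d1 * d2 * d3 * d4))%N.
    by rewrite muln_gt0 g0 !muln_gt0 p1 p2 p3 p4.
  by rewrite (dvdn_gt0 g1 h) (leq_trans (dvdn_leq g1 h) le).
have h1 : (0 < M * d1 <= R)%N.
  by apply: dle; rewrite dvdn_mul // -!mulnA dvdn_mulr.
have h2 : (0 < M * m * d2 <= R)%N.
  apply: dle; rewrite dvdn_mul //; first by rewrite dvdn_mul // -mulnA dvdn_mulr.
  by rewrite -!mulnA mulnCA dvdn_mulr.
have h3 : (0 < M * a * b * d3 <= R)%N.
  apply: dle; rewrite dvdn_mul //; first by rewrite dvdn_mulr.
  by rewrite mulnAC dvdn_mull.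
have h4 : (0 < M * a * b * m * d4 <= R)%N.
  by apply: dle; rewrite dvdn_mul // dvdn_mull.
have [k1 a1 b1] := ceil_div h1; have [k2 a2 b2] := ceil_div h2.
have [k3 a3 b3] := ceil_div h3; have [k4 a4 b4] := ceil_div h4.
move: h1 h2 h3 h4 => /andP[h1 _] /andP[h2 _] /andP[h3 _] /andP[h4 _].
have := card_cell (zchinese M d1 0 e1) (fun v2 => zchinese (M * m)%N d2 (lat_c2 M m t v2) (e2 v2))
  (fun v2 v1 => zchinese (M * a * b)%N d3 (lat_c3 M a b s v2) (e3 v2 v1))
  (fun _ v1 u2 => zchinese (M * a * b * m)%N d4 (lat_c4 M a b m s t v1 u2) (e4 v1 u2))
  h1 h2 h3 h4 a1 a2 a3 a4.
move: #|_| => N hN.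
apply: (@leq_trans ((k1 * (M * d1)) * (k2 * (M * m * d2)) * (k3 * (M * a * b * d3)) *
   (k4 * (M * a * b * m * d4)))%N).
  rewrite (_ : M ^ 4 * (a * b * m) ^ 2 * (d1 * d2 * d3 * d4) =
    (M * d1) * (M * m * d2) * (M * a * b * d3) * (M * a * b * m * d4))%N; last by ring.
  rewrite (_ : k1 * _ * _ * _ * _ = k1 * k2 * k3 * k4 *
   ((M * d1) * (M * m * d2) * (M * a * b * d3) * (M * a * b * m * d4)))%N; last by ring.
  by rewrite leq_mul2r hN orbT.
apply: (@leq_trans ((2 * R) * (2 * R) * (2 * R) * (2 * R))%N); last by rewrite leq_eqVlt; apply/orP; left; apply/eqP; ring.
exact: leq_mul (leq_mul (leq_mul b1 b2) b3) b4.
Qed.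

Lemma leq_card_has (T : finType) (I : Type) (l : seq I) (A : pred T) (Q : I -> pred T)
    (W C : nat) :
  (forall r, #|[predI A & Q r]| * W <= C)%N ->
  (#|[predI A & [pred z | has (fun r => Q r z) l]]| * W <= size l * C)%N.
Proof.
move=> h; elim: l => [|r l IH]; first by rewrite eq_card0 // => z; rewrite !inE andbF.
rewrite /= mulSn; apply: leq_trans (leq_add (h r) IH); rewrite -mulnDl leq_mul2r.
apply/orP; right; rewrite -cardUI -[leqLHS]addn0 leq_add //; apply: subset_leq_card.
apply/fintype.subsetP => z; rewrite !inE /= => /andP[hA /orP[] h']; apply/orP; [left|right];
  exact/andP.
Qed.

(** For two roots x and y, p divides (x - y)(x + y + 1), so y is x or p - 1 - x. *)
Lemma size_om_roots (p : nat) : prime p -> (size (om_roots p) <= 2)%N.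
Proof.
move=> pp; case E : (om_roots p) => [//|x l].
have hx : om_root p x by rewrite -mem_om_roots E inE eqxx.
have sub : {subset om_roots p <= [:: x; (p - 1 - x)%N]}.
  move=> y; rewrite mem_om_roots => hy.
  have [xp yp] : (x < p)%N /\ (y < p)%N by case/andP: hx; case/andP: hy.
  have : (p %| (x%:Z - y%:Z) * (x%:Z + y%:Z + 1))%Z.
    by apply: (dvdz_lc (x := 1) (y := -1) _ (om_rootP hx) (om_rootP hy)); ring.
  rewrite Euclid_dvdzM // !inE => /orP[] /dvdzP[z hz].
    have : z = 0 by nia.
    by move=> z0; rewrite z0 in hz; apply/orP; left; apply/eqP; lia.
  have : z = 1 by nia.
  by move=> z1; rewrite z1 in hz; apply/orP; right; apply/eqP; lia.
rewrite -E; apply: (uniq_leq_size _ sub).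
by rewrite filter_uniq // iota_uniq.
Qed.

Lemma solve_linear (n : nat) (x y : int) : (0 < n)%N -> coprimez n y ->
  exists2 s : nat, (s < n)%N & (n %| x + s%:Z * y)%Z.
Proof.
move=> n0 /coprimezP[[c d] /= h]; have nz : n%:Z != 0 by rewrite eqz_nat -lt0n.
exists `|((- x * d) %% n)%Z|%N.
  by have := ltz_mod (- x * d) nz; have := modz_ge0 (- x * d) nz; lia.
rewrite gez0_abs ?modz_ge0 //.
apply/dvdzP; exists (x * c - ((- x * d) %/ n)%Z * y).
have E : ((- x * d) %% n)%Z = - x * d - ((- x * d) %/ n)%Z * n.
  by have := divz_eq (- x * d) n; move: (_ %% _)%Z (_ %/ _)%Z => r q ->; ring.
rewrite E; transitivity (x * (c * n + d * y) - x * d * y - ((- x * d) %/ n)%Z * n * y).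
  by rewrite h; ring.
by ring.
Qed.

(** If p does not divide x.2 then - x.1 / x.2 is a root of X^2 + X + 1. Otherwise p divides x.1 too,
    which the extra entry 0 records. *)
Lemma eN_root (p : nat) (x : eis) : prime p -> (p %| eN x)%Z ->
  has (fun s : nat => (p %| x.1 + s%:Z * x.2)%Z) (0%N :: om_roots p).
Proof.
move=> pp hN; have [d2|nd2] := boolP (p %| x.2)%Z.
  have : (p %| x.1 * x.1)%Z.
    by apply: (dvdz_lc (x := 1) (y := x.1 - x.2) _ hN d2); rewrite /eN /nrm; ring.
  by rewrite Euclid_dvdzM // orbb /= mul0r addr0 => ->.
have c : coprimez p x.2 by rewrite coprimezE prime_coprime.
have [s sp hs] := solve_linear x.1 (prime_gt0 pp) c.
apply/hasP; exists s => //; rewrite inE mem_om_roots /om_root sp /=; apply/orP; right.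
have : (p %| x.2 * (x.2 * (s%:Z ^+ 2 + s%:Z + 1)))%Z.
  apply: (dvdz_lc (x := 1) (y := - (x.1 - s%:Z * x.2 - x.2)) _ hN hs).
  by rewrite /eN /nrm; ring.
rewrite !Euclid_dvdzM // (negbTE nd2) /= dvdzE; congr (_ %| _)%N; lia.
Qed.

Lemma card_sub_extra (R M a b s m t d1 d2 d3 d4 W : nat) e1 e2 e3 e4 (Q : pred (box R)) :
  coprime M a -> coprime (M * a) b -> coprime (M * a * b) m ->
  coprime M d1 -> coprime (M * m) d2 -> coprime (M * a * b) d3 ->
  coprime (M * a * b * m) d4 -> (0 < M * a * b * m)%N ->
  (0 < d1)%N -> (0 < d2)%N -> (0 < d3)%N -> (0 < d4)%N ->
  (d1 * d2 * d3 * d4)%N = W -> (M * a * b * m * W <= R)%N ->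
  (forall z, Q z -> extra R d1 d2 d3 d4 e1 e2 e3 e4 z) ->
  (#|[predI lat_pred R M a b s m t & Q]| * (M ^ 4 * (a * b * m) ^ 2 * W) <= 16 * R ^ 4)%N.
Proof.
move=> cMa cab cm c1 c2 c3 c4 g0 p1 p2 p3 p4 <- le sub.
apply: leq_trans (lat_card_extra s t e1 e2 e3 e4 cMa cab cm c1 c2 c3 c4 g0 p1 p2 p3 p4 le).
rewrite leq_mul2r; apply/orP; right; apply: subset_leq_card.
by apply/fintype.subsetP => z; rewrite !inE => /andP[-> /sub].
Qed.

(** Each way of being typed is a pair of congruences modulo p, of density 1 / p^2. There are at most
    3 values of r, and at most 3 * 3 pairs of congruences when both norms vanish: 192 = 16 (3 +
    9). *)
Lemma card_typed (R M a b s m t p : nat) :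
  coprime M a -> coprime (M * a) b -> coprime (M * a * b) m ->
  (0 < M * a * b * m)%N -> prime p -> coprime (M * a * b * m) p ->
  (M * a * b * m * p ^ 2 <= R)%N ->
  (#|[predI lat_pred R M a b s m t & [pred z | typed_at p (zu z) (zv z)]]|
    * (M ^ 4 * (a * b * m) ^ 2 * p ^ 2) <= 192 * R ^ 4)%N.
Proof.
move=> cMa cab cm g0 pp cp le; have p0 := prime_gt0 pp.
have [c1 c2 c3] : [/\ coprime M p, coprime (M * m) p & coprime (M * a * b) p].
  by move: cp; rewrite !coprimeMl => /andP[/andP[/andP[-> ->] ->] ->].
set A := lat_pred _ _ _ _ _ _ _; set W := (_ * p ^ 2)%N.
pose Q1 (r : nat) : pred (box R) := [pred z |
  (p %| (zu z).1 - r%:Z * (zv z).1)%Z && (p %| (zu z).2 - r%:Z * (zv z).2)%Z].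
pose Q2 (r : nat * nat) : pred (box R) := [pred z |
  (p %| (zu z).1 + r.1%:Z * (zu z).2)%Z && (p %| (zv z).1 + r.2%:Z * (zv z).2)%Z].
have h1 r : (#|[predI A & Q1 r]| * W <= 16 * R ^ 4)%N.
  apply: (@card_sub_extra R M a b s m t 1 1 p p _ 0
    (id) (fun v2 _ => r%:Z * v2) (fun v1 _ => r%:Z * v1)) => //;
    rewrite ?coprimen1 ?mul1n //.
  by move=> z /andP[h h']; rewrite /extra /= !dvd1z h h'.
have h2 r : (#|[predI A & Q2 r]| * W <= 16 * R ^ 4)%N.
  apply: (@card_sub_extra R M a b s m t 1 p 1 p _ 0
    (fun v2 => - (r.2%:Z * v2)) (fun v2 _ => v2) (fun _ u2 => - (r.1%:Z * u2))) => //;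
    rewrite ?coprimen1 ?mul1n ?muln1 //.
  by move=> z /andP[h h']; rewrite /extra /= !dvd1z !opprK h h'.
have := leq_card_has (1%N :: om_roots p) h1.
pose l := [seq (x, y) | x <- 0%N :: om_roots p, y <- 0%N :: om_roots p].
have := leq_card_has l h2.
have s2 := size_om_roots pp; have sl : (size l <= 9)%N.
  by rewrite size_allpairs (@leq_mul _ _ 3 3).
have sl1 : (size (1%N :: om_roots p) <= 3)%N by [].
move=> H2 H1; have {}H1 := leq_trans H1 (leq_mul sl1 (leqnn _)).
have {}H2 := leq_trans H2 (leq_mul sl (leqnn _)).
rewrite (_ : 192 * R ^ 4 = 3 * (16 * R ^ 4) + 9 * (16 * R ^ 4))%N; last by ring.
apply: leq_trans (leq_add H1 H2); rewrite -mulnDl leq_mul2r; apply/orP; right.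
rewrite -cardUI; apply: leq_trans (leq_addr _ _); apply: subset_leq_card.
apply/fintype.subsetP => z; rewrite !inE => /andP[-> /orP[hz|/andP[hu hv]]] /=.
  by apply/orP; left.
apply/orP; right.
have /hasP[r1 r1l hr1] := eN_root pp hu; have /hasP[r2 r2l hr2] := eN_root pp hv.
have hasQ : has (fun r => Q2 r z) l.
  by apply/hasP; exists (r1, r2); [exact: allpairs_f | rewrite /Q2 /= hr1 hr2].
exact: hasQ.
Qed.

(** Here p may divide a b: the lattice restricts v only modulo M m, so a congruence on v at p is
    independent of it. The constant is 48 = 3 * 16. *)
Lemma card_norm_dvd (R M a b s m t p : nat) :
  coprime M a -> coprime (M * a) b -> coprime (M * a * b) m ->
  (0 < M * a * b * m)%N -> prime p -> coprime (M * m) p ->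
  (M * a * b * m * p <= R)%N ->
  (#|[predI lat_pred R M a b s m t & [pred z | p %| eN (zv z)]%Z]|
    * (M ^ 4 * (a * b * m) ^ 2 * p) <= 48 * R ^ 4)%N.
Proof.
move=> cMa cab cm g0 pp cp le; have p0 := prime_gt0 pp.
set A := lat_pred _ _ _ _ _ _ _; set W := (_ * p)%N.
pose Q (r : nat) : pred (box R) := [pred z | (p %| (zv z).1 + r%:Z * (zv z).2)%Z].
have h r : (#|[predI A & Q r]| * W <= 16 * R ^ 4)%N.
  apply: (@card_sub_extra R M a b s m t 1 p 1 1 _ 0
    (fun v2 => - (r%:Z * v2)) (fun v2 _ => v2) (fun _ u2 => u2)) => //;
    rewrite ?coprimen1 ?mul1n ?muln1 //.
  by move=> z; rewrite /Q /extra /= !dvd1z !opprK => ->.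
have s2 := size_om_roots pp; have sl : (size (0%N :: om_roots p) <= 3)%N by [].
have := leq_trans (leq_card_has (0%N :: om_roots p) h) (leq_mul sl (leqnn _)).
rewrite (_ : 48 * R ^ 4 = 3 * (16 * R ^ 4))%N; last by ring.
apply: leq_trans; rewrite leq_mul2r; apply/orP; right; apply: subset_leq_card.
by apply/fintype.subsetP => z; rewrite !inE => /andP[-> /(eN_root pp)].
Qed.

(** Meant for p dividing m: u2 and v2 are restricted only modulo M a b and M, both prime to p. *)
Lemma card_coord_dvd (R M a b s m t p : nat) :
  coprime M a -> coprime (M * a) b -> coprime (M * a * b) m ->
  (0 < M * a * b * m)%N -> prime p -> coprime (M * a * b) p ->
  (M * a * b * m * p <= R)%N ->
  (#|[predI lat_pred R M a b s m t &
      [pred z : box R | (p %| (zu z).2)%Z || (p %| (zv z).2)%Z]]|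
    * (M ^ 4 * (a * b * m) ^ 2 * p) <= 48 * R ^ 4)%N.
Proof.
move=> cMa cab cm g0 pp cp le; have p0 := prime_gt0 pp.
have cMp : coprime M p by move: cp; rewrite !coprimeMl => /andP[/andP[]].
set A := lat_pred _ _ _ _ _ _ _; set W := (_ * p)%N.
pose Q1 : pred (box R) := [pred z | (p %| (zu z).2)%Z].
pose Q2 : pred (box R) := [pred z | (p %| (zv z).2)%Z].
have h1 : (#|[predI A & Q1]| * W <= 16 * R ^ 4)%N.
  apply: (@card_sub_extra R M a b s m t 1 1 p 1 _ 0
    (id) (fun _ _ => 0) (fun _ u2 => u2)) => //;
    rewrite ?coprimen1 ?mul1n ?muln1 //.
  by move=> z; rewrite /Q1 /Q2 /extra /= !dvd1z subr0 => ->.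
have h2 : (#|[predI A & Q2]| * W <= 16 * R ^ 4)%N.
  apply: (@card_sub_extra R M a b s m t p 1 1 1 _ 0
    (id) (fun _ _ => 0) (fun _ u2 => u2)) => //;
    rewrite ?coprimen1 ?mul1n ?muln1 //.
  by move=> z; rewrite /Q1 /Q2 /extra /= !dvd1z subr0 => ->.
apply: (@leq_trans (16 * R ^ 4 + 16 * R ^ 4)%N); last by lia.
apply: leq_trans (leq_add h1 h2); rewrite -mulnDl leq_mul2r; apply/orP; right.
rewrite -cardUI; apply: leq_trans (leq_addr _ _); apply: subset_leq_card.
apply/fintype.subsetP => z; rewrite !inE /Q1 /Q2 /= => /andP[-> /orP[]] ->; by rewrite ?orbT.
Qed.

(** * Pairs with a large common divisor *)

Lemma sum_inv_sq (F : realFieldType) (J n : nat) : (0 < J)%N ->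
  \sum_(i < n | (J < i)%N) (i%:R ^+ 2)^-1 <= J%:R^-1 :> F.
Proof.
move=> J0; have J0F : 0 < J%:R :> F by rewrite ltr0n.
have [nJ|Jn] := leqP n J.
  rewrite big_pred0 ?invr_ge0 ?ler0n // => i; apply/negbTE; rewrite -leqNgt.
  exact: leq_trans (ltnW (ltn_ord i)) nJ.
(* Telescoping: 1 / i^2 <= 1 / (i - 1) - 1 / i. *)
suff: \sum_(i < n | (J < i)%N) (i%:R ^+ 2)^-1 <= J%:R^-1 - n.-1%:R^-1 :> F.
  by move=> h; apply: le_trans h _; rewrite gerBl invr_ge0 ler0n.
elim: n Jn => // n IH; rewrite ltnS leq_eqVlt big_mkcond big_ord_recr -big_mkcond /= => /orP[/eqP <-|Jn].
  rewrite ltnn addr0 subrr big_pred0 // => i.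
  by apply/negbTE; rewrite -leqNgt ltnW.
rewrite Jn; apply: le_trans (lerD (IH Jn) (lexx _)) _.
case: n Jn {IH} => // n; rewrite ltnS /= => Jn.
have n0 : 0 < n%:R :> F by rewrite ltr0n (leq_trans J0).
rewrite -addrA lerD2l -natr1; move: n0; move: (n%:R : F) => x x0.
rewrite -subr_ge0; have -> : - (x + 1)^-1 - (- x^-1 + ((x + 1) ^+ 2)^-1) =
  (x * (x + 1) ^+ 2)^-1.
  by field; rewrite !gt_eqF // ltr_wpDr.
by rewrite invr_ge0 mulr_ge0 // ?exprn_ge0 ?ltW // ltr_wpDr.
Qed.

(** 4 N = 3 a^2 + (2 b - a)^2, and symmetrically in b. *)
Lemma nrm_ge (a b : int) : 3 * a ^+ 2 <= 4 * nrm a b /\ 3 * b ^+ 2 <= 4 * nrm a b.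
Proof.
by have := sqr_ge0 (a - b *+ 2); have := sqr_ge0 (b - a *+ 2); rewrite /nrm; split; lia.
Qed.

Lemma shift_inj (a b : int) (L : nat) : (`|a| <= L)%N -> (`|b| <= L)%N ->
  `|(a + L%:Z)%R|%N = `|(b + L%:Z)%R|%N -> a = b.
Proof. by lia. Qed.

Lemma shift_lt (a : int) (L : nat) :
  (`|a| <= L)%N -> (`|(a + L%:Z)%R| < (2 * L).+1)%N.
Proof. by lia. Qed.

Definition eis_of (R : nat) (u : 'I_R * 'I_R) : eis := (u.1%:Z, u.2%:Z).

(** Put j = max(x, y) and k = x + y w. Since N(u) <= R^2 and 3 j^2 <= 4 N(k), the coordinates of the
    quotient u / k are at most L = 2 R / j in absolute value, and (2 L + 1) j <= 6 R. *)
Lemma card_edvd (R x y : nat) : (0 < maxn x y <= 2 * R)%N ->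
  (#|[pred u : 'I_R * 'I_R | edvd (x%:Z, y%:Z) (eis_of u)]| * maxn x y ^ 2
    <= (6 * R) ^ 2)%N.
Proof.
set j := maxn x y => /andP[j0 jR]; set k : eis := (x%:Z, y%:Z).
have k0 : k != 0.
  apply/eqP => -[x0 y0]; move: j0; rewrite /j.
  by move: x0 y0; clear; lia.
have hk : 3 * j%:Z ^+ 2 <= 4 * eN k.
  by have [h1 h2] := nrm_ge x%:Z y%:Z; rewrite /j /eN /=; case: leqP.
pose L := ((2 * R) %/ j)%N.
pose quo (u : 'I_R * 'I_R) : eis :=
  (((eis_of u) * econj k).1 %/ eN k, ((eis_of u) * econj k).2 %/ eN k)%Z.
have quoE u : edvd k (eis_of u) -> (eis_of u) = k * quo u.
  move=> h; move/(edvdP _ k0): (h) => [q hq]; rewrite hq; congr (_ * _).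
  rewrite /quo hq -mulrA [q * _]mulrC mulrA mul_econj eis_mulE /=.
  have Nk0 : eN k != 0 by rewrite eN_eq0.
  by rewrite !mul0r subr0 addr0 subr0 !mulKz //; case: (q).
have small (u : 'I_R * 'I_R) : edvd k (eis_of u) ->
    (`|(quo u).1| <= L)%N /\ (`|(quo u).2| <= L)%N.
  move=> h; have := congr1 eN (quoE _ h); rewrite eN_mul.
  have hu : 0 <= eN (eis_of u) <= R%:Z ^+ 2.
    by apply: nrm_bound => /=; rewrite lez_nat ltnW.
  move=> E; rewrite {}E in hu; have [h1 h2] := nrm_ge (quo u).1 (quo u).2.
  have key (c : int) : 3 * c ^+ 2 <= 4 * eN (quo u) -> (`|c| <= L)%N.
    move=> hc; rewrite /L leq_divRL //.
    have : 9 * (j%:Z * c) ^+ 2 <= 16 * R%:Z ^+ 2.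
      apply: (@le_trans _ _ (4 * eN k * (4 * eN (quo u)))); last first.
        rewrite (_ : 4 * eN k * _ = 16 * (eN k * eN (quo u))); last by ring.
        by case/andP: hu => _; rewrite ler_pM2l.
      have -> : 9 * (j%:Z * c) ^+ 2 = (3 * j%:Z ^+ 2) * (3 * c ^+ 2) by ring.
      by apply: ler_pM => //; rewrite mulr_ge0 // sqr_ge0.
    clear; move=> h; have : `|j%:Z * c| <= 2 * R%:Z by nia.
    by rewrite normrM; lia.
  by split; apply: key.
have sz (u : 'I_R * 'I_R) : edvd k (eis_of u) ->
   (`|((quo u).1 + L%:Z)%R| < (2 * L).+1)%N /\ (`|((quo u).2 + L%:Z)%R| < (2 * L).+1)%N.
  by move=> /small[h1 h2]; split; exact: shift_lt.
pose f (u : 'I_R * 'I_R) : 'I_(2 * L).+1 * 'I_(2 * L).+1 :=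
  (inord `|((quo u).1 + L%:Z)%R|, inord `|((quo u).2 + L%:Z)%R|).
have finj : {in [pred u : 'I_R * 'I_R | edvd k (eis_of u)] &, injective f}.
  move=> u w; rewrite !inE => hu hw [] /(congr1 val) /= e1 /(congr1 val) /= e2.
  have [a1 a2] := sz _ hu; have [b1 b2] := sz _ hw.
  rewrite !inordK // in e1 e2.
  have [c1 c2] := small _ hu; have [d1 d2] := small _ hw.
  have q : quo u = quo w.
    rewrite [LHS]surjective_pairing [RHS]surjective_pairing; congr pair.
      exact: shift_inj c1 d1 e1.
    exact: shift_inj c2 d2 e2.
  have := quoE _ hu; rewrite q -(quoE _ hw) => -[e3 e4].
  by rewrite [LHS]surjective_pairing [RHS]surjective_pairing; congr pair; apply/val_inj.
rewrite -(card_in_imset finj).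
apply: (@leq_trans ((2 * L).+1 * (2 * L).+1 * j ^ 2)%N).
  rewrite leq_mul2r; apply/orP; right; apply: leq_trans (max_card _) _.
  by rewrite card_prod !card_ord.
have : (L * j <= 2 * R)%N by rewrite leq_trunc_div.
move: (L) => l h; have h' : ((2 * l).+1 * j <= 6 * R)%N.
  by rewrite mulSn -mulnA; move: (l * j)%N (j) jR h; clear; lia.
rewrite (_ : _ * _ * _ = ((2 * l).+1 * j) ^ 2)%N; last by ring.
by rewrite leq_exp2r.
Qed.

Lemma leq_card_exists (T I : finType) (A : pred T) (P : pred I) (Q : I -> pred T) :
  (forall z, A z -> exists2 i, P i & Q i z) ->
  (#|A| <= \sum_(i | P i) #|Q i|)%N.
Proof.
move=> h; under eq_bigr => i _ do rewrite -sum1_card big_mkcond.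
rewrite -sum1_card exchange_big big_mkcond; apply: leq_sum => z _.
case: ifP => // /h[i Pi Qiz]; rewrite (bigD1 i) //= ifT //.
Qed.

Lemma card_edvd_pair (R x y : nat) : (0 < maxn x y <= 2 * R)%N ->
  (#|[pred z : box R | edvd (x%:Z, y%:Z) (zu z) && edvd (x%:Z, y%:Z) (zv z)]|
    * maxn x y ^ 4 <= (6 * R) ^ 4)%N.
Proof.
move=> h; have := card_edvd h; set A := [pred u : 'I_R * 'I_R | _] => hA.
pose f (z : box R) : ('I_R * 'I_R) * ('I_R * 'I_R) := ((z.2, z.1.2), (z.1.1.2, z.1.1.1)).
have finj : injective f by move=> [[[a b] c] d] [[[a' b'] c'] d'] [-> -> -> ->].
rewrite -(card_imset _ finj).
apply: (@leq_trans (#|[pred w | A w.1 && A w.2]| * maxn x y ^ 4)%N).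
  rewrite leq_mul2r; apply/orP; right; apply: subset_leq_card.
  by apply/fintype.subsetP => w /imsetP[z hz ->]; exact: hz.
rewrite (card_dep A (fun _ => A)) sum_nat_const.
rewrite -[4%N]/(2 + 2)%N !expnD mulnACA; exact: leq_mul.
Qed.

(** For a given maximum x, each of the halves y <= x and x <= y contributes at most (x + 1) / x^4 <=
    2 / x^2. *)
Lemma sum_max_inv (F : realFieldType) (n J : nat) : (0 < J)%N ->
  \sum_(k : 'I_n * 'I_n | (J < maxn k.1 k.2)%N) ((maxn k.1 k.2)%:R ^+ 4)^-1
    <= 4 / J%:R :> F.
Proof.
move=> J0.
pose g (x y : nat) : F := if (J < x)%N && (y <= x)%N then (x%:R ^+ 4)^-1 else 0.
have g0 x y : 0 <= g x y by rewrite /g; case: ifP => // _; rewrite invr_ge0 exprn_ge0.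
have row : \sum_(x < n) \sum_(y < n) g x y <= 2 / J%:R.
  apply: (@le_trans _ _ (2 * \sum_(x < n | (J < x)%N) (x%:R ^+ 2)^-1)); last first.
    by rewrite ler_pM2l // sum_inv_sq.
  rewrite mulr_sumr [leRHS]big_mkcond; apply: ler_sum => x _.
  case: ifP => [Jx|nJx]; last by rewrite big1 // => y _; rewrite /g nJx.
  rewrite -big_mkcond /= Jx /= sumr_const.
  have cx : (#|[pred y : 'I_n | (y <= x)%N]| <= x.+1)%N.
    pose f (y : 'I_n) : 'I_x.+1 := inord y.
    have finj : {in [pred y : 'I_n | (y <= x)%N] &, injective f}.
      move=> y y'; rewrite !inE => h h' /(congr1 val) /=.
      by rewrite !inordK ?ltnS // => e; apply: val_inj.
    by rewrite -(card_in_imset finj) (leq_trans (max_card _)) // card_ord.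
  have x1 : 1 <= x%:R :> F by rewrite ler1n (leq_trans _ Jx).
  have x0 : 0 < x%:R :> F by apply: lt_le_trans x1.
  apply: (@le_trans _ _ ((x%:R ^+ 4)^-1 *+ x.+1)).
    by rewrite ler_wpMn2l // invr_ge0 exprn_ge0 // ltW.
  rewrite -[leLHS]mulr_natr -[x.+1%:R]natr1; move: (x%:R : F) x1 x0 => t t1 t0.
  rewrite ler_pdivrMl ?exprn_gt0 //.
  have -> : t ^+ 4 * (2 * (t ^+ 2)^-1) = 2 * t ^+ 2 by field; rewrite gt_eqF.
  by nra.
rewrite -(pair_big_dep predT (fun x y : 'I_n => J < maxn x y)%N
  (fun x y : 'I_n => ((maxn x y)%:R ^+ 4)^-1)) /=.
apply: (@le_trans _ _ (\sum_(x < n) \sum_(y < n) (g x y + g y x))).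
  apply: ler_sum => x _; rewrite big_mkcond; apply: ler_sum => y _.
  case: ifP => [h|_]; last by rewrite addr_ge0.
  have [xy|xy] := leqP y x.
    by rewrite (maxn_idPl xy) in h *; rewrite {1}/g h xy /= lerDl.
  by rewrite (maxn_idPr (ltnW xy)) in h *; rewrite [g y x]/g h (ltnW xy) /= lerDr.
under eq_bigr => x _ do rewrite big_split.
rewrite big_split /= [X in _ + X]exchange_big /=.
by have := lerD row row; rewrite -mulrDl -natrD.
Qed.

Lemma edvd_max_le (R : nat) (z : box R) (x y : nat) : (0 < maxn x y)%N ->
  zv z != 0 -> edvd (x%:Z, y%:Z) (zv z) -> (maxn x y <= 2 * R)%N.
Proof.
set k : eis := (x%:Z, y%:Z) => j0 v0 hv.
have k0 : k != 0.
  apply/eqP => -[x0 y0]; move: j0 x0 y0; clear; lia.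
move/(edvdP _ k0): hv => [q hq].
have hk : 3 * (maxn x y)%:Z ^+ 2 <= 4 * eN k.
  by have [h1 h2] := nrm_ge x%:Z y%:Z; rewrite /eN /=; case: leqP.
have hu : 0 <= eN (zv z) <= R%:Z ^+ 2.
  by apply: nrm_bound => /=; rewrite lez_nat ltnW.
have q1 : 1 <= eN q.
  have : eN q != 0 by rewrite eN_eq0; apply: contraNneq v0 => q0; rewrite hq q0 mulr0.
  by have := eN_ge0 q; move: (eN q); clear; lia.
rewrite hq eN_mul in hu; have k1 := eN_ge0 k.
move: hu hk q1 k1; move: (maxn x y) (eN k) (eN q); clear; nia.
Qed.

(** The lattice congruences are forgotten here, so the loss R^4 / J is harmless only because J will
    be chosen far above the index of the lattice. The constant is 5184 = 4 * 6^4. *)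
Lemma card_big_gcd (F : realFieldType) (R J : nat) : (0 < J)%N ->
  (#|[pred z : box R | (zv z != 0) &&
     [exists k : 'I_(2 * R).+1 * 'I_(2 * R).+1, (J < maxn k.1 k.2)%N &&
        (edvd (k.1%:Z, k.2%:Z) (zu z) && edvd (k.1%:Z, k.2%:Z) (zv z))]]|%:R : F)
  <= 5184 * R%:R ^+ 4 / J%:R.
Proof.
move=> J0.
pose P (k : 'I_(2 * R).+1 * 'I_(2 * R).+1) := (J < maxn k.1 k.2)%N.
pose Q (k : 'I_(2 * R).+1 * 'I_(2 * R).+1) : pred (box R) :=
  [pred z | (maxn k.1 k.2 <= 2 * R)%N &&
    (edvd (k.1%:Z, k.2%:Z) (zu z) && edvd (k.1%:Z, k.2%:Z) (zv z))].
have /leq_card_exists H (z : box R) : [pred z : box R | (zv z != 0) &&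
     [exists k : 'I_(2 * R).+1 * 'I_(2 * R).+1, (J < maxn k.1 k.2)%N &&
        (edvd (k.1%:Z, k.2%:Z) (zu z) && edvd (k.1%:Z, k.2%:Z) (zv z))]] z ->
   exists2 k, P k & Q k z.
  move=> /andP[v0 /existsP[k /andP[Jk /andP[h1 h2]]]]; exists k => //.
  by rewrite /Q /= h1 h2 (edvd_max_le (leq_ltn_trans (leq0n J) Jk) v0 h2).
apply: (@le_trans _ _ (\sum_(k | P k) #|Q k|%:R)).
  by rewrite -natr_sum ler_nat.
apply: (@le_trans _ _ (\sum_(k | P k) 1296 * R%:R ^+ 4 * ((maxn k.1 k.2)%:R ^+ 4)^-1)).
  apply: ler_sum => k Pk; have j0 : (0 < maxn k.1 k.2)%N by apply: leq_ltn_trans Pk.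
  have [jR|Rj] := leqP (maxn k.1 k.2) (2 * R); last first.
    rewrite eq_card0 => [|z]; last by rewrite !inE leqNgt Rj.
    by rewrite !mulr_ge0 // ?exprn_ge0 // invr_ge0 exprn_ge0.
  have : (#|Q k| * maxn k.1 k.2 ^ 4 <= (6 * R) ^ 4)%N.
    apply: leq_trans (card_edvd_pair (x := k.1) (y := k.2) _); last by rewrite j0.
    rewrite leq_mul2r; apply/orP; right; apply: subset_leq_card.
    by apply/fintype.subsetP => z; rewrite !inE => /andP[_].
  rewrite -(ler_nat F) natrM !natrX => h.
  rewrite ler_pdivlMr ?exprn_gt0 ?ltr0n //.
  by apply: le_trans h _; rewrite natrM exprMn (_ : 6%:R ^+ 4 = 1296 :> F) // -natrX.
rewrite -mulr_sumr; apply: le_trans (ler_wpM2l _ (sum_max_inv _ _ J0)) _.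
  by rewrite mulr_ge0 // exprn_ge0.
rewrite (_ : 1296 * R%:R ^+ 4 * (4 / J%:R) = (1296 * 4) * R%:R ^+ 4 / J%:R) -?natrM //.
by ring.
Qed.

(** * Sums over the tuples *)

Lemma ler_sum_inj (F : realFieldType) (I J : finType) (P : pred I) (Q : pred J)
    (h : I -> J) (f : I -> F) (g : J -> F) :
  {in P &, injective h} -> (forall i, P i -> Q (h i)) ->
  (forall i, P i -> f i <= g (h i)) -> (forall j, Q j -> 0 <= g j) ->
  \sum_(i | P i) f i <= \sum_(j | Q j) g j.
Proof.
move=> hinj hQ hf g0.
apply: (@le_trans _ _ (\sum_(i | P i) g (h i))); first exact: ler_sum.
rewrite -(@big_imset _ _ _ _ _ h P g) /=; last by move=> x y hx hy; exact: hinj.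
rewrite [leRHS](bigID (fun j => j \in h @: P)) /=.
rewrite (eq_bigl (fun j => Q j && (j \in h @: P))) => [|j].
  rewrite lerDl; apply: sumr_ge0 => j /andP[Qj _]; exact: g0.
by case: (boolP (j \in h @: P)) => [/imsetP[i Pi ->]|]; rewrite ?andbF // andbT hQ.
Qed.

Definition sum_a (F : realFieldType) (Y M : nat) (P : pred nat) : F :=
  \sum_(a < Y.+1 | [&& (0 < a)%N, coprime a M & P a]) (a%:R)^-1.

Definition sum_b (F : realFieldType) (Y M : nat) (P : pred nat) : F :=
  \sum_(k : 'I_Y.+1 * 'I_Y.+1 | [&& coprime k.1 M, om_root k.1 k.2 & P k.1]) (k.1%:R)^-1.

Lemma sum_a_dvd (F : realFieldType) (Y M q : nat) : (0 < q)%N ->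
  sum_a F Y M (fun a => q %| a)%N <= q%:R^-1 * sum_a F Y M predT.
Proof.
move=> q0; rewrite /sum_a mulr_sumr.
have lt (a : 'I_Y.+1) : (a %/ q < Y.+1)%N by apply: leq_ltn_trans (leq_div _ _) (ltn_ord a).
apply: (ler_sum_inj (h := fun a => Ordinal (lt a))).
- move=> a a' /and3P[_ _ qa] /and3P[_ _ qa'] /(congr1 val) /= e.
  by apply/val_inj; rewrite /= -(divnK qa) -(divnK qa') e.
- move=> a /and3P[a0 ca qa] /=; rewrite divn_gt0 // dvdn_leq //= andbT.
  by apply: coprime_dvdl ca; apply: dvdn_div.
- move=> a /and3P[a0 ca qa] /=.
  by rewrite -{1}(divnK qa) natrM invfM mulrC.
- by move=> a _; rewrite mulr_ge0 // invr_ge0 ler0n.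
Qed.

Lemma Euclid_pow (p k : nat) (x y : int) : prime p ->
  ~~ ((p %| x)%Z && (p %| y)%Z) -> ((p ^ k)%N %| x * y)%Z ->
  ((p ^ k)%N %| x)%Z || ((p ^ k)%N %| y)%Z.
Proof.
move=> pp; have cop z : ~~ (p %| z)%Z -> coprimez (p ^ k)%N z.
  by move=> h; rewrite coprimezE coprimeXl // prime_coprime.
rewrite negb_and => /orP[] /cop c hd; apply/orP; [right|left].
  by rewrite Gauss_dvdzr in hd.
by rewrite Gauss_dvdzl in hd.
Qed.

(* The roots of s ^ 2 + s + 1 modulo a power P of a prime other than 3 are s
   and P - 1 - s: the boolean below tells them apart. *)
Definition root_side (P s : nat) : bool := ((s %% P).*2 < P)%N.

(** The part of b prime to p divides b / p^j, where s1 and s2 agree. Modulo the p-part P, (s1 -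
    s2)(s1 + s2 + 1) = 0 and p cannot divide both factors, so s1 = s2 or s1 + s2 = -1. *)
Lemma om_root_lift (p j b s1 s2 : nat) : prime p -> coprime b 3 -> (0 < j)%N ->
  (p ^ j %| b)%N -> om_root b s1 -> om_root b s2 ->
  s1 = s2 %[mod b %/ p ^ j] -> root_side (b`_p)%N s1 = root_side (b`_p)%N s2 -> s1 = s2.
Proof.
move=> pp b3 j0 jb h1 h2 e side.
have [l1 l2] : (s1 < b)%N /\ (s2 < b)%N by case/andP: h1; case/andP: h2.
have b0 : (0 < b)%N by apply: leq_ltn_trans l1.
set P := (b`_p)%N in side.
have PE : P = (p ^ logn p b)%N by rewrite /P p_part.
have P0 : (0 < P)%N by rewrite PE expn_gt0 prime_gt0.
have Pb : (P %| b)%N by rewrite /P dvdn_part.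
have p3 : coprime p 3.
  by apply: coprime_dvdl b3; apply: dvdn_trans jb; rewrite dvdn_exp.
have pb : (p %| b%:Z)%Z by rewrite dvdzE /=; apply: dvdn_trans jb; rewrite dvdn_exp.
have H1 := om_rootP h1; have H2 := om_rootP h2.
have close : (P %| s1%:Z - s2%:Z)%Z -> s1 = s2.
  move=> hP; have hb' : ((b %/ p ^ j)%N %| s1%:Z - s2%:Z)%Z.
    by rewrite -eqz_mod_dvd !modz_nat e.
  have hr : ((b %/ P)%N %| s1%:Z - s2%:Z)%Z.
    apply: dvdz_natl hb'; rewrite dvdn_divRL //.
    apply: (@dvdn_trans (b %/ P * P)); last by rewrite divnK.
    by rewrite dvdn_mul // PE dvdn_exp2l // -pfactor_dvdn.
  have : (b%:Z %| s1%:Z - s2%:Z)%Z.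
    rewrite -(divnK Pb) dvdzE /= Gauss_dvd; first by apply/andP; split; [exact: hr | exact: hP].
    by rewrite -{1}(partnC p b0) mulKn // coprime_sym coprime_partC.
  move=> hb; have : (`|s1%:Z - s2%:Z| < b)%N by move: l1 l2; clear; lia.
  have [h|h] := posnP `|s1%:Z - s2%:Z|%N; first by move: h; clear; lia.
  by move=> lt; have := dvdn_leq h hb; move: lt; clear; lia.
have prod : (P %| (s1%:Z - s2%:Z) * (s1%:Z + s2%:Z + 1))%Z.
  by apply: (dvdz_lc (x := 1) (y := -1) _ (dvdz_natl Pb H1) (dvdz_natl Pb H2)); ring.
have : ~~ ((p %| s1%:Z - s2%:Z)%Z && (p %| s1%:Z + s2%:Z + 1)%Z).
  apply/negP => /andP[k1 k2]; have k3 : (p %| 2 * s1%:Z + 1)%Z.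
    by apply: (dvdz_lc (x := 1) (y := 1) _ k1 k2); ring.
  have : (p %| 1)%Z.
    apply: (om_disc p3 (dvdz_trans pb H1)); by rewrite mulr1.
  by rewrite dvdz1 /= => /eqP p1; move: pp; rewrite p1.
move=> nb; move: prod; rewrite PE => prod.
have /orP[] := Euclid_pow pp nb prod; rewrite -PE; first exact: close.
move=> hs; apply: close; rewrite -eqz_mod_dvd !modz_nat; apply/eqP; congr Posz.
have : (P %| s1 %% P + s2 %% P + 1)%N.
  have : (P %| s1 + s2 + 1)%N by move: hs; rewrite dvdzE; congr (_ %| _)%N; clear; lia.
  have -> : (s1 + s2 + 1 = (s1 %/ P + s2 %/ P) * P + (s1 %% P + s2 %% P + 1))%N.
    by rewrite {1}(divn_eq s1 P) {1}(divn_eq s2 P); ring.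
  by rewrite dvdn_addr // dvdn_mull.
have := ltn_pmod s1 P0; have := ltn_pmod s2 P0; move: side; rewrite /root_side.
move: (s1 %% P)%N (s2 %% P)%N => r1 r2; clear - P0.
move=> side q1 q2 /dvdnP[c hc].
(* Thus r1 + r2 + 1 = P, and residues lying on the same side of P / 2 must agree. *)
have c1 : c = 1%N by nia.
rewrite c1 mul1n in hc; move: side hc q1 q2; clear; lia.
Qed.

(** Dividing b by p^j and reducing s is injective once [root_side] is recorded; this extra bit is
    the factor 2. *)
Lemma sum_b_dvd (F : realFieldType) (Y M p j : nat) : prime p -> (3 %| M)%N -> (0 < j)%N ->
  sum_b F Y M (fun b => p ^ j %| b)%N <= 2 / (p ^ j)%N%:R * sum_b F Y M predT.
Proof.
move=> pp M3 j0; set q := (p ^ j)%N; have q0 : (0 < q)%N by rewrite expn_gt0 prime_gt0.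
have qF : 0 < q%:R^-1 :> F by rewrite invr_gt0 ltr0n.
pose g (w : ('I_Y.+1 * 'I_Y.+1) * bool) : F := q%:R^-1 * (w.1.1%:R)^-1.
pose Q (w : ('I_Y.+1 * 'I_Y.+1) * bool) := coprime w.1.1 M && om_root w.1.1 w.1.2.
have -> : 2 / q%:R * sum_b F Y M predT = \sum_(w | Q w) g w.
  rewrite /sum_b -mulrA mulr_sumr mulr_natl mulr2n.
  pose P (k : 'I_Y.+1 * 'I_Y.+1) := coprime k.1 M && om_root k.1 k.2.
  rewrite (eq_bigl P) => [|k]; last by rewrite andbT.
  rewrite (eq_bigl (fun w => P w.1 && predT w.2)) => [|w]; last by rewrite andbT.
  rewrite -(pair_big_dep P (fun _ => predT) (fun k _ => q%:R^-1 * (k.1%:R)^-1)) /=.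
  rewrite -big_split /=; apply: eq_bigr => k _; rewrite big_bool.
  by [].
pose h (k : 'I_Y.+1 * 'I_Y.+1) : ('I_Y.+1 * 'I_Y.+1) * bool :=
  ((inord (k.1 %/ q)%N, inord (k.2 %% (k.1 %/ q))%N), root_side (k.1`_p)%N k.2).
have dec (k : 'I_Y.+1 * 'I_Y.+1) : om_root k.1 k.2 -> (q %| k.1)%N -> [/\ (0 < k.1 %/ q)%N,
    (h k).1.1 = (k.1 %/ q)%N :> nat &
    (h k).1.2 = (k.2 %% (k.1 %/ q))%N :> nat].
  move=> /andP[sb _] qb; have b0 : (0 < k.1)%N by apply: leq_ltn_trans sb.
  have d0 : (0 < k.1 %/ q)%N by rewrite divn_gt0 // dvdn_leq.
  have d1 : (k.1 %/ q < Y.+1)%N by apply: leq_ltn_trans (leq_div _ _) (ltn_ord _).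
  have d2 : (k.2 %% (k.1 %/ q) < Y.+1)%N by apply: leq_ltn_trans (leq_mod _ _) (ltn_ord _).
  by split=> //; rewrite /h /= !inordK.
apply: (ler_sum_inj (h := h)).
- move=> [b1 s1] [b2 s2] /and3P[/= c1 r1 q1] /and3P[/= c2 r2 q2] e.
  have [d1 e1 f1] := dec (b1, s1) r1 q1; have [d2 e2 f2] := dec (b2, s2) r2 q2.
  have eb : b1 = b2.
    apply/val_inj => /=; rewrite -(divnK q1) -(divnK q2); congr (_ * _)%N.
    by have := e1; rewrite e e2 /= => ->.
  rewrite -eb in r2 q2 e f2 *; congr pair; apply/val_inj.
  apply: (om_root_lift (p := p) (j := j) (b := b1) pp _ j0 q1 r1 r2).
  + exact: coprime_dvdr M3 c1.
  + by have := f1; rewrite e f2 /= => ->.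
  + by move/(congr1 snd): e.
- move=> [b s] /and3P[/= cb rs qb]; have [d e f] := dec (b, s) rs qb.
  rewrite /Q e f /= (coprime_dvdl (dvdn_div qb) cb) /=.
  exact: (om_root_mod d (dvdn_div qb) rs).
- move=> [b s] /and3P[/= cb rs qb]; have [d e f] := dec (b, s) rs qb.
  by rewrite /g e /= -{1}(divnK qb) natrM invfM mulrC.
- by move=> w _; rewrite mulr_ge0 // ?invr_ge0 ?ler0n // ltW.
Qed.

(** * Lower bounds for the sums over a and over (b, s) *)

Definition nnrm (x y : nat) : nat := (x * (x - y) + y * y)%N.

Lemma nnrmE (x y : nat) : (y <= x)%N -> (nnrm x y)%:Z = nrm x%:Z y%:Z.
Proof. by move=> yx; rewrite /nnrm /nrm PoszD !PoszM -subzn //; ring. Qed.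

(* The pairs (x, y) with 0 < y < x lie in an open sector of angle pi / 3, so
   two of them with the same norm b and the same slope modulo b are equal. *)
Lemma sector_inj (b s x y x' y' : nat) : (0 < y < x)%N -> (0 < y' < x')%N ->
  coprime x y -> coprime x' y' -> nnrm x y = b -> nnrm x' y' = b ->
  (b %| x + s * y)%N -> (b %| x' + s * y')%N -> (x, y) = (x', y').
Proof.
move=> /andP[y0 yx] /andP[y0' yx'] cxy cxy' nb nb' h h'.
have Q0 : (y * x' = x * y')%N.
  have : (b%:Z %| y%:Z * x'%:Z - x%:Z * y'%:Z)%Z.
    apply: (@dvdz_lc _ (- y'%:Z) y%:Z (x + s * y)%N%:Z (x' + s * y')%N%:Z) => //.
    by rewrite !PoszD !PoszM; ring.
  set q := _ - _ => bq.
  (* The determinant q of the two pairs satisfies |q| / b = (2 / sqrt 3) sin theta, where theta < pi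
     / 3 is the angle between them. Algebraically, b^2 - q^2 is a product of positive terms. *)
  have small : q ^+ 2 < b%:Z ^+ 2.
    have E1 := nnrmE (ltnW yx); have E2 := nnrmE (ltnW yx').
    rewrite nb /nrm in E1; rewrite nb' /nrm in E2.
    rewrite [ltRHS]expr2 {1}E1 E2 /q.
    move: y0 yx y0' yx'; clear; rewrite -!ltz_nat.
    move: (x%:Z) (y%:Z) (x'%:Z) (y'%:Z) => X T X' T' t0 tx t0' tx'.
    rewrite -subr_gt0.
    have -> : (X ^+ 2 - X * T + T ^+ 2) * (X' ^+ 2 - X' * T' + T' ^+ 2) - (T * X' - X * T') ^+ 2
      = (X * (X' - T') + T * T') * (X' * (X - T) + T * T') by ring.
    by apply: mulr_gt0; apply: addr_gt0; apply: mulr_gt0; lia.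
  have : (`|q| < b)%N by move: small; clear; nia.
  have [q0|q0] := posnP `|q|%N.
    by move=> _; move: q0; rewrite /q; clear; lia.
  by move=> lt; have := dvdn_leq q0 bq; move: lt; clear; lia.
have xx : x = x'.
  apply/eqP; rewrite eqn_dvd; apply/andP; split.
    by rewrite -(Gauss_dvdr _ cxy) Q0 dvdn_mulr.
  by rewrite -(Gauss_dvdr _ cxy') mulnC -Q0 dvdn_mull.
congr pair => //; move: Q0; rewrite -xx mulnC => /eqP; rewrite eqn_pmul2l => [/eqP //|].
exact: leq_ltn_trans yx.
Qed.

(** The residue of - x / y modulo b. [find] would return b if there were none; [slopeP] excludes
    this for y prime to b. *)
Definition slope (b x y : nat) : nat := find (fun s => (b %| x + s * y)%N) (iota 0 b).

Lemma slopeP (b x y : nat) : (0 < b)%N -> coprime b y ->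
  (slope b x y < b)%N /\ (b %| x + slope b x y * y)%N.
Proof.
move=> b0 c; have [s sb hs] := solve_linear x%:Z b0 (c : coprimez b y%:Z).
have hs' : has (fun s => (b %| x + s * y)%N) (iota 0 b).
  by apply/hasP; exists s; [rewrite mem_iota | move: hs; rewrite dvdzE].
have lt : (slope b x y < b)%N by have := hs'; rewrite has_find size_iota.
split=> //; have := nth_find 0%N hs'; by rewrite nth_iota.
Qed.

Lemma slope_root (b x y : nat) : (0 < y < x)%N -> coprime x y -> nnrm x y = b ->
  [/\ om_root b (slope b x y) & (b %| x + slope b x y * y)%N].
Proof.
move=> /andP[y0 yx] cxy nb; have b0 : (0 < b)%N.
  by rewrite -nb /nnrm addn_gt0 [X in _ || X]muln_gt0 y0 orbT.
have cb : coprime b y.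
  rewrite -nb /nnrm coprime_sym /coprime addnC gcdnMDl -/(coprime _ _).
  rewrite coprimeMr [coprime y x]coprime_sym cxy /=.
  by rewrite /coprime -(gcdnDr y) subnK ?(ltnW yx) // gcdnC.
have [lt hs] := slopeP x b0 cb; split=> //; rewrite /om_root lt /=.
move: (slope b x y) lt hs => s lt hs.
have : (b%:Z %| y%:Z ^+ 2 * (s%:Z ^+ 2 + s%:Z + 1))%Z.
  apply: (@dvdz_lc _ 1 (- (x%:Z - s%:Z * y%:Z - y%:Z)) b%:Z (x + s * y)%N%:Z) => //.
  have <- : nrm x%:Z y%:Z = b%:Z by rewrite -nnrmE ?nb // ltnW.
  by rewrite /nrm PoszD PoszM; ring.
rewrite Gauss_dvdzr; last by rewrite coprimezE abszX coprimeXr.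
by rewrite dvdzE; congr (_ %| _)%N; clear; lia.
Qed.

Definition harm (F : realFieldType) (K : nat) : F := \sum_(k < K.+1 | (0 < k)%N) (k%:R)^-1.

Lemma nnrm_dec (x y : nat) : (0 < y < x)%N -> let d := gcdn x y in
  [/\ (0 < d)%N, (0 < y %/ d < x %/ d)%N, coprime (x %/ d) (y %/ d) &
      nnrm x y = (d ^ 2 * nnrm (x %/ d) (y %/ d))%N].
Proof.
move=> /andP[y0 yx] d; have d0 : (0 < d)%N by rewrite gcdn_gt0 y0 orbT.
have dx : (d %| x)%N by exact: dvdn_gcdl.
have dy : (d %| y)%N by exact: dvdn_gcdr.
have Ex := divnK dx; have Ey := divnK dy.
split=> //.
- rewrite divn_gt0 // dvdn_leq //=.
  by rewrite -(ltn_pmul2r d0) Ex Ey.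
- rewrite /coprime -(eqn_pmul2r d0) mul1n; apply/eqP.
  by rewrite muln_gcdl Ex Ey.
- rewrite -{1}Ex -{1}Ey /nnrm -mulnBl; ring.
Qed.

Lemma nnrm_le (x y : nat) : (y <= x)%N -> (nnrm x y <= x ^ 2)%N.
Proof.
move=> yx; rewrite /nnrm; have -> : (x ^ 2 = x * (x - y) + x * y)%N.
  by rewrite -mulnDr subnK.
by rewrite leq_add2l leq_mul2r yx orbT.
Qed.

Lemma sum_inv_sq2 (F : realFieldType) (n : nat) :
  \sum_(i < n | (0 < i)%N) (i%:R ^+ 2)^-1 <= 2 :> F.
Proof.
case: n => [|[|n]]; rewrite ?big_ord0 ?ler0n //.
  by rewrite big_mkcond big_ord1.
rewrite (bigD1 (Ordinal (isT : (1 < n.+2)%N))) //= expr1n invr1.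
have := sum_inv_sq F n.+2 (isT : (0 < 1)%N); rewrite invr1 => h.
rewrite (_ : 2 = 1 + 1) //; apply: lerD => //.
apply: le_trans h; rewrite le_eqVlt; apply/orP; left; apply/eqP.
by apply: eq_bigl => -[[|[|i]] hi].
Qed.

Lemma card_range (K k : nat) : (k <= K)%N ->
  (k <= #|[pred j : 'I_K.+1 | (0 < j <= k)%N]|)%N.
Proof.
move=> kK; have lt (i : 'I_k) : (i.+1 < K.+1)%N by rewrite ltnS (leq_trans _ kK).
pose f (i : 'I_k) : 'I_K.+1 := Ordinal (lt i).
have finj : injective f by move=> x y /(congr1 val) [] /val_inj.
rewrite -[leqLHS]card_ord -(card_imset _ finj); apply: subset_leq_card.
by apply/fintype.subsetP => x /imsetP[i _ ->]; rewrite inE /=.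
Qed.

(** A primitive pair of norm b has as slope a root s modulo b, and by [sector_inj] distinct pairs
    give distinct (b, s). The pairs used are x = 1 + k M, y = j M with 0 < j <= k, whose norm is
    prime to M and at most (1 + k M)^2 <= 4 k^2 M^2; summing over the k values of j leaves 1 / (4
    M^2 k). A common factor d is divided out and recorded, at the cost of the sum of 1 / d^2, at
    most 2. *)
Lemma sum_b_lower (F : realFieldType) (Y M K : nat) : (1 < M)%N ->
  ((1 + K * M) ^ 2 <= Y)%N ->
  (8 * M%:R ^+ 2)^-1 * harm F K <= sum_b F Y M predT.
Proof.
move=> M1 KY; have M0 : (0 < M)%N by apply: ltn_trans M1.
pose X (k : nat) := (1 + k * M)%N; pose T (j : nat) := (j * M)%N.
pose P (w : 'I_K.+1 * 'I_K.+1) := (0 < w.2 <= w.1)%N.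
pose Q (w : 'I_Y.+1 * ('I_Y.+1 * 'I_Y.+1)) :=
  (0 < w.1)%N && (coprime w.2.1 M && om_root w.2.1 w.2.2).
pose g (w : 'I_Y.+1 * ('I_Y.+1 * 'I_Y.+1)) : F := (w.1%:R ^+ 2)^-1 * (w.2.1%:R)^-1.
pose f (w : 'I_K.+1 * 'I_K.+1) : F := ((nnrm (X w.1) (T w.2))%:R)^-1.
have sumQ : \sum_(w | Q w) g w <= 2 * sum_b F Y M predT.
  rewrite -(pair_big_dep (fun d : 'I_Y.+1 => 0 < d)%N
    (fun _ (k : 'I_Y.+1 * 'I_Y.+1) => coprime k.1 M && om_root k.1 k.2)
    (fun (d : 'I_Y.+1) (k : 'I_Y.+1 * 'I_Y.+1) => (d%:R ^+ 2)^-1 * (k.1%:R)^-1)) /=.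
  under eq_bigr => d _ do rewrite -mulr_sumr.
  rewrite -mulr_suml /sum_b; under [X in _ <= _ * X]eq_bigl => k do rewrite andbT.
  apply: ler_wpM2r; last exact: sum_inv_sq2.
  by apply: sumr_ge0 => k _; rewrite invr_ge0.
have sumP : (4 * M%:R ^+ 2)^-1 * harm F K <= \sum_(w | P w) f w.
  rewrite -(pair_big_dep predT (fun k j : 'I_K.+1 => 0 < j <= k)%N
    (fun k j : 'I_K.+1 => ((nnrm (X k) (T j))%:R)^-1)) /=.
  rewrite /harm mulr_sumr big_mkcond; apply: ler_sum => k _.
  case: ifP => [k0|_]; last by apply: sumr_ge0 => j _; rewrite invr_ge0.
  apply: (@le_trans _ _ (\sum_(j < K.+1 | (0 < j <= k)%N) ((X k ^ 2)%N%:R)^-1)); last first.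
    apply: ler_sum => j /andP[j0 jk]; rewrite lef_pV2 ?posrE ?ltr0n ?expn_gt0 //.
      by rewrite ler_nat nnrm_le // /T /X (leq_trans (leq_mul jk (leqnn M))) // leq_addl.
    by rewrite /nnrm addn_gt0; apply/orP; right; rewrite /T !muln_gt0 j0 M0.
  rewrite sumr_const.
  apply: (@le_trans _ _ (((X k ^ 2)%N%:R)^-1 *+ k)); last first.
    by apply: ler_wpMn2l; rewrite ?invr_ge0 // card_range // -ltnS.
  rewrite -[leRHS]mulr_natl natrX; have k1 : 1 <= k%:R :> F by rewrite ler1n.
  have m1 : 1 <= M%:R :> F by rewrite ler1n.
  rewrite /X natrD natrM; move: (k%:R : F) (M%:R : F) k1 m1 => x m x1 m1.
  have x0 : 0 < x by apply: lt_le_trans x1.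
  have m0 : 0 < m by apply: lt_le_trans m1.
  have xm : 1 <= x * m by rewrite -[1]mulr1; apply: ler_pM.
  have e0 : 0 < (1 + x * m) ^+ 2 by apply: exprn_gt0; lra.
  rewrite ler_pdivlMr // mulrC -invfM ler_pdivrMr; last by rewrite !mulr_gt0 // exprn_gt0.
  rewrite (_ : x * (4 * m ^+ 2 * x) = (x * m + x * m) ^+ 2); last by ring.
  by apply: lerXn2r; rewrite ?nnegrE; lra.
have cM (w : 'I_K.+1 * 'I_K.+1) : P w -> coprime (nnrm (X w.1) (T w.2)) M.
  move=> /andP[_ jk]; rewrite /nnrm /X /T -addnBA ?leq_mul2r ?jk ?orbT // -mulnBl.
  rewrite coprime_sym /coprime; move: (w.1 : nat) (w.2 : nat) => k j; move: (k - j)%N => c.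
  rewrite (_ : (1 + k * M) * (1 + c * M) + j * M * (j * M) = (k + c + k * c * M + j * j * M) * M + 1)%N; last by ring.
  by rewrite gcdnMDl gcdn1.
have dec (w : 'I_K.+1 * 'I_K.+1) : P w -> (0 < T w.2 < X w.1)%N.
  by move=> /andP[j0 jk]; rewrite /T muln_gt0 j0 M0 /X add1n ltnS leq_mul2r jk orbT.
pose dd (w : 'I_K.+1 * 'I_K.+1) := gcdn (X w.1) (T w.2).
pose xx (w : 'I_K.+1 * 'I_K.+1) := (X w.1 %/ dd w)%N.
pose yy (w : 'I_K.+1 * 'I_K.+1) := (T w.2 %/ dd w)%N.
pose bb (w : 'I_K.+1 * 'I_K.+1) := nnrm (xx w) (yy w).
pose h (w : 'I_K.+1 * 'I_K.+1) : 'I_Y.+1 * ('I_Y.+1 * 'I_Y.+1) :=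
  (inord (dd w), (inord (bb w), inord (slope (bb w) (xx w) (yy w)))).
have hP (w : 'I_K.+1 * 'I_K.+1) : P w -> [/\ (h w).1 = dd w :> nat, (h w).2.1 = bb w :> nat,
    (h w).2.2 = slope (bb w) (xx w) (yy w) :> nat & om_root (bb w) (slope (bb w) (xx w) (yy w))].
  move=> Pw; have [d0 yx cxy E] := nnrm_dec (dec w Pw).
  have [rt _] := slope_root yx cxy erefl.
  have nY : (nnrm (X w.1) (T w.2) <= Y)%N.
    apply: leq_trans (nnrm_le _) _; first by case/andP: (dec w Pw) => _ /ltnW.
    apply: leq_trans KY; rewrite leq_exp2r // leq_add2l leq_mul2r -ltnS ltn_ord orbT //.
  have bY : (bb w <= Y)%N.
    by apply: leq_trans nY; rewrite E leq_pmull // expn_gt0 d0.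
  have dY : (dd w <= Y)%N.
    apply: leq_trans nY; rewrite E; apply: (@leq_trans (dd w ^ 2)); first by rewrite leq_pmulr.
    rewrite leq_pmulr //; have : (0 < bb w)%N by case/andP: rt => /(leq_ltn_trans (leq0n _)).
    by [].
  have sY : (slope (bb w) (xx w) (yy w) <= Y)%N.
    by apply: leq_trans bY; apply: ltnW; case/andP: rt.
  by rewrite /h /= !inordK.
have main : \sum_(w | P w) f w <= \sum_(w | Q w) g w.
  apply: (ler_sum_inj (h := h)).
  - move=> w w' Pw Pw' e.
    have [e1 e2 e3 _] := hP w Pw; have [e1' e2' e3' _] := hP w' Pw'.
    have Ed : dd w = dd w' by rewrite -e1 e e1'.
    have Eb : bb w = bb w' by rewrite -e2 e e2'.
    have Es : slope (bb w) (xx w) (yy w) = slope (bb w') (xx w') (yy w') by rewrite -e3 e e3'.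
    have [d0 yx cxy E] := nnrm_dec (dec w Pw); have [d0' yx' cxy' E'] := nnrm_dec (dec w' Pw').
    have [_ r] := slope_root yx cxy erefl; have [_ r'] := slope_root yx' cxy' erefl.
    have := sector_inj yx yx' cxy cxy' erefl (esym Eb) r.
    rewrite [X in (X %| _)%N -> _]Eb [slope _ _ _]Es => /(_ r') [E1 E2].
    have EX : X w.1 = X w'.1.
      transitivity (xx w * dd w)%N; first by rewrite divnK // dvdn_gcdl.
      by rewrite [xx w]E1 Ed divnK // dvdn_gcdl.
    have ET : T w.2 = T w'.2.
      transitivity (yy w * dd w)%N; first by rewrite divnK // dvdn_gcdr.
      by rewrite [yy w]E2 Ed divnK // dvdn_gcdr.
    move: EX ET => /eqP; rewrite eqn_add2l eqn_pmul2r // => /eqP /val_inj E3 /eqP.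
    rewrite eqn_pmul2r // => /eqP /val_inj E4.
    by rewrite [w]surjective_pairing [w']surjective_pairing E3 E4.
  - move=> w Pw; have [e1 e2 e3 rt] := hP w Pw; rewrite /Q e1 e2 e3 rt andbT.
    have [d0 yx cxy E] := nnrm_dec (dec w Pw); rewrite d0 /=.
    by have := cM w Pw; rewrite E coprimeMl => /andP[].
  - move=> w Pw; have [e1 e2 e3 rt] := hP w Pw; rewrite /f /g e1 e2.
    have [d0 yx cxy E] := nnrm_dec (dec w Pw).
    by rewrite E natrM natrX invfM.
  - by move=> w _; rewrite mulr_ge0 // invr_ge0 // exprn_ge0.
have := le_trans sumP (le_trans main sumQ).
rewrite (_ : 8 * M%:R ^+ 2 = 2 * (4 * M%:R ^+ 2)); last by ring.
by move=> le; rewrite invfM -mulrA ler_pdivrMl.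
Qed.

(** Keep only a = 1 + k M, which is prime to M and at most 2 k M. *)
Lemma sum_a_lower (F : realFieldType) (Y M K : nat) : (0 < M)%N -> (1 + K * M <= Y)%N ->
  (2 * M%:R)^-1 * harm F K <= sum_a F Y M predT.
Proof.
move=> M0 KY; rewrite /harm mulr_sumr.
have lt (k : 'I_K.+1) : (1 + k * M < Y.+1)%N.
  by rewrite ltnS (leq_trans _ KY) // leq_add2l leq_mul2r -ltnS ltn_ord orbT.
apply: (ler_sum_inj (h := fun k => Ordinal (lt k))).
- move=> x y _ _ /(congr1 val) /= /eqP.
  by rewrite eqn_add2l eqn_pmul2r // => /eqP /val_inj.
- move=> k _ /=; rewrite andbT.
  by rewrite coprime_sym /coprime addnC gcdnMDl gcdn1.
- move=> k k0 /=; rewrite -invfM lef_pV2 ?posrE ?ltr0n //; last first.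
    by rewrite !mulr_gt0 // ltr0n.
  rewrite -!natrM ler_nat; have : (1 <= k * M)%N by rewrite muln_gt0 k0 M0.
  by rewrite -mulnA [(M * k)%N]mulnC mul2n -addnn leq_add2r.
- by move=> j _; rewrite invr_ge0.
Qed.

(** The components are a, (b, s) and (m, t). *)
Definition tup (Y : nat) : finType :=
  ('I_Y.+1 * ('I_Y.+1 * 'I_Y.+1) * ('I_Y.+1 * 'I_Y.+1))%type.

Definition tg (Y : nat) (x : tup Y) : nat := (x.1.1 * x.1.2.1 * x.2.1)%N.

Definition tadm (Y M : nat) (x : tup Y) : bool :=
  [&& ((0 < x.1.1)%N && coprime x.1.1 M),
      (coprime x.1.2.1 M && om_root x.1.2.1 x.1.2.2) &
      (coprime x.2.1 M && om_root x.2.1 x.2.2)].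

Lemma sum_tup (F : realFieldType) (Y M : nat) (PA PB PM : pred nat) :
  \sum_(x : tup Y | tadm M x && [&& PA x.1.1, PB x.1.2.1 & PM x.2.1]) ((tg x)%:R)^-1 =
  sum_a F Y M PA * sum_b F Y M PB * sum_b F Y M PM.
Proof.
rewrite /sum_a /sum_b big_distrl /= big_distrl /=.
pose A (a : 'I_Y.+1) := [&& (0 < a)%N, coprime a M & PA a].
pose B (P : pred nat) (k : 'I_Y.+1 * 'I_Y.+1) := [&& coprime k.1 M, om_root k.1 k.2 & P k.1].
rewrite (eq_bigl (fun x : tup Y => (A x.1.1 && B PB x.1.2) && B PM x.2)); last first.
  move=> x; rewrite /tadm /A /B; move: (0 < _)%N => b1.
  by rewrite -!andbA; do !bool_congr.
rewrite -(pair_big_dep (fun y : 'I_Y.+1 * ('I_Y.+1 * 'I_Y.+1) => A y.1 && B PB y.2) (fun _ => B PM)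
  (fun (y : 'I_Y.+1 * ('I_Y.+1 * 'I_Y.+1)) (z : 'I_Y.+1 * 'I_Y.+1) =>
     (((y.1 * y.2.1)%N * z.1)%N%:R : F)^-1)) /=.
rewrite -(pair_big_dep A (fun _ => B PB)
  (fun (a : 'I_Y.+1) (k : 'I_Y.+1 * 'I_Y.+1) => \sum_(z | B PM z) ((a * k.1 * z.1)%N%:R : F)^-1)) /=.
apply: eq_bigr => a _; rewrite -mulrA big_distrl /= mulr_sumr; apply: eq_bigr => k _.
rewrite !mulr_sumr; apply: eq_bigr => z _.
by rewrite !natrM !invfM mulrA.
Qed.

Lemma sq_dvd3 (p x y z : nat) : prime p -> (p ^ 2 %| x * y * z)%N ->
  [|| p ^ 2 %| x, p ^ 2 %| y, p ^ 2 %| z, (p %| x) && (p %| y),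
      (p %| x) && (p %| z) | (p %| y) && (p %| z)]%N.
Proof.
move=> pp h; have cop n : ~~ (p %| n)%N -> coprime (p ^ 2) n.
  by move=> hn; rewrite coprimeXl // prime_coprime.
have [px|/cop nx] := boolP (p %| x)%N.
  have [py|/cop ny] := boolP (p %| y)%N; first by rewrite !orbT.
  have [pz|/cop nz] := boolP (p %| z)%N; first by rewrite !orbT.
  by rewrite Gauss_dvdl // Gauss_dvdl // in h; rewrite h.
have [py|/cop ny] := boolP (p %| y)%N.
  have [pz|/cop nz] := boolP (p %| z)%N; first by rewrite !orbT.
  by rewrite Gauss_dvdl // Gauss_dvdr // in h; rewrite h !orbT.
by rewrite -mulnA Gauss_dvdr // Gauss_dvdr // in h; rewrite h !orbT.
Qed.

(** * Tuples whose product g is divisible by p or by p^2 *)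

Definition tsum (F : realFieldType) (Y M : nat) (P : pred nat) : F :=
  \sum_(x : tup Y | tadm M x && P (tg x)) ((tg x)%:R)^-1.

Lemma tsumT (F : realFieldType) (Y M : nat) :
  tsum F Y M predT = sum_a F Y M predT * sum_b F Y M predT * sum_b F Y M predT.
Proof. by rewrite -sum_tup; apply: eq_bigl => x. Qed.

Lemma sum_a_ge0 (F : realFieldType) (Y M : nat) P : 0 <= sum_a F Y M P.
Proof. by apply: sumr_ge0 => a _; rewrite invr_ge0. Qed.

Lemma sum_b_ge0 (F : realFieldType) (Y M : nat) P : 0 <= sum_b F Y M P.
Proof. by apply: sumr_ge0 => a _; rewrite invr_ge0. Qed.

(** p divides a, b or m, with relative weights 1 / p, 2 / p, 2 / p: 5 = 1 + 2 + 2. *)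
Lemma tsum_dvd (F : realFieldType) (Y M p : nat) : prime p -> (3 %| M)%N ->
  tsum F Y M (fun g => p %| g)%N <= 5 / p%:R * tsum F Y M predT.
Proof.
move=> pp M3; have p0 : 0 < p%:R^-1 :> F by rewrite invr_gt0 ltr0n prime_gt0.
pose D := fun n : nat => (p %| n)%N.
have ha := sum_a_dvd F Y M (prime_gt0 pp).
have hb := sum_b_dvd F Y pp M3 (isT : (0 < 1)%N); rewrite expn1 in hb.
have A0 := sum_a_ge0 F Y M predT; have B0 := sum_b_ge0 F Y M predT.
apply: (@le_trans _ _ (sum_a F Y M D * sum_b F Y M predT * sum_b F Y M predT +
   sum_a F Y M predT * sum_b F Y M D * sum_b F Y M predT +
   sum_a F Y M predT * sum_b F Y M predT * sum_b F Y M D)).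
  rewrite -!sum_tup /tsum !(big_mkcond (fun x => tadm M x && _)) -!big_split /=.
  apply: ler_sum => x _; have i0 : 0 <= ((tg x)%:R)^-1 :> F by rewrite invr_ge0.
  case: (tadm M x); last by rewrite !addr0.
  rewrite {1}/tg !Euclid_dvdM // /D /= !andbT.
  by case: (p %| x.1.1)%N; case: (p %| x.1.2.1)%N; case: (p %| x.2.1)%N; rewrite /=; lra.
rewrite tsumT; move: (sum_a F Y M predT) (sum_b F Y M predT) ha hb A0 B0 => A B.
rewrite -/D; move: (sum_a F Y M D) (sum_b F Y M D) (p%:R^-1) p0 => a b q q0 ha hb A0 B0.
have h1 : a * B * B <= q * A * B * B by rewrite !ler_wpM2r.
have h2 : A * b * B <= A * (2 * q * B) * B by rewrite ler_wpM2r // ler_wpM2l.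
have h3 : A * B * b <= A * B * (2 * q * B) by rewrite ler_wpM2l // mulr_ge0.
apply: le_trans (lerD (lerD h1 h2) h3) _; rewrite le_eqVlt; apply/orP; left; apply/eqP; ring.
Qed.

(** Either p^2 divides one of a, b, m or p divides two of them: 13 = (1 + 2 + 2) + (2 + 2 + 4). *)
Lemma tsum_sq_dvd (F : realFieldType) (Y M p : nat) : prime p -> (3 %| M)%N ->
  tsum F Y M (fun g => p ^ 2 %| g)%N <= 13 / p%:R ^+ 2 * tsum F Y M predT.
Proof.
move=> pp M3; have p0 : 0 < p%:R^-1 :> F by rewrite invr_gt0 ltr0n prime_gt0.
pose D := fun n : nat => (p %| n)%N; pose E := fun n : nat => (p ^ 2 %| n)%N.
have ha := sum_a_dvd F Y M (prime_gt0 pp).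
have hb := sum_b_dvd F Y pp M3 (isT : (0 < 1)%N); rewrite expn1 in hb.
have p20 : (0 < p ^ 2)%N by rewrite expn_gt0 prime_gt0.
have ha2 := sum_a_dvd F Y M p20.
have hb2 := sum_b_dvd F Y pp M3 (isT : (0 < 2)%N).
rewrite natrX -exprVn in ha2 hb2; rewrite -exprVn.
have A0 := sum_a_ge0 F Y M predT; have B0 := sum_b_ge0 F Y M predT.
have a0 := sum_a_ge0 F Y M D; have b0 := sum_b_ge0 F Y M D.
apply: (@le_trans _ _ (sum_a F Y M E * sum_b F Y M predT * sum_b F Y M predT +
   sum_a F Y M predT * sum_b F Y M E * sum_b F Y M predT +
   sum_a F Y M predT * sum_b F Y M predT * sum_b F Y M E +
   sum_a F Y M D * sum_b F Y M D * sum_b F Y M predT +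
   sum_a F Y M D * sum_b F Y M predT * sum_b F Y M D +
   sum_a F Y M predT * sum_b F Y M D * sum_b F Y M D)).
  rewrite -!sum_tup /tsum !(big_mkcond (fun x => tadm M x && _)) -!big_split /=.
  apply: ler_sum => x _; have i0 : 0 <= ((tg x)%:R)^-1 :> F by rewrite invr_ge0.
  case: (tadm M x); last by rewrite !addr0.
  have := @sq_dvd3 p x.1.1 x.1.2.1 x.2.1 pp; rewrite -/(tg x) -/(E (tg x)).
  rewrite /= !andbT -/(E _) -/(E x.1.2.1) -/(E x.2.1) -/(D x.1.1) -/(D x.1.2.1) -/(D x.2.1).
  move: (E (tg x)) (E x.1.1) (E x.1.2.1) (E x.2.1) (D x.1.1) (D x.1.2.1) (D x.2.1).
  by do 7![case]; rewrite /= => h; try lra; exfalso; exact: (not_false_is_true (h isT)).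
rewrite tsumT; move: (sum_a F Y M predT) (sum_b F Y M predT) ha hb ha2 hb2 A0 B0 => A B.
rewrite -/D -/E; move: (sum_a F Y M E) (sum_b F Y M E) => a' b'.
move: (sum_a F Y M D) (sum_b F Y M D) (p%:R^-1) p0 a0 b0 => a b q q0 a0 b0 ha hb ha2 hb2 A0 B0.
have h1 : a' * B * B <= q ^+ 2 * A * B * B by rewrite !ler_wpM2r.
have h2 : A * b' * B <= A * (2 * q ^+ 2 * B) * B by rewrite ler_wpM2r // ler_wpM2l.
have h3 : A * B * b' <= A * B * (2 * q ^+ 2 * B) by rewrite ler_wpM2l // mulr_ge0.
have h4 : a * b * B <= (q * A) * (2 * q * B) * B by rewrite ler_wpM2r // ler_pM.
have h5 : a * B * b <= (q * A) * B * (2 * q * B).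
  by apply: ler_pM => //; rewrite ?mulr_ge0 // ler_wpM2r.
have h6 : A * b * b <= A * (2 * q * B) * (2 * q * B).
  by apply: ler_pM => //; rewrite ?mulr_ge0 // ler_wpM2l.
apply: le_trans (lerD (lerD (lerD (lerD (lerD h1 h2) h3) h4) h5) h6) _.
rewrite le_eqVlt; apply/orP; left; apply/eqP; ring.
Qed.

(** Primes up to Y suffice, since a prime factor of g divides a, b or m. *)
Definition tsqf (Y : nat) (x : tup Y) : bool :=
  [forall p : 'I_Y.+1, prime p ==> ~~ (p ^ 2 %| tg x)%N].

Lemma tadm_gt0 (Y M : nat) (x : tup Y) : tadm M x -> (0 < tg x)%N.
Proof.
move=> /and3P[/andP[a0 _] /andP[_ /andP[sb _]] /andP[_ /andP[tm _]]].
by rewrite /tg !muln_gt0 a0 (leq_ltn_trans (leq0n _) sb) (leq_ltn_trans (leq0n _) tm).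
Qed.

Lemma tadm_coprime (Y M : nat) (x : tup Y) : tadm M x -> coprime (tg x) M.
Proof.
by move=> /and3P[/andP[_ c1] /andP[c2 _] /andP[c3 _]]; rewrite /tg !coprimeMl c1 c2 c3.
Qed.

Lemma tadm_prime_le (Y M p : nat) (x : tup Y) :
  tadm M x -> prime p -> (p %| tg x)%N -> (p <= Y)%N.
Proof.
move=> ad pp; have g0 := tadm_gt0 ad; move: g0.
rewrite /tg !muln_gt0 => /andP[/andP[a0 b0] m0]; rewrite !Euclid_dvdM // => h.
have le (i : 'I_Y.+1) : (0 < i)%N -> (p %| i)%N -> (p <= Y)%N.
  by move=> i0 /(dvdn_leq i0) /leq_trans; apply; rewrite -ltnS.
by case/orP: h => [/orP[]|]; apply: le.
Qed.

Lemma tadm_prime_gt (Y M P p : nat) (x : tup Y) :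
  (forall q, prime q -> (q <= P)%N -> (q %| M)%N) ->
  tadm M x -> prime p -> (p %| tg x)%N -> (P < p)%N.
Proof.
move=> hM ad pp pg; rewrite ltnNge; apply/negP => /(hM _ pp) pM.
have := coprime_dvdl pg (tadm_coprime ad); rewrite prime_coprime // pM //.
Qed.

Lemma tsqf_squarefree (Y M : nat) (x : tup Y) :
  tadm M x -> tsqf x -> squarefree (tg x).
Proof.
move=> ad /forallP sf p pp; apply/negP => pg.
have pY : (p < Y.+1)%N by rewrite ltnS (tadm_prime_le ad pp) // (dvdn_trans _ pg) // dvdn_exp.
by have := sf (Ordinal pY); rewrite /= pp pg.
Qed.

Lemma sum_exists_le (F : realFieldType) (T I : finType) (A : pred T) (P : pred I)
    (Q : I -> pred T) (f : T -> F) :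
  (forall x, 0 <= f x) -> (forall x, A x -> exists2 i, P i & Q i x) ->
  \sum_(x | A x) f x <= \sum_(i | P i) \sum_(x | Q i x) f x.
Proof.
move=> f0 h; rewrite [leRHS](eq_bigr (fun i => \sum_x if Q i x then f x else 0)); last first.
  by move=> i _; rewrite big_mkcond.
rewrite exchange_big big_mkcond; apply: ler_sum => x _.
have pos i : 0 <= if Q i x then f x else 0 by case: ifP.
case: ifP => [/h[i Pi Qi]|_]; last by apply: sumr_ge0.
by rewrite (bigD1 i) //= Qi lerDl sumr_ge0.
Qed.

(** The prime factors of g exceed P because g is prime to M, and the sum of 13 / p^2 over p > P is
    at most 13 / P. *)
Lemma sqf_lower (F : realFieldType) (Y M P : nat) : (0 < P)%N -> (3 %| M)%N ->
  (forall q, prime q -> (q <= P)%N -> (q %| M)%N) ->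
  (1 - 13 / P%:R) * tsum F Y M predT <=
  \sum_(x : tup Y | tadm M x && tsqf x) ((tg x)%:R)^-1.
Proof.
move=> P0 M3 hM; set S := \sum_(x | _) _.
have -> : tsum F Y M predT = S + \sum_(x : tup Y | tadm M x && ~~ tsqf x) ((tg x)%:R)^-1.
  rewrite /tsum (bigID (fun x : tup Y => tsqf x)) /=.
  by congr (_ + _); apply: eq_bigl => x; rewrite andbT.
set S' := \sum_(x | tadm M x && ~~ tsqf x) _.
have T0 : 0 <= S by apply: sumr_ge0 => x _; rewrite invr_ge0.
have T0' : 0 <= S' by apply: sumr_ge0 => x _; rewrite invr_ge0.
have TE : tsum F Y M predT = S + S'.
  rewrite /tsum (bigID (fun x : tup Y => tsqf x)) /=.
  by congr (_ + _); apply: eq_bigl => x; rewrite andbT.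
suff: S' <= 13 / P%:R * (S + S') by move=> h; rewrite mulrBl mul1r lerBlDr lerD2l.
rewrite -TE.
apply: (@le_trans _ _ (\sum_(p < Y.+1 | (P < p)%N && prime p) tsum F Y M (fun g => p ^ 2 %| g)%N)).
  rewrite /tsum; apply: sum_exists_le => [x|x /andP[ad]]; first by rewrite invr_ge0.
  rewrite negb_forall => /existsP[p]; rewrite negb_imply negbK => /andP[pp pg].
  exists p; last by rewrite ad.
  by rewrite pp andbT (tadm_prime_gt hM ad pp) // (dvdn_trans _ pg) // dvdn_exp.
apply: (@le_trans _ _ (\sum_(p < Y.+1 | (P < p)%N && prime p) 13 * (p%:R ^+ 2)^-1 * tsum F Y M predT)).
  by apply: ler_sum => p /andP[_ pp]; apply: tsum_sq_dvd.
rewrite -mulr_suml -mulr_sumr ler_wpM2r //; first by rewrite TE addr_ge0.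
rewrite ler_wpM2l //; apply: le_trans (sum_inv_sq F Y.+1 P0).
rewrite [leRHS](bigID (fun p : 'I_Y.+1 => prime p)) /= lerDl.
by apply: sumr_ge0 => p _; rewrite invr_ge0 exprn_ge0.
Qed.

(** The sum of 1 / p over p dividing g need not be small for an individual g. After exchanging the
    sums each p > P costs only (1 / p)(5 / p). *)
Lemma prime_div_upper (F : realFieldType) (Y M P : nat) : (0 < P)%N -> (3 %| M)%N ->
  (forall q, prime q -> (q <= P)%N -> (q %| M)%N) ->
  \sum_(x : tup Y | tadm M x) ((tg x)%:R)^-1 *
     (\sum_(p < Y.+1 | prime p && (p %| tg x)%N) (p%:R)^-1) <=
  5 / P%:R * tsum F Y M predT.
Proof.
move=> P0 M3 hM.
have T0 : 0 <= tsum F Y M predT by apply: sumr_ge0 => x _; rewrite invr_ge0.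
under eq_bigr => x _ do rewrite mulr_sumr.
rewrite (exchange_big_dep (fun p : 'I_Y.+1 => prime p)) /=; last by move=> x p _ /andP[].
apply: (@le_trans _ _ (\sum_(p < Y.+1 | (P < p)%N) 5 * (p%:R ^+ 2)^-1 * tsum F Y M predT)); last first.
  rewrite -mulr_suml -mulr_sumr ler_wpM2r // ler_wpM2l //.
  exact: sum_inv_sq.
rewrite big_mkcond [leRHS]big_mkcond; apply: ler_sum => p _.
have R0 : 0 <= 5 * (p%:R ^+ 2)^-1 * tsum F Y M predT.
  by rewrite !mulr_ge0 // invr_ge0 exprn_ge0.
case: ifP => pp; last by case: ifP.
case: ifP => pP; last first.
  rewrite big1 // => x /and3P[ad _ pg]; have := tadm_prime_gt hM ad pp pg.
  by rewrite pP.
rewrite -mulr_suml (eq_bigl (fun x : tup Y => tadm M x && (p %| tg x)%N)) => [|x]; last first.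
  by rewrite pp.
have := tsum_dvd F Y pp M3; rewrite {1}/tsum => h.
apply: le_trans (ler_wpM2r _ h) _; first by rewrite invr_ge0.
by rewrite le_eqVlt; apply/orP; left; apply/eqP; rewrite expr2 invfM; ring.
Qed.

Lemma harm_ge_ln (R : realType) (K : nat) : ln (K.+1%:R) <= harm R K.
Proof.
elim: K => [|K IH].
  by rewrite ln1; apply: sumr_ge0 => k _; rewrite invr_ge0.
have -> : harm R K.+1 = harm R K + (K.+1%:R)^-1.
  by rewrite /harm big_mkcond big_ord_recr -big_mkcond.
apply: le_trans _ (lerD IH (lexx _)).
have k0 : 0 < K.+1%:R :> R by rewrite ltr0n.
have -> : K.+2%:R = K.+1%:R * (1 + (K.+1%:R)^-1) :> R.
  by rewrite mulrDr mulr1 mulfV ?gt_eqF // natr1.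
have i0 : 0 < (K.+1%:R)^-1 :> R by rewrite invr_gt0.
by rewrite lnM ?posrE // ?addr_gt0 // lerD2l; apply: le_ln1Dx; apply: lt_trans i0; rewrite oppr_lt0.
Qed.

(** * Zeros of the equations of the complement *)

Definition upoly (K : fieldType) (d : nat) (g : K -> K) : Prop :=
  exists2 p : {poly K}, (size p <= d)%N & forall t, g t = p.[t].

Definition upd (K : Type) (x : nat -> K) (i : nat) (t : K) : nat -> K :=
  fun j => if j == i then t else x j.

(** Polynomial in each variable separately, with one degree bound for all. This is stable under the
    ring operations and is all that the count of zeros requires, so no multivariate polynomial has
    to be built. *)
Definition sepoly (K : fieldType) (f : (nat -> K) -> K) : Prop :=
  exists d, forall x i, upoly d (fun t => f (upd x i t)).

Lemma sepoly_const (K : fieldType) (c : K) : sepoly (fun _ => c).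
Proof.
exists 1%N => x i; exists c%:P; first exact: size_polyC_leq1.
by move=> t; rewrite hornerC.
Qed.

Lemma sepoly_var (K : fieldType) (j : nat) : sepoly (fun x : nat -> K => x j).
Proof.
exists 2%N => x i; rewrite /upd; case: (j == i).
  by exists 'X; rewrite ?size_polyX // => t; rewrite hornerX.
exists (x j)%:P; first by rewrite (leq_trans (size_polyC_leq1 _)).
by move=> t; rewrite hornerC.
Qed.

Lemma sepolyD (K : fieldType) (f g : (nat -> K) -> K) :
  sepoly f -> sepoly g -> sepoly (fun x => f x + g x).
Proof.
move=> [d hd] [e he]; exists (maxn d e) => x i.
have [p sp hp] := hd x i; have [q sq hq] := he x i.
exists (p + q); last by move=> t; rewrite hornerD hp hq.
by rewrite (leq_trans (size_polyD _ _)) // geq_max !leq_max sp sq orbT.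
Qed.

Lemma sepolyM (K : fieldType) (f g : (nat -> K) -> K) :
  sepoly f -> sepoly g -> sepoly (fun x => f x * g x).
Proof.
move=> [d hd] [e he]; exists (d + e)%N => x i.
have [p sp hp] := hd x i; have [q sq hq] := he x i.
exists (p * q); last by move=> t; rewrite hornerM hp hq.
rewrite (leq_trans (size_polyMleq _ _)) // (leq_trans (leq_pred _)) //.
exact: leq_add.
Qed.

Lemma sepolyN (K : fieldType) (f : (nat -> K) -> K) :
  sepoly f -> sepoly (fun x => - f x).
Proof.
move=> [d hd]; exists d => x i; have [p sp hp] := hd x i.
by exists (- p); rewrite ?size_polyN // => t; rewrite hornerN hp.
Qed.

Lemma sepolyB (K : fieldType) (f g : (nat -> K) -> K) :
  sepoly f -> sepoly g -> sepoly (fun x => f x - g x).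
Proof. by move=> hf hg; apply: sepolyD => //; exact: sepolyN. Qed.

Lemma sepolyX (K : fieldType) (f : (nat -> K) -> K) n :
  sepoly f -> sepoly (fun x => f x ^+ n).
Proof.
move=> hf; elim: n => [|n IH]; first exact: sepoly_const.
have -> : (fun x => f x ^+ n.+1) = (fun x => f x * f x ^+ n).
  by apply/funext => x; rewrite exprS.
exact: sepolyM.
Qed.

Lemma sepolyMn (K : fieldType) (f : (nat -> K) -> K) n :
  sepoly f -> sepoly (fun x => f x *+ n).
Proof.
move=> hf; have -> : (fun x => f x *+ n) = (fun x => f x * n%:R).
  by apply/funext => x; rewrite mulr_natr.
by apply: sepolyM => //; exact: sepoly_const.
Qed.

Lemma sepoly_sum (K : fieldType) (I : Type) (r : seq I) (P : pred I)
    (f : I -> (nat -> K) -> K) :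
  (forall i, sepoly (f i)) -> sepoly (fun x => \sum_(i <- r | P i) f i x).
Proof.
move=> hf; elim: r => [|i r IH].
  have -> : (fun x => \sum_(i <- [::] | P i) f i x) = (fun _ => 0).
    by apply/funext => x; rewrite big_nil.
  exact: sepoly_const.
have -> : (fun x => \sum_(j <- i :: r | P j) f j x) =
  (fun x => (if P i then f i x else 0) + \sum_(j <- r | P j) f j x).
  by apply/funext => x; rewrite big_cons; case: (P i); rewrite ?add0r.
by apply: sepolyD => //; case: (P i) => //; exact: sepoly_const.
Qed.

Lemma sepoly_prod (K : fieldType) (I : Type) (r : seq I) (P : pred I)
    (f : I -> (nat -> K) -> K) :
  (forall i, sepoly (f i)) -> sepoly (fun x => \prod_(i <- r | P i) f i x).
Proof.
move=> hf; elim: r => [|i r IH].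
  have -> : (fun x => \prod_(i <- [::] | P i) f i x) = (fun _ => 1).
    by apply/funext => x; rewrite big_nil.
  exact: sepoly_const.
have -> : (fun x => \prod_(j <- i :: r | P j) f j x) =
  (fun x => (if P i then f i x else 1) * \prod_(j <- r | P j) f j x).
  by apply/funext => x; rewrite big_cons; case: (P i); rewrite ?mul1r.
by apply: sepolyM => //; case: (P i) => //; exact: sepoly_const.
Qed.

Lemma sepoly_bieval (K : numFieldType) (X Y : (nat -> K) -> 'rV[K]_4) (p : bipoly) :
  (forall i, sepoly (fun x => X x ord0 i)) -> (forall i, sepoly (fun x => Y x ord0 i)) ->
  sepoly (fun x => bieval (X x) (Y x) p).
Proof.
move=> hX hY; rewrite /bieval /mmap /mmap1.
apply: sepoly_sum => m; apply: sepolyM; first exact: sepoly_const.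
apply: sepoly_prod => i; apply: sepolyX.
case: (split_ordP i) => j ->.
  by under eq_fun do rewrite row_mxEl; exact: hX.
by under eq_fun do rewrite row_mxEr; exact: hY.
Qed.

Lemma upoly_card_zeros (K : numFieldType) (d R : nat) (g : K -> K) (c : K) :
  upoly d g -> g c != 0 -> (#|[pred x : 'I_R | (g x%:R == 0)%R]| <= d)%N.
Proof.
move=> [p sp hp] gc.
have p0 : p != 0 by apply: contraNneq gc => p0; rewrite hp p0 horner0.
pose rs : seq K := [seq x%:R | x : 'I_R <- enum [pred x : 'I_R | g x%:R == 0]].
have : (size rs < size p)%N.
  apply: max_poly_roots => //.
    apply/allP => y /mapP[x]; rewrite mem_enum inE hp => hx ->.
    by rewrite /root hx.
  rewrite map_inj_uniq ?enum_uniq // => x y /eqP.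
  by rewrite eqr_nat => /eqP; exact: val_inj.
by rewrite size_map -cardE => /ltnW /leq_trans; apply.
Qed.

Lemma upoly_nat_nonzero (K : numFieldType) (d : nat) (g : K -> K) (c : K) :
  upoly d g -> g c != 0 -> exists n : nat, g n%:R != 0.
Proof.
move=> hg gc; have := upoly_card_zeros d.+1 hg gc.
case: (pickP [pred x : 'I_d.+1 | g x%:R != 0]) => [x hx _|h]; first by exists x.
rewrite (@eq_card _ _ predT) => [|x]; first by rewrite card_ord ltnn.
by have := h x; rewrite !inE => /negbFE.
Qed.

Lemma upd_same (K : Type) (x : nat -> K) i : upd x i (x i) = x.
Proof. by apply/funext => j; rewrite /upd; case: eqP => [->|]. Qed.

(** The coordinates are replaced one by one, a nonzero polynomial in one variable having a natural
    number at which it does not vanish. This turns a point over [algC] into rational data. *)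
Lemma sepoly_nat_nonzero (K : numFieldType) (f : (nat -> K) -> K) (x : nat -> K) n :
  sepoly f -> f x != 0 ->
  exists2 y : nat -> K, f y != 0 & forall i, (i < n)%N -> exists m : nat, y i = m%:R.
Proof.
move=> [d hd] fx; elim: n => [|n [y fy hy]]; first by exists x.
have := hd y n; move/upoly_nat_nonzero => /(_ (y n)); rewrite upd_same => /(_ fy)[m hm].
exists (upd y n m%:R) => // i; rewrite ltnS leq_eqVlt /upd => /orP[->|ni]; first by exists m.
by rewrite ltn_eqF //; exact: hy.
Qed.

Lemma leq_card_imp (T : finType) (A B : pred T) :
  (forall z, A z -> B z) -> (#|A| <= #|B|)%N.
Proof. by move=> h; apply: subset_leq_card; apply/fintype.subsetP => z; exact: h. Qed.

(** Replace c1, ..., c4 by the coordinates of a zero one after another: the value first becomes 0 at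
    some stage i, and there the i-th coordinate is one of at most d roots. Each stage accounts for
    at most d R^3 points. *)
Lemma card_zeros (K : numFieldType) (f : K -> K -> K -> K -> K) (d R : nat) (c1 c2 c3 c4 : K) :
  (forall x2 x3 x4, upoly d (fun t => f t x2 x3 x4)) ->
  (forall x1 x3 x4, upoly d (fun t => f x1 t x3 x4)) ->
  (forall x1 x2 x4, upoly d (fun t => f x1 x2 t x4)) ->
  (forall x1 x2 x3, upoly d (fun t => f x1 x2 x3 t)) ->
  f c1 c2 c3 c4 != 0 ->
  (#|[pred z : box R | f z.1.1.1%:R z.1.1.2%:R z.1.2%:R z.2%:R == 0%R]| <= 4 * d * R ^ 3)%N.
Proof.
move=> h1 h2 h3 h4 fc.
pose Z1 : pred 'I_R := [pred x : 'I_R | f x%:R c2 c3 c4 == 0].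
pose Z2 : pred ('I_R * 'I_R) := [pred y : 'I_R * 'I_R | predT y.1 &&
  ((f y.1%:R c2 c3 c4 != 0) && (f y.1%:R y.2%:R c3 c4 == 0))].
pose Z3 : pred ('I_R * 'I_R * 'I_R) := [pred y : 'I_R * 'I_R * 'I_R | predT y.1 &&
  ((f y.1.1%:R y.1.2%:R c3 c4 != 0) && (f y.1.1%:R y.1.2%:R y.2%:R c4 == 0))].
pose Z4 : pred (box R) := [pred y : box R | predT y.1 &&
  ((f y.1.1.1%:R y.1.1.2%:R y.1.2%:R c4 != 0) &&
   (f y.1.1.1%:R y.1.1.2%:R y.1.2%:R y.2%:R == 0))].
have cI : (#|'I_R| <= R)%N by rewrite card_ord.
have zero g (c : K) (b : bool) : upoly d g -> (b -> g c != 0) ->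
    (#|[pred x : 'I_R | b && (g x%:R == 0)%R]| <= d)%N.
  move=> hg; case: b => [/(_ isT) gc|_]; first exact: (upoly_card_zeros R hg gc).
  by rewrite eq_card0.
have k1 : (#|Z1| <= d)%N by exact: (upoly_card_zeros R (h1 c2 c3 c4) fc).
have k2 : (#|Z2| <= R * d)%N.
  apply: (@card_dep_le _ _ predT (fun x1 x2 : 'I_R => (f x1%:R c2 c3 c4 != 0) &&
    (f x1%:R x2%:R c3 c4 == 0))) => // x1.
  exact: (zero (fun t => f x1%:R t c3 c4) c2).
have k3 : (#|Z3| <= R * R * d)%N.
  apply: (@card_dep_le _ _ predT (fun (y : 'I_R * 'I_R) (x : 'I_R) => (f y.1%:R y.2%:R c3 c4 != 0) &&
    (f y.1%:R y.2%:R x%:R c4 == 0))) => // [|y]; first by rewrite card_prod card_ord.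
  exact: (zero (fun t => f y.1%:R y.2%:R t c4) c3).
have k4 : (#|Z4| <= R * R * R * d)%N.
  apply: (@card_dep_le _ _ predT (fun (y : 'I_R * 'I_R * 'I_R) (x : 'I_R) => (f y.1.1%:R y.1.2%:R y.2%:R c4 != 0) &&
    (f y.1.1%:R y.1.2%:R y.2%:R x%:R == 0))) => // [|y]; first by rewrite !card_prod card_ord.
  exact: (zero (fun t => f y.1.1%:R y.1.2%:R y.2%:R t) c4).
have k1' : (#|[pred z : box R | Z1 z.1.1.1 && predT z.1.1.2 && predT z.1.2 && predT z.2]|
    <= d * R * R * R)%N.
  apply: (@card_dep_le _ _ (fun y => Z1 y.1.1 && predT y.1.2 && predT y.2) (fun _ => predT)) => //.
  apply: (@card_dep_le _ _ (fun y => Z1 y.1 && predT y.2) (fun _ => predT)) => //.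
  by apply: (@card_dep_le _ _ Z1 (fun _ => predT)).
have k2' : (#|[pred z : box R | Z2 z.1.1 && predT z.1.2 && predT z.2]| <= R * d * R * R)%N.
  apply: (@card_dep_le _ _ (fun y => Z2 y.1 && predT y.2) (fun _ => predT)) => //.
  by apply: (@card_dep_le _ _ Z2 (fun _ => predT)).
have k3' : (#|[pred z : box R | Z3 z.1 && predT z.2]| <= R * R * d * R)%N.
  by apply: (@card_dep_le _ _ Z3 (fun _ => predT)).
rewrite (_ : 4 * d * R ^ 3 = d * R * R * R + R * d * R * R + R * R * d * R + R * R * R * d)%N; last by ring.
refine (leq_trans _ (leq_add (leq_add (leq_add k1' k2') k3') k4)).
have U (A B : pred (box R)) : (#|[predU A & B]| <= #|A| + #|B|)%N.
  by rewrite -cardUI leq_addr.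
refine (leq_trans _ (leq_add (leq_add (U _ _) (leqnn _)) (leqnn _))).
refine (leq_trans _ (leq_add (U _ _) (leqnn _))).
refine (leq_trans _ (U _ _)); apply: (@leq_card_imp (box R)) => z.
rewrite /= => h; rewrite !inE /= h ?andbT /Z1 /Z2 /Z3 /=.
by do ![case: (_ == 0)].
Qed.

Lemma fermat_pt_rmorph (R S : comPzRingType) (f : {rmorphism R -> S}) (u1 u2 v1 v2 : R) i :
  f (fermat_pt u1 u2 v1 v2 i) = fermat_pt (f u1) (f u2) (f v1) (f v2) i.
Proof.
have fn a b : f (nrm a b) = nrm (f a) (f b) by rewrite /nrm rmorphD rmorphB !rmorphXn rmorphM.
have fk a b : f (a - b *+ 2) = f a - f b *+ 2 by rewrite rmorphB rmorphMn.
by case: i => [|[|[|i]]]; rewrite /fermat_pt /= ?rmorphN ?rmorphB ?rmorphD ?rmorphM ?rmorphMn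
  ?rmorphB ?rmorphN ?rmorphM ?rmorphMn ?rmorphB ?rmorphM ?fn.
Qed.

Definition xrow (K : comNzRingType) (e : nat -> K) : 'rV[K]_4 := \row_i e i ^+ 3.
(* y_i = Y_i / e_i, multiplied by the product of all the e_j. *)
Definition yrow (K : comNzRingType) (e y : nat -> K) : 'rV[K]_4 :=
  \row_(i < 4) (y i * \prod_(j < 4 | j != i) e j).

(** The variables 0 to 3 are the e_i, and 4 to 7 are u1, u2, v1, v2. The leading product ensures
    that a nonzero value forces all e_i to be nonzero. *)
Definition pull (K : numFieldType) (p : bipoly) (x : nat -> K) : K :=
  (\prod_(j < 4) x j) * bieval (xrow x) (yrow x (fermat_pt (x 4) (x 5) (x 6) (x 7))) p.

Lemma sepoly_nrm (K : fieldType) (f g : (nat -> K) -> K) :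
  sepoly f -> sepoly g -> sepoly (fun x => nrm (f x) (g x)).
Proof.
move=> hf hg; apply: sepolyD; last exact: sepolyX.
by apply: sepolyB; [exact: sepolyX | exact: sepolyM].
Qed.

Lemma sepoly_fermat_pt (K : fieldType) (f1 f2 g1 g2 : (nat -> K) -> K) i :
  sepoly f1 -> sepoly f2 -> sepoly g1 -> sepoly g2 ->
  sepoly (fun x => fermat_pt (f1 x) (f2 x) (g1 x) (g2 x) i).
Proof.
move=> h1 h2 k1 k2.
have hn := sepoly_nrm h1 h2; have kn := sepoly_nrm k1 k2.
have hD1 := sepolyB (sepolyM k1 kn) (sepolyM h1 hn).
have hD2 := sepolyB (sepolyM k2 kn) (sepolyM h2 hn).
have hk1 := sepolyB hD1 (sepolyMn 2 hD2); have hk2 := sepolyB (sepolyN hD1) hD2.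
case: i => [|[|[|i]]]; rewrite /fermat_pt.
- exact: sepolyB (sepolyM hk1 k1) (sepolyM hk2 k2).
- exact: sepolyB (sepolyD (sepolyM hk1 k2) (sepolyM hk2 k1)) (sepolyM hk2 k2).
- exact: sepolyN (sepolyB (sepolyM hk1 h1) (sepolyM hk2 h2)).
- exact: sepolyN (sepolyB (sepolyD (sepolyM hk1 h2) (sepolyM hk2 h1)) (sepolyM hk2 h2)).
Qed.

Lemma sepoly_pull (K : numFieldType) (p : bipoly) : sepoly (@pull K p).
Proof.
apply: sepolyM; first by apply: sepoly_prod => j; exact: sepoly_var.
apply: sepoly_bieval => i; under eq_fun do rewrite mxE.
  by apply: sepolyX; exact: sepoly_var.
apply: sepolyM; first by apply: sepoly_fermat_pt; exact: sepoly_var.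
by apply: sepoly_prod => j; exact: sepoly_var.
Qed.

Lemma bieval_ratr (K : numFieldType) (x y : 'rV[rat]_4) (p : bipoly) :
  bieval (map_mx (@ratr K) x) (map_mx (@ratr K) y) p = ratr (bieval x y p).
Proof.
rewrite /bieval /mmap rmorph_sum; apply: eq_bigr => m _; rewrite rmorphM.
congr (_ * _); first by rewrite fmorph_rat.
rewrite /mmap1 rmorph_prod; apply: eq_bigr => i _; rewrite rmorphXn; congr (_ ^+ _).
by case: (split_ordP i) => j ->; rewrite ?row_mxEl ?row_mxEr mxE.
Qed.

Lemma bieval_eqY (K : numFieldType) (x y : 'rV[K]_4) :
  bieval x y eqY = \sum_(i < 4) x ord0 i * y ord0 i ^+ 3.
Proof.
rewrite /bieval /eqY rmorph_sum; apply: eq_bigr => i _.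
by rewrite rmorphM rmorphXn /= /varx /vary !mmapX !mmap1U row_mxEl row_mxEr.
Qed.

(** * From a geometric point of U to a suitable fibre *)

Definition nzpoly (K : fieldType) (g : K -> K) : Prop :=
  exists2 p : {poly K}, p != 0 & forall t, g t = p.[t].

Lemma nzpolyM (K : fieldType) (g h : K -> K) :
  nzpoly g -> nzpoly h -> nzpoly (fun t => g t * h t).
Proof.
move=> [p p0 hp] [q q0 hq]; exists (p * q); first by rewrite mulf_neq0.
by move=> t; rewrite hornerM hp hq.
Qed.

Lemma nzpoly_prod (K : fieldType) (I : Type) (r : seq I) (P : pred I) (g : I -> K -> K) :
  (forall i, P i -> nzpoly (g i)) -> nzpoly (fun t => \prod_(i <- r | P i) g i t).
Proof.
move=> h; elim: r => [|i r [p p0 hp]].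
  by exists 1; rewrite ?oner_neq0 // => t; rewrite big_nil hornerC.
case Pi : (P i); last by exists p => // t; rewrite big_cons Pi hp.
have [q q0 hq] := h i Pi; exists (q * p); first by rewrite mulf_neq0.
by move=> t; rewrite big_cons Pi hornerM hp hq.
Qed.

Lemma upoly_nzpoly (K : fieldType) d (g : K -> K) c : upoly d g -> g c != 0 -> nzpoly g.
Proof.
move=> [p _ hp] gc; exists p => //.
by apply: contraNneq gc => p0; rewrite hp p0 horner0.
Qed.

Lemma nzpoly_nonzero (K : numFieldType) (g : K -> K) : nzpoly g -> exists t, g t != 0.
Proof.
move=> [p p0 hp]; case: (pselect (exists t, g t != 0)) => // h; exfalso.
have : (size [seq k%:R : K | k <- iota 0 (size p)] < size p)%N.
  apply: max_poly_roots => //.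
    apply/allP => y _; rewrite /root -hp; apply/negPn/negP => hy; apply: h; by exists y.
  rewrite map_inj_uniq ?iota_uniq // => x y /eqP.
  by rewrite eqr_nat => /eqP.
by rewrite size_map size_iota ltnn.
Qed.

Lemma nzpoly_shift (K : numFieldType) (a : K) : nzpoly (fun t => a + t).
Proof.
exists ('X + a%:P); last by move=> t; rewrite hornerD hornerX hornerC addrC.
by rewrite -size_poly_eq0 size_XaddC.
Qed.

(* A point of Y is moved along a curve of Y to avoid the coordinate
   hyperplanes; all coordinates below are polynomials in t. *)
Lemma move_point (K : numFieldType) (p : bipoly) (d e : nat) (x y : 'rV[K]_4) :
  bihomog d e p -> y != 0 -> \sum_(i < 4) x ord0 i * y ord0 i ^+ 3 = 0 ->
  bieval x y p != 0 ->
  exists x' y' : 'rV[K]_4, [/\ bieval x' y' p != 0,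
    \sum_(i < 4) x' ord0 i * y' ord0 i ^+ 3 = 0,
    forall i, x' ord0 i != 0 & forall i, y' ord0 i != 0].
Proof.
move=> hp /rV0Pn[j yj] xy hF.
(* The equation is linear in x: the x_i with i != j may be moved freely, and the factor (y_j + t)^3
   clears the denominator of x_j. At t = 0 the curve passes through (y_j^3 x, y). *)
pose Y t : 'rV[K]_4 := \row_i (y ord0 i + t).
pose S t := \sum_(i < 4 | i != j) (x ord0 i + t) * (y ord0 i + t) ^+ 3.
pose X t : 'rV[K]_4 := \row_i (if i == j then - S t else (x ord0 i + t) * (y ord0 j + t) ^+ 3).
have XY t : \sum_(i < 4) X t ord0 i * Y t ord0 i ^+ 3 = 0.
  rewrite (bigD1 j) //= !mxE eqxx; apply/eqP; rewrite mulNr addrC subr_eq0 /S mulr_suml.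
  apply/eqP; apply: eq_bigr => i ij; rewrite !mxE (negbTE ij); ring.
have X0 : X 0 = (y ord0 j ^+ 3) *: x.
  apply/rowP => i; rewrite !mxE !addr0; case: eqP => [->|_]; last by rewrite mulrC.
  apply/eqP; rewrite -subr_eq0 -oppr_eq0 opprB opprK addrC mulrC.
  rewrite -[X in _ == X]xy (bigD1 j) //= addrC; apply/eqP; congr (_ + _).
  by apply: eq_bigr => i' _; rewrite !addr0.
have Y0 : Y 0 = 1 *: y by apply/rowP => i; rewrite !mxE addr0 mul1r.
have shift a : sepoly (fun z : nat -> K => a + z 0%N).
  by apply: sepolyD; [exact: sepoly_const | exact: sepoly_var].
have sepX i : sepoly (fun z : nat -> K => X (z 0%N) ord0 i).
  under eq_fun do rewrite mxE; case: (i == j).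
    apply: sepolyN; apply: sepoly_sum => k.
    by apply: sepolyM => //; exact: sepolyX.
  by apply: sepolyM => //; exact: sepolyX.
have sepY i : sepoly (fun z : nat -> K => Y (z 0%N) ord0 i).
  by under eq_fun do rewrite mxE; exact: shift.
have [D hD] := sepoly_bieval p sepX sepY.
have nF : nzpoly (fun t => bieval (X t) (Y t) p).
  apply: (upoly_nzpoly (c := 0) (hD (fun _ => 0) 0%N)).
  by rewrite /upd eqxx X0 Y0 (bieval_homog _ _ _ _ hp) expr1n mulr1 mulf_neq0 // !expf_neq0.
have nS : nzpoly (fun t => - S t).
  exists (- \sum_(i < 4 | i != j) ('X + (x ord0 i)%:P) * ('X + (y ord0 i)%:P) ^+ 3); last first.
    move=> t; rewrite hornerN horner_sum; congr (- _); apply: eq_bigr => i _.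
    by rewrite hornerM horner_exp !hornerD !hornerX !hornerC ![_ + t]addrC.
  (* The sum of three monic polynomials of degree 4 has leading coefficient 3. *)
  rewrite oppr_eq0; apply/eqP => /(congr1 (fun q : {poly K} => q`_4)).
  rewrite coef_sum coef0 (eq_bigr (fun _ => 1)); last first.
    move=> i _; set q := _ * _.
    have mq : q \is monic by rewrite monicMl ?monicXaddC // monic_exp // monicXaddC.
    have sq : size q = 5%N.
      rewrite size_Mmonic ?monic_neq0 ?monicXaddC ?monic_exp ?monicXaddC // size_XaddC.
      by rewrite -[y ord0 i]opprK polyCN size_exp_XsubC.
    by move/monicP: mq; rewrite lead_coefE sq.
  by rewrite sumr_const cardC1 card_ord /= => /eqP; rewrite pnatr_eq0.
have nX i : nzpoly (fun t => X t ord0 i).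
  under eq_fun do rewrite mxE; case: (i == j) => //.
  apply: nzpolyM; first exact: nzpoly_shift.
  have -> : (fun t => (y ord0 j + t) ^+ 3) = (fun t => (y ord0 j + t) * ((y ord0 j + t) * (y ord0 j + t))).
    by apply/funext => t; rewrite !exprS expr0 mulr1.
  by do 2?[apply: nzpolyM]; exact: nzpoly_shift.
have nY i : nzpoly (fun t => Y t ord0 i).
  by under eq_fun do rewrite mxE; exact: nzpoly_shift.
have [t] := nzpoly_nonzero (nzpolyM nF (nzpolyM
  (@nzpoly_prod K _ (index_enum 'I_4) predT _ (fun i _ => nX i))
  (@nzpoly_prod K _ (index_enum 'I_4) predT _ (fun i _ => nY i)))).
rewrite !mulf_eq0 !negb_or => /andP[h1 /andP[/prodf_neq0 h2 /prodf_neq0 h3]].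
by exists (X t), (Y t); split=> // i; [exact: h2 | exact: h3].
Qed.

Lemma cube_root1 : exists w : algC, w ^+ 2 + w + 1 = 0.
Proof.
have [w pw] := C_prim_root_exists (n := 3) isT.
exists w; have w3 := prim_expr_order pw.
have w1 : w - 1 != 0.
  by rewrite subr_eq0; apply/eqP => w1; have := prim_order_dvd pw 1; rewrite w1 expr1n eqxx.
apply: (mulfI w1); rewrite mulr0.
have -> : (w - 1) * (w ^+ 2 + w + 1) = w ^+ 3 - 1 by ring.
by rewrite w3 subrr.
Qed.

(** The scalar of [fermat_pt_section] may vanish at a given point. Multiplying the cube root e_0 by
    c with c^3 = 1 leaves x and y unchanged but replaces z0 by c z0, and some c makes the scalar
    nonzero. *)
Lemma twist_nonzero (w z0 z1 A : algC) : w ^+ 2 + w + 1 = 0 -> z0 != 0 -> z1 != 0 ->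
  exists2 c : algC, c ^+ 3 = 1 & c * z0 * nrm (c * z0) z1 + A != 0.
Proof.
move=> hw hz0 hz1.
have w2 : w ^+ 2 = - w - 1 by apply/eqP; rewrite -subr_eq0 -hw; apply/eqP; ring.
have w3 : w ^+ 3 = 1 by rewrite exprS w2; apply/eqP; rewrite -subr_eq0 -oppr_eq0 -hw; apply/eqP; ring.
have w0 : w != 0 by apply/eqP => w0; move: w3; rewrite w0 expr0n => /eqP; rewrite eq_sym oner_eq0.
have [h1|h1] := eqVneq (z0 * nrm z0 z1 + A) 0; last first.
  by exists 1; rewrite ?expr1n // !mul1r.
have [h2|h2] := eqVneq (w * z0 * nrm (w * z0) z1 + A) 0; last by exists w.
have [h3|h3] := eqVneq (w ^+ 2 * z0 * nrm (w ^+ 2 * z0) z1 + A) 0; last first.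
  by exists (w ^+ 2) => //; rewrite -exprM mulnC exprM w3 expr1n.
(* Subtracting the three equations in pairs leaves two linear relations
   between z0 and z1. *)
exfalso; move: h1 h2 h3; rewrite w2 /nrm.
have E c : c * z0 * ((c * z0) ^+ 2 - c * z0 * z1 + z1 ^+ 2) + A =
  c ^+ 3 * z0 ^+ 3 + A + c * z0 * z1 * (z1 - c * z0) by ring.
have -> : z0 * (z0 ^+ 2 - z0 * z1 + z1 ^+ 2) + A = z0 ^+ 3 + A + z0 * z1 * (z1 - z0) by ring.
rewrite !E w3.
have -> : (- w - 1) ^+ 3 = 1 by rewrite -w2 -exprM mulnC exprM w3 expr1n.
rewrite !mul1r; set B := _ + A => h1 h2 h3.
have B0 : B = 0.
  have : 3%:R * B = 0.
    transitivity ((B + z0 * z1 * (z1 - z0)) + (B + w * z0 * z1 * (z1 - w * z0)) +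
      (B + (- w - 1) * z0 * z1 * (z1 - (- w - 1) * z0)) + 2 * (w ^+ 2 + w + 1) * z0 ^+ 2 * z1).
      by ring.
    by rewrite h1 h2 h3 hw !(mulr0, mul0r) !addr0.
  by move/eqP; rewrite mulf_eq0 pnatr_eq0 /= => /eqP.
rewrite B0 !add0r in h1 h2.
move/eqP: h1; rewrite !mulf_eq0 (negbTE hz0) (negbTE hz1) /= subr_eq0 => /eqP zz.
move/eqP: h2; rewrite zz !mulf_eq0 (negbTE hz0) (negbTE w0) /= subr_eq0.
rewrite -{1}[z0]mul1r (inj_eq (mulIf hz0)) => /eqP w1.
by move/eqP: hw; rewrite -w1 expr1n (_ : 1 + 1 + 1 = 3%:R) ?pnatr_eq0 //; ring.
Qed.

Definition of4 (K : Type) (a b c d : K) (i : nat) : K :=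
  match i with 0 => a | 1 => b | 2 => c | _ => d end.

(** Over [algC] every x_i is a cube E_i^3, the numbers E_i y_i lie on the Fermat surface, and
    [fermat_pt_section] inverts the parametrization there. *)
Lemma pull_nonzero (p : bipoly) (d e : nat) (x y : 'rV[algC]_4) :
  bihomog d e p -> \sum_(i < 4) x ord0 i * y ord0 i ^+ 3 = 0 ->
  bieval x y p != 0 -> (forall i, x ord0 i != 0) -> (forall i, y ord0 i != 0) ->
  exists z : nat -> algC, pull p z != 0.
Proof.
move=> hp xy hF x0 y0.
pose E (i : 'I_4) : algC := 3.-root (x ord0 i).
have E3 i : E i ^+ 3 = x ord0 i by rewrite rootCK.
have E0 i : E i != 0.
  by apply/eqP => Ei; have := x0 i; rewrite -E3 Ei expr0n eqxx.
have [w hw] := cube_root1.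
pose i0 : 'I_4 := @Ordinal 4 0 isT; pose i1 : 'I_4 := @Ordinal 4 1 isT.
pose i2 : 'I_4 := @Ordinal 4 2 isT; pose i3 : 'I_4 := @Ordinal 4 3 isT.
pose Z i := E i * y ord0 i.
have Z0 i : Z i != 0 by rewrite mulf_neq0.
have [c c3 hc] := twist_nonzero (Z i2 * nrm (Z i2) (Z i3)) hw (Z0 i0) (Z0 i1).
pose E' (i : nat) := of4 (c * E i0) (E i1) (E i2) (E i3) i.
pose Y' (i : nat) := of4 (c * Z i0) (Z i1) (Z i2) (Z i3) i.
have c0 : c != 0 by apply/eqP => c0; move: c3; rewrite c0 expr0n => /eqP; rewrite eq_sym oner_eq0.
have all4 (P : nat -> 'I_4 -> Prop) : P 0%N i0 -> P 1%N i1 -> P 2%N i2 -> P 3%N i3 ->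
    forall i : 'I_4, P i i.
  move=> p0 p1 p2 p3 [[|[|[|[|//]]]] hi].
  - by have -> : Ordinal hi = i0 by apply/val_inj.
  - by have -> : Ordinal hi = i1 by apply/val_inj.
  - by have -> : Ordinal hi = i2 by apply/val_inj.
  - by have -> : Ordinal hi = i3 by apply/val_inj.
have E'0 (i : 'I_4) : E' i != 0.
  by apply: (all4 (fun k _ => E' k != 0)); rewrite /= ?mulf_neq0.
have E'3 (i : 'I_4) : E' i ^+ 3 = x ord0 i.
  by apply: (all4 (fun k i => E' k ^+ 3 = x ord0 i)); rewrite /= ?exprMn ?c3 ?mul1r E3.
have Y'E (i : 'I_4) : Y' i = E' i * y ord0 i.
  by apply: (all4 (fun k i => Y' k = E' k * y ord0 i)); rewrite /= ?mulrA.
have Y3 : Y' 0%N ^+ 3 + Y' 1%N ^+ 3 + Y' 2%N ^+ 3 + Y' 3%N ^+ 3 = 0.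
  rewrite -[RHS]xy.
  transitivity (\sum_(i < 4) Y' i ^+ 3); first by rewrite !big_ord_recl big_ord0 /= addr0 !addrA.
  by apply: eq_bigr => i _; rewrite Y'E exprMn E'3.
have [f0 f1 f2 f3] := fermat_pt_section Y3.
move: f0 f1 f2 f3; set C := _ *+ 3 => f0 f1 f2 f3.
have C0 : C != 0.
  by rewrite /C -mulr_natr mulf_neq0 // ?pnatr_eq0 //.
(* In the order of [pull]: e, then u = - (Y2 + Y3 w) and v = Y0 + Y1 w. *)
pose z (i : nat) : algC := match i with
  0 | 1 | 2 | 3 => E' i | 4 => - Y' 2%N | 5 => - Y' 3%N | 6 => Y' 0%N | _ => Y' 1%N end.
have zE (i : 'I_4) : z i = E' i by case: i => [[|[|[|[|//]]]]].
exists z; rewrite /pull; under eq_bigr do rewrite zE.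
have P0 : \prod_(j < 4) E' j != 0 by apply/prodf_neq0 => j _; exact: E'0.
rewrite mulf_neq0 //.
have -> : xrow z = 1 *: x by apply/rowP => i; rewrite !mxE zE E'3 mul1r.
have -> : yrow z (fermat_pt (z 4%N) (z 5%N) (z 6%N) (z 7%N)) = (C * \prod_(j < 4) E' j) *: y.
  apply/rowP => i; rewrite !mxE.
  have -> : fermat_pt (z 4%N) (z 5%N) (z 6%N) (z 7%N) i = C * Y' i.
    by case: i => [[|[|[|[|//]]]]] hi; rewrite /=; [exact: f0|exact: f1|exact: f2|exact: f3].
  rewrite Y'E [in RHS](bigD1 i) //=.
  have -> : \prod_(j < 4 | j != i) z j = \prod_(j < 4 | j != i) E' j.
    by apply: eq_bigr => j _; exact: zE.
  by ring.
by rewrite (bieval_homog _ _ _ _ hp) expr1n mul1r mulf_neq0 // expf_neq0 // mulf_neq0.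
Qed.

Definition param (K : Type) (e : nat -> K) (u1 u2 v1 v2 : K) (i : nat) : K :=
  match i with 4 => u1 | 5 => u2 | 6 => v1 | 7 => v2 | _ => e i end.

Lemma pull_param (K : numFieldType) (p : bipoly) (e : nat -> K) (u1 u2 v1 v2 : K) :
  pull p (param e u1 u2 v1 v2) =
  (\prod_(j < 4) e j) * bieval (xrow e) (yrow e (fermat_pt u1 u2 v1 v2)) p.
Proof.
have E (i : 'I_4) : param e u1 u2 v1 v2 i = e i by case: i => [[|[|[|[|//]]]]].
rewrite /pull (eq_bigr (fun j : 'I_4 => e j)) => [|j _]; last exact: E.
congr (_ * bieval _ _ _); apply/rowP => i; rewrite !mxE ?E //.
by congr (_ * _); apply: eq_bigr => j _; exact: E.
Qed.

Definition fibre_val (p : bipoly) (e : nat -> nat) (u v : eis) : rat :=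
  bieval (xrow (fun i => (e i)%:R)) (yrow (fun i => (e i)%:R)
    (fun i => (fermat_pt u.1 u.2 v.1 v.2 i)%:~R)) p.

(** A point of U over [algC] where p is nonzero is moved off the coordinate hyperplanes and pulled
    back to the eight parameters, which are then specialized to natural numbers. The first four give
    the fibre; the other four are a nonzero of p on it, as [card_zeros] requires. *)
Lemma good_fibre (U : zopen) : zopen_nonempty U ->
  exists p : bipoly, exists e : nat -> nat, exists D : nat,
    [/\ zeqs U p, forall i, (i < 4)%N -> (0 < e i)%N &
     forall R, (#|[pred z : box R | fibre_val p e (zu z) (zv z) == 0%R]| <= 4 * D * R ^ 3)%N].
Proof.
move=> [P [PY [p Up Pp]]]; exists p.
have [d [d' hp]] := zeqs_bihomog Up.
have [x [y [Px Py hF]]] : exists x y, [/\ hcoord P.1 x, hcoord P.2 y & bieval x y p != 0].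
  case: (pselect (exists x y, [/\ hcoord P.1 x, hcoord P.2 y & bieval x y p != 0])) => // h.
  case: Pp => x y Px Py; apply/eqP; case: eqVneq => // hF; exfalso; apply: h.
  by exists x, y.
have xy := PY x y Px Py; rewrite bieval_eqY in xy.
have y0 := hcoord_neq0 Py.
have [x' [y' [hF' xy' x0' y0']]] := move_point hp y0 xy hF.
have [z0 hz0] := pull_nonzero hp xy' hF' x0' y0'.
have sp := sepoly_pull algC p.
have [z hz nz] := sepoly_nat_nonzero 8 sp hz0.
have /choice[n hn] : forall i, exists m : nat, (i < 8)%N -> z i = m%:R.
  move=> i; case: (ltnP i 8) => [i8|_]; last by exists 0%N.
  by have [m hm] := nz i i8; exists m.
pose e (i : nat) : algC := (n i)%:R.
have zE : pull p z = pull p (param e (z 4%N) (z 5%N) (z 6%N) (z 7%N)).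
  rewrite pull_param /pull.
  have Ei (i : 'I_4) : z i = e i by apply: hn; apply: ltn_trans (ltn_ord i) _.
  rewrite (eq_bigr (fun j : 'I_4 => e j)) => [|j _]; last exact: Ei.
  congr (_ * bieval _ _ _); apply/rowP => i; rewrite !mxE ?Ei //.
  by congr (_ * _); apply: eq_bigr => j _; exact: Ei.
rewrite zE in hz; have [D hD] := sp; exists n, D; split=> //.
  move=> i i4; rewrite lt0n; apply: contraNneq hz => ni.
  by rewrite pull_param (bigD1 (Ordinal i4)) //= /e ni !mul0r.
move=> R; pose f v2 v1 u2 u1 := pull p (param e u1 u2 v1 v2).
have upP (x1 x2 x3 x4 t : algC) :
  [/\ upd (param e x1 x2 x3 x4) 4 t = param e t x2 x3 x4,
      upd (param e x1 x2 x3 x4) 5 t = param e x1 t x3 x4,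
      upd (param e x1 x2 x3 x4) 6 t = param e x1 x2 t x4 &
      upd (param e x1 x2 x3 x4) 7 t = param e x1 x2 x3 t].
  by split; apply/funext => k; rewrite /upd; do 8?[case: k => [//|k]].
have hf : (#|[pred z : box R | f z.1.1.1%:R z.1.1.2%:R z.1.2%:R z.2%:R == 0%R]| <= 4 * D * R ^ 3)%N.
  apply: (@card_zeros _ f D R (z 7%N) (z 6%N) (z 5%N) (z 4%N)) => //.
  - move=> x2 x3 x4; have [q sq hq] := hD (param e x4 x3 x2 0) 7%N.
    by exists q => // t; rewrite -hq; have [_ _ _ ->] := upP x4 x3 x2 0 t.
  - move=> x1 x3 x4; have [q sq hq] := hD (param e x4 x3 0 x1) 6%N.
    by exists q => // t; rewrite -hq; have [_ _ -> _] := upP x4 x3 0 x1 t.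
  - move=> x1 x2 x4; have [q sq hq] := hD (param e x4 0 x2 x1) 5%N.
    by exists q => // t; rewrite -hq; have [_ -> _ _] := upP x4 0 x2 x1 t.
  - move=> x1 x2 x3; have [q sq hq] := hD (param e 0 x3 x2 x1) 4%N.
    by exists q => // t; rewrite -hq; have [-> _ _ _] := upP 0 x3 x2 x1 t.
apply: leq_trans hf; apply: (@leq_card_imp (box R)) => w /= hw.
rewrite /f pull_param mulf_eq0; apply/orP; right.
have : ratr (fibre_val p n (zu w) (zv w)) == 0 :> algC by rewrite fmorph_eq0.
rewrite /fibre_val -bieval_ratr; congr (bieval _ _ _ == 0); apply/rowP => i; rewrite !mxE.
  by rewrite rmorphXn /= ratr_nat.
rewrite rmorphM rmorph_prod /= ratr_int; congr (_ * _).
  rewrite (fermat_pt_rmorph (intmul 1 : {rmorphism int -> algC})).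
  by [].
by apply: eq_bigr => j _; rewrite ratr_nat.
Qed.

(** * The sieve *)

Lemma squarefree_coprime (x y n : nat) : (0 < n)%N -> (x * y %| n)%N ->
  squarefree n -> coprime x y.
Proof.
move=> n0 xyn sf; rewrite /coprime eqn_leq gcdn_gt0.
have /andP[x0 y0] : (0 < x)%N && (0 < y)%N by rewrite -muln_gt0 (dvdn_gt0 n0).
rewrite x0 andbT leqNgt; apply/negP => /pdivP[p pp].
rewrite dvdn_gcd => /andP[px py]; have /negP[] := sf p pp.
by apply: dvdn_trans xyn; rewrite expnS expn1 dvdn_mul.
Qed.

(** The degeneracies at primes dividing g that the last two clauses of [exact_type] exclude. *)
Definition clash_at (a b m p : nat) (u v : eis) : bool :=
  if (p %| a * b)%N then (p %| eN v)%Z else (p %| u.2)%Z || (p %| v.2)%Z.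

(** By [edvd_max_le] the range up to 2 R contains every common divisor with nonnegative coordinates,
    provided that v is nonzero. *)
Definition big_gcd (R J : nat) : pred (box R) := [pred z : box R | (zv z != 0) &&
     [exists k : 'I_(2 * R).+1 * 'I_(2 * R).+1, (J < maxn k.1 k.2)%N &&
        (edvd (k.1%:Z, k.2%:Z) (zu z) && edvd (k.1%:Z, k.2%:Z) (zv z))]].
Arguments big_gcd : clear implicits.

Definition good (R J Y M a b s m t : nat) (Z : pred (box R)) : pred (box R) :=
  [pred z | [&& lat_pred R M a b s m t z,
     [forall p : 'I_(J ^ 2).+1, prime p && coprime (M * (a * b * m)) p ==>
        ~~ typed_at p (zu z) (zv z)],
     [forall p : 'I_Y.+1, prime p && (p %| a * b * m)%N ==>
        ~~ clash_at a b m p (zu z) (zv z)],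
     ~~ big_gcd R J z & ~~ Z z]].

(** From the exact lattice count are removed: points typed at a prime P < p <= J^2 prime to M g (192
    / p^2 each), points degenerate at a prime dividing g (48 / p each), pairs with a common divisor
    beyond J, and zeros of the equation. The bound M g J^4 <= R leaves room for the modulus p^2 in
    the first count. *)
Lemma good_lower (F : realFieldType) (R J Y P M a b s m t D : nat) (Z : pred (box R)) :
  (forall q, prime q -> (q <= P)%N -> (q %| M)%N) -> (0 < P)%N -> (0 < J)%N ->
  (Y <= J ^ 2)%N -> (1 < M)%N ->
  (0 < a * b * m)%N -> coprime (a * b * m) M -> squarefree (a * b * m) ->
  (M * (a * b * m) * (J ^ 2) ^ 2 <= R)%N -> (M * (a * b * m) %| R)%N ->
  (#|Z| <= 4 * D * R ^ 3)%N ->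
  R%:R ^+ 4 / (M%:R ^+ 4 * (a * b * m)%N%:R ^+ 2) *
    (1 - 192 / P%:R - 48 * \sum_(p < Y.+1 | prime p && (p %| a * b * m)%N) (p%:R)^-1)
    - 5184 * R%:R ^+ 4 / J%:R - 4 * D%:R * R%:R ^+ 3
  <= (#|good J Y M a b s m t Z|)%:R :> F.
Proof.
move=> hM P0 J0 YJ M1 g0 cgM sf le gR hZ; set g := (a * b * m)%N in g0 cgM sf le gR *.
have M0 : (0 < M)%N by apply: ltn_trans M1.
have cMg : coprime M g by rewrite coprime_sym.
have cab : coprime a b by apply: (squarefree_coprime g0 _ sf); rewrite /g dvdn_mulr.
have cabm : coprime (a * b) m by apply: (squarefree_coprime g0 _ sf).
have [cMa cMb cMm] : [/\ coprime M a, coprime M b & coprime M m].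
  by move: cMg; rewrite /g !coprimeMr => /andP[/andP[-> ->] ->].
have c1 : coprime (M * a) b by rewrite coprimeMl cMb cab.
have c2 : coprime (M * a * b) m by rewrite -mulnA coprimeMl cMm cabm.
have E1 : (M * a * b * m = M * g)%N by rewrite /g !mulnA.
have Mg0 : (0 < M * a * b * m)%N by rewrite E1 muln_gt0 M0 g0.
set L := lat_pred R M a b s m t.
have cardL : (#|L| * (M ^ 4 * g ^ 2))%N = (R ^ 4)%N.
  by apply: lat_card_eq => //; rewrite E1.
set W : F := M%:R ^+ 4 * g%:R ^+ 2.
have W0 : 0 < W by rewrite mulr_gt0 // exprn_gt0 // ltr0n.
pose PA (p : 'I_(J ^ 2).+1) := (P < p)%N && (prime p && coprime (M * g) p).
pose QA (p : 'I_(J ^ 2).+1) : pred (box R) := [predI L & [pred z | typed_at p (zu z) (zv z)]].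
pose PB (p : 'I_Y.+1) := prime p && (p %| g)%N.
pose QB (p : 'I_Y.+1) : pred (box R) := [predI L & [pred z | clash_at a b m p (zu z) (zv z)]].
have cov : (#|L| <= #|good J Y M a b s m t Z| + \sum_(p | PA p) #|QA p| +
    \sum_(p | PB p) #|QB p| + #|big_gcd R J| + #|Z|)%N.
  pose SA : pred (box R) := [pred z | [exists p, PA p && QA p z]].
  pose SB : pred (box R) := [pred z | [exists p, PB p && QB p z]].
  have hA : (#|SA| <= \sum_(p | PA p) #|QA p|)%N.
    by apply: leq_card_exists => z /existsP[p /andP[h1 h2]]; exists p.
  have hB : (#|SB| <= \sum_(p | PB p) #|QB p|)%N.
    by apply: leq_card_exists => z /existsP[p /andP[h1 h2]]; exists p.
  have U (A B : pred (box R)) : (#|[predU A & B]| <= #|A| + #|B|)%N.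
    by rewrite -cardUI leq_addr.
  refine (leq_trans _ (leq_add (leq_add (leq_add (leq_add (leqnn _) hA) hB) (leqnn _)) (leqnn _))).
  refine (leq_trans _ (leq_add (leq_add (leq_add (U _ _) (leqnn _)) (leqnn _)) (leqnn _))).
  refine (leq_trans _ (leq_add (leq_add (U _ _) (leqnn _)) (leqnn _))).
  refine (leq_trans _ (leq_add (U _ _) (leqnn _))).
  refine (leq_trans _ (U _ _)).
  apply: (@leq_card_imp (box R)) => z Lz.
  suff H : good J Y M a b s m t Z z || SA z || SB z || big_gcd R J z || Z z by exact: H.
  have [|nA] := boolP (SA z); first by rewrite orbT.
  have [|nB] := boolP (SB z); first by rewrite orbT.
  have [|nC] := boolP (big_gcd R J z); first by rewrite orbT.
  have [|nD] := boolP (Z z); first by rewrite orbT.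
  rewrite !orbF; apply/and5P; split=> //.
    apply/forallP => p; apply/implyP => /andP[pp cp]; apply: contra nA => ty.
    apply/existsP; exists p; rewrite /PA /QA pp cp andbT /=; apply/andP; split; last first.
      by apply/andP; split.
    rewrite andbT ltnNge; apply/negP => pP; have pM := hM _ pp pP; move: cp; rewrite coprimeMl => /andP[cp _].
    by move: cp; rewrite coprime_sym prime_coprime // pM.
  apply/forallP => p; apply/implyP => pp; apply: contra nB => cl.
  by apply/existsP; exists p; rewrite /PB /QB pp /=; apply/andP; split.
have toF n q C : (n * (M ^ 4 * g ^ 2 * q) <= C * R ^ 4)%N ->
    n%:R * (W * q%:R) <= C%:R * R%:R ^+ 4 :> F.
  by rewrite /W -!natrX -!natrM ler_nat.
have bA p : PA p -> (#|QA p|)%:R <= 192 * (R%:R ^+ 4 / W) * (p%:R ^+ 2)^-1 :> F.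
  move=> /andP[Pp /andP[pp cp]]; have p0 : 0 < p%:R ^+ 2 :> F by rewrite exprn_gt0 // ltr0n prime_gt0.
  have := @card_typed R M a b s m t p cMa c1 c2 Mg0 pp.
  rewrite E1 => /(_ cp); rewrite -/L -/g => h.
  have : (M * g * p ^ 2 <= R)%N.
    apply: leq_trans le; rewrite leq_mul2l leq_exp2r // -ltnS ltn_ord orbT //.
  move=> /h /toF; rewrite natrX mulrA => h'.
  by rewrite ler_pdivlMr // mulrA ler_pdivlMr // mulrAC.
have bB p : PB p -> (#|QB p|)%:R <= 48 * (R%:R ^+ 4 / W) * (p%:R)^-1 :> F.
  move=> /andP[pp pg]; have p0 : 0 < p%:R :> F by rewrite ltr0n prime_gt0.
  have cMp : coprime M p by apply: coprime_dvdr cMg.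
  have ple : (M * a * b * m * p <= R)%N.
    rewrite E1; apply: leq_trans le; rewrite leq_mul2l; apply/orP; right.
    apply: leq_trans (leq_trans (_ : p <= J ^ 2)%N _).
    + by [].
    + by apply: leq_trans YJ; rewrite -ltnS.
    + by rewrite leq_pmulr // expn_gt0 J0.
  have H : (#|QB p| * (M ^ 4 * g ^ 2 * p) <= 48 * R ^ 4)%N.
    rewrite /QB /clash_at; have [pab|npab] := boolP (p %| a * b)%N.
      apply: card_norm_dvd => //; rewrite coprimeMl cMp /= coprime_sym prime_coprime //.
      by rewrite -prime_coprime // (coprime_dvdl pab).
    apply: card_coord_dvd => //; rewrite -mulnA coprimeMl cMp /=.
    by rewrite coprime_sym prime_coprime.
  move/toF: H; rewrite mulrA => h'.
  by rewrite ler_pdivlMr // mulrA ler_pdivlMr // mulrAC.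
have := cov; rewrite -(ler_nat F) !natrD !natr_sum => covF.
have LF : (#|L|)%:R = R%:R ^+ 4 / W :> F.
  by rewrite -natrX -cardL natrM (_ : (M ^ 4 * g ^ 2)%N%:R = W) ?mulfK ?gt_eqF // /W -!natrX -natrM.
have hbig : (#|big_gcd R J|)%:R <= 5184 * R%:R ^+ 4 / J%:R :> F by exact: card_big_gcd.
have hz : (#|Z|)%:R <= 4 * D%:R * R%:R ^+ 3 :> F by rewrite -natrX -!natrM ler_nat.
have sA : \sum_(p | PA p) (#|QA p|)%:R <= 192 * (R%:R ^+ 4 / W) * P%:R^-1.
  apply: le_trans (ler_sum _ bA) _; rewrite -mulr_sumr ler_wpM2l //.
    by rewrite mulr_ge0 // divr_ge0 // ?exprn_ge0 // ltW.
  apply: le_trans (sum_inv_sq F (J ^ 2).+1 P0).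
  rewrite big_mkcond [leRHS]big_mkcond; apply: ler_sum => p _; rewrite /PA.
  case: (P < p)%N => //=; case: ifP => // _; by rewrite invr_ge0 exprn_ge0.
have sB : \sum_(p | PB p) (#|QB p|)%:R <= 48 * (R%:R ^+ 4 / W) * \sum_(p < Y.+1 | prime p && (p %| g)%N) (p%:R)^-1.
  by apply: le_trans (ler_sum _ bB) _; rewrite -mulr_sumr.
rewrite LF in covF; move: covF sA sB hbig hz.
set x := \sum_(p | PA p) _; set y := \sum_(p | PB p) _; set w := \sum_(p < _ | _) _.
move: x y w (#|big_gcd R J|%:R) (#|Z|%:R) (#|good _ _ _ _ _ _ _ _ _|%:R) => x y w e f h.
move: (R%:R ^+ 4 / W) (5184 * R%:R ^+ 4 / J%:R) (4 * D%:R * R%:R ^+ 3) (P%:R^-1) => X1 X2 X3 X4.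
by move=> h1 h2 h3 h4 h5; lra.
Qed.

(** * From pairs to rational points *)

Lemma vline_proj_subproof (K : fieldType) (n : nat) :
  \dim <[const_mx 1 : 'rV[K]_n.+1]>%VS == 1%N.
Proof.
rewrite dim_vline (_ : (const_mx 1 : 'rV[K]_n.+1) != 0) //.
by apply/eqP => /rowP /(_ ord0) /eqP; rewrite !mxE oner_eq0.
Qed.

(* The line through x; the value at x = 0 is irrelevant. *)
Definition proj_pt (K : fieldType) (n : nat) (x : 'rV[K]_n.+1) : projsp K n :=
  insubd (exist (fun L : {vspace 'rV[K]_n.+1} => \dim L == 1%N) _
    (vline_proj_subproof K n) : projsp K n) <[x]>%VS.

Lemma proj_ptP (K : fieldType) (n : nat) (x : 'rV[K]_n.+1) :
  x != 0 -> hcoord (proj_pt x) x.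
Proof. by move=> x0; rewrite /hcoord /proj_pt val_insubd dim_vline x0. Qed.

Lemma hcoord_prop (K : fieldType) (n : nat) (P : projsp K n) (x y : 'rV[K]_n.+1) :
  hcoord P x -> hcoord P y -> exists2 c, c != 0 & x = c *: y.
Proof.
move=> Px Py; have : x \in <[y]>%VS by rewrite -Py Px memv_line.
move=> /vlineP[c xy]; exists c => //; apply/eqP => c0.
by have := hcoord_neq0 Px; rewrite xy c0 scale0r eqxx.
Qed.

(** Any integral vector on the line is an integral multiple of the primitive one, so cancelling a
    common factor can only lower the norm. *)
Lemma rep_norm_le (R : realType) (P : projsp rat 3) (z : 'rV[int]_4) (N : R) :
  hcoord P (map_mx intr z) -> (forall i, `|z ord0 i|%:~R <= N) ->
  `|map_mx intr (rep P) : 'rV[R]_4| <= N.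
Proof.
move=> Pz zN; have [r1 Pr] := rep_prim P.
have [c c0 zr] := hcoord_prop Pz Pr.
have E : denq c *: z = numq c *: rep P.
  apply/rowP => i; rewrite [LHS]mxE [RHS]mxE; apply: (@intr_inj rat).
  move/rowP: zr => /(_ i); rewrite !mxE => zri.
  by rewrite !intrM zri mulrA numqE [_ * c]mulrC.
have dn : (`|denq c| %| `|numq c|)%N.
  rewrite -(biggcdZ (numq c) r1) -E; apply/dvdn_biggcdP => i _.
  by rewrite mxE abszM dvdn_mulr.
have d1 : denq c = 1.
  have := coprime_num_den c; rewrite /coprime (gcdn_idPr dn) => /eqP h.
  by rewrite -absz_denq h.
rewrite d1 scale1r in E.
rewrite [leLHS]/Num.norm /= mx_normrE; apply/bigmax_leP; split.
  by apply: le_trans (zN ord0); rewrite ler0z.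
move=> [i j] _ /=; rewrite (ord1 i) mxE -intr_norm; apply: le_trans (zN j).
rewrite ler_int E mxE normrM ler_peMl //.
by rewrite -gtz0_ge1 normr_gt0 numq_eq0.
Qed.

Definition fpt (u v : eis) (i : nat) : rat := (fermat_pt u.1 u.2 v.1 v.2 i)%:~R.
Definition xpt (e : nat -> nat) : 'rV[rat]_4 := xrow (fun i => (e i)%:R).
Definition ypt (e : nat -> nat) (u v : eis) : 'rV[rat]_4 :=
  yrow (fun i => (e i)%:R) (fpt u v).
Definition Ppt (e : nat -> nat) (u v : eis) : biproj rat :=
  (proj_pt (xpt e), proj_pt (ypt e u v)).

Lemma prod_e_neq0 (e : nat -> nat) (P : pred 'I_4) : (forall i, (i < 4)%N -> (0 < e i)%N) ->
  \prod_(j < 4 | P j) (e j)%:R != 0 :> rat.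
Proof. by move=> he; apply/prodf_neq0 => j _; rewrite pnatr_eq0 -lt0n he. Qed.

Lemma xpt_neq0 (e : nat -> nat) : (forall i, (i < 4)%N -> (0 < e i)%N) -> xpt e != 0.
Proof.
move=> he; apply/eqP => /rowP /(_ ord0) /eqP; rewrite !mxE expf_eq0 /= pnatr_eq0 -leqn0 leqNgt.
by rewrite he.
Qed.

Lemma ypt_neq0 (e : nat -> nat) (u v : eis) : (forall i, (i < 4)%N -> (0 < e i)%N) ->
  v != 0 -> ek u v != 0 -> ypt e u v != 0.
Proof.
move=> he v0 k0; apply/eqP => /rowP y0.
have F0 (i : 'I_4) : fermat_pt u.1 u.2 v.1 v.2 i = 0.
  have /eqP := y0 i; rewrite !mxE mulf_eq0 (negbTE (prod_e_neq0 _ he)) orbF.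
  by rewrite intr_eq0 => /eqP.
have [E _] := fermat_pt_eis u v.
have : ek u v * v == 0.
  by rewrite E (F0 (@Ordinal 4 0 isT)) (F0 (@Ordinal 4 1 isT)).
by rewrite -eN_eq0 eN_mul mulf_eq0 !eN_eq0 (negbTE v0) (negbTE k0).
Qed.

Lemma Ppt_mem (U : zopen) (p : bipoly) (e : nat -> nat) (u v : eis) :
  (forall i, (i < 4)%N -> (0 < e i)%N) -> v != 0 -> ek u v != 0 ->
  zeqs U p -> fibre_val p e u v != 0 -> Upts U rat (Ppt e u v).
Proof.
move=> he v0 k0 Up hF.
have hx := proj_ptP (xpt_neq0 he); have hy := proj_ptP (ypt_neq0 he v0 k0).
split; last first.
  by exists p => // hv; move/eqP: hF; apply; exact: hv hx hy.
move=> x y Px Py; have [a _ ->] := hcoord_prop Px hx; have [b _ ->] := hcoord_prop Py hy.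
rewrite bieval_eqY.
transitivity (a * b ^+ 3 * (\prod_(j < 4) (e j)%:R) ^+ 3 * \sum_(i < 4) fpt u v i ^+ 3).
  rewrite mulr_sumr; apply: eq_bigr => i _; rewrite !mxE.
  by rewrite [in RHS](bigD1 i) //=; ring.
have -> : \sum_(i < 4) fpt u v i ^+ 3 =
    (\sum_(i < 4) fermat_pt u.1 u.2 v.1 v.2 i ^+ 3)%:~R.
  by rewrite rmorph_sum; apply: eq_bigr => i _; rewrite rmorphXn.
by rewrite fermat_pt_eq0 mulr0.
Qed.

(** |x|^3 contributes A^9. In y, the three other e_j contribute A^3, and the common divisor g of the
    Fermat coordinates is cancelled from 7 K^4. *)
Lemma Ppt_height (R : realType) (e : nat -> nat) (u v : eis) (g K A : nat) :
  (forall i, (i < 4)%N -> (0 < e i <= A)%N) -> v != 0 -> ek u v != 0 -> (0 < g)%N ->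
  (forall i, (g %| fermat_pt u.1 u.2 v.1 v.2 i)%Z) ->
  0 <= u.1 <= K%:Z -> 0 <= u.2 <= K%:Z -> 0 <= v.1 <= K%:Z -> 0 <= v.2 <= K%:Z ->
  height R (Ppt e u v) <= 7 * (A ^ 12)%N%:R * K%:R ^+ 4 / g%:R.
Proof.
move=> heA v0 k0 g0 hg hu1 hu2 hv1 hv2.
have he i : (i < 4)%N -> (0 < e i)%N by move=> /heA /andP[].
have A0 : (0 < A)%N by have /andP[h1 h2] := heA 0%N isT; apply: leq_trans h2.
have hx := proj_ptP (xpt_neq0 he); have hy := proj_ptP (ypt_neq0 he v0 k0).
pose X : 'rV[int]_4 := \row_i (e i)%:Z ^+ 3.
pose Yv : 'rV[int]_4 := \row_(i < 4)
  ((fermat_pt u.1 u.2 v.1 v.2 i %/ g)%Z * \prod_(j < 4 | j != i) (e j)%:Z).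
have g0R : 0 < g%:R :> R by rewrite ltr0n.
have A3 : (A ^ 3)%N%:Z = A%:Z ^+ 3 by rewrite !expnS expn0 !PoszM; ring.
have PX : hcoord (Ppt e u v).1 (map_mx intr X).
  have -> : map_mx intr X = xpt e by apply/rowP => i; rewrite !mxE rmorphXn.
  exact: hx.
have PY : hcoord (Ppt e u v).2 (map_mx intr Yv).
  have -> : map_mx intr Yv = (g%:R)^-1 *: ypt e u v.
    apply/rowP => i; rewrite !mxE rmorphM rmorph_prod /= mulrA; congr (_ * _).
    rewrite /fpt -{2}(divzK (hg i)) rmorphM /= mulrC mulrK // unitfE.
    by rewrite intr_eq0 eqz_nat -lt0n.
  by apply: hcoordZ => //; rewrite invr_eq0 pnatr_eq0 -lt0n.
have b1 : `|map_mx intr (rep (Ppt e u v).1) : 'rV[R]_4| <= (A ^ 3)%N%:R.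
  apply: (rep_norm_le PX) => i; rewrite mxE normrX /= -[(A ^ 3)%N%:R]/((A ^ 3)%N%:~R) ler_int.
  have /andP[_ h] := heA i (ltn_ord i); rewrite A3.
  by rewrite lerXn2r ?nnegrE // ger0_norm // lez_nat.
have b2 : `|map_mx intr (rep (Ppt e u v).2) : 'rV[R]_4| <= 7 * (A ^ 3)%N%:R * K%:R ^+ 4 / g%:R.
  apply: (rep_norm_le PY) => i; rewrite ler_pdivlMr // mxE normrM.
  have h1 : `|(fermat_pt u.1 u.2 v.1 v.2 i %/ g)%Z| * g%:Z <= K%:Z ^+ 4 *+ 7.
    rewrite -[g%:Z]ger0_norm // -normrM divzK //.
    exact: fermat_pt_le.
  have h2 : `|\prod_(j < 4 | j != i) (e j)%:Z| <= (A ^ 3)%N%:Z.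
    rewrite normr_prod; apply: (@le_trans _ _ (\prod_(j < 4 | j != i) A%:Z)).
      apply: ler_prod => j _; rewrite normr_ge0 /= ger0_norm // lez_nat.
      by case/andP: (heA j (ltn_ord j)).
    by rewrite prodr_const cardC1 card_ord A3.
  have h3 : `|(fermat_pt u.1 u.2 v.1 v.2 i %/ g)%Z| * g%:Z * `|\prod_(j < 4 | j != i) (e j)%:Z|
      <= (K%:Z ^+ 4 *+ 7) * (A ^ 3)%N%:Z by apply: ler_pM => //; rewrite mulr_ge0.
  rewrite -(ler_int R) in h3; rewrite [X in X * _](_ : _ = (`|(fermat_pt u.1 u.2 v.1 v.2 i %/ g)%Z| *
    `|\prod_(j < 4 | j != i) (e j)%:Z|)%:~R) //.
  rewrite (_ : g%:R = (g%:Z)%:~R :> R) // -intrM mulrAC; apply: le_trans h3 _.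
  by rewrite intrM rmorphMn rmorphXn /= -!pmulrn -mulr_natl mulrAC.
rewrite /height; apply: (@le_trans _ _ ((A ^ 3)%N%:R ^+ 3 * (7 * (A ^ 3)%N%:R * K%:R ^+ 4 / g%:R))).
  by apply: ler_pM => //; rewrite ?exprn_ge0 // lerXn2r ?nnegrE.
rewrite -natrX; have -> : (A ^ 12 = (A ^ 3) ^ 3 * A ^ 3)%N by rewrite -expnM -expnD.
by rewrite natrM le_eqVlt; apply/orP; left; apply/eqP; ring.
Qed.

(** Equal points have proportional Fermat coordinates, hence equal ratios u / v; coprimality and the
    residue class modulo M then fix the pair. *)
Lemma Ppt_inj (M : nat) (e : nat -> nat) (u v u' v' p q p' q' : eis) : (2 < M)%N ->
  (forall i, (i < 4)%N -> (0 < e i)%N) ->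
  in_class M u v -> in_class M u' v' ->
  p * u + q * v = 1 -> p' * u' + q' * v' = 1 ->
  Ppt e u v = Ppt e u' v' -> u = u' /\ v = v'.
Proof.
move=> M2 he /and4P[c1 c2 c3 c4] /and4P[c1' c2' c3' c4'] b b' /(congr1 snd) /= e2.
have nz (w : eis) : (M %| w.1 - 1)%Z -> w != 0.
  move=> h; apply/eqP => w0; move: h; rewrite w0 sub0r dvdzE abszN dvdn1 => /eqP.
  by move: M2; clear; lia.
have k0 : ek u v != 0 by apply: (@ek_neq0 M).
have k0' : ek u' v' != 0 by apply: (@ek_neq0 M).
have hy := proj_ptP (ypt_neq0 he (nz _ c3) k0).
have hy' := proj_ptP (ypt_neq0 he (nz _ c3') k0').
rewrite -[proj_pt _]e2 in hy'.
have [c c0 E] := hcoord_prop hy hy'.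
have ratio : u * v' = u' * v.
  apply: (@fermat_pt_ratio u v u' v' (denq c) (numq c)) => // i i4.
  apply: (@intr_inj rat); rewrite !intrM.
  have /rowP /(_ (Ordinal i4)) := E; rewrite !mxE /fpt /= mulrA => /(mulIf (prod_e_neq0 _ he)) Fi.
  by rewrite Fi mulrA numqE [_ * c]mulrC.
exact: (@eis_ratio_inj M u v u' v' p q p' q').
Qed.

Lemma leq_card_fset_set (T : choiceType) (W : finType) (S : set T) (A : pred W) (f : W -> T) :
  finite_set S -> {in A &, injective f} -> (forall w, A w -> S (f w)) ->
  (#|A| <= #|` fset_set S|)%N.
Proof.
move=> finS finj fS; rewrite cardE -(size_map f).
apply: uniq_leq_size.
  by rewrite map_inj_in_uniq ?enum_uniq // => x y; rewrite !mem_enum => hx hy; exact: finj.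
move=> y /mapP[w]; rewrite mem_enum => hw ->.
by rewrite in_fset_set // inE; exact: fS.
Qed.

Lemma lat_pred_class (R M a b s m t : nat) (z : box R) : lat_pred R M a b s m t z ->
  in_class M (zu z) (zv z) /\ in_lat a b s m t (zu z) (zv z).
Proof. by move=> /andP. Qed.

Lemma good_exact (R J Y M a b s m t : nat) (Z : pred (box R)) (z : box R) :
  (0 < a * b * m)%N -> squarefree (a * b * m) ->
  (forall p, prime p -> (p %| a * b * m)%N -> (p <= Y)%N) ->
  good J Y M a b s m t Z z -> exact_type (J ^ 2) M a b m (zu z) (zv z).
Proof.
move=> g0 sf pY /and5P[_ /forallP h1 /forallP h2 _ _]; split=> p pp.
- move=> pJ cp; have := h1 (Ordinal (pJ : (p < (J ^ 2).+1)%N)).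
  by rewrite /= pp coprime_sym cp.
- move=> pab; have pg : (p %| a * b * m)%N by rewrite dvdn_mulr.
  have := h2 (Ordinal (pY p pp pg : (p < Y.+1)%N)).
  by rewrite /= pp pg /clash_at pab.
- move=> pm; have pg : (p %| a * b * m)%N by rewrite dvdn_mull.
  have npab : ~~ (p %| a * b)%N.
    rewrite -prime_coprime //; apply: coprime_dvdl pm _; rewrite coprime_sym.
    exact: (squarefree_coprime g0 _ sf).
  have := h2 (Ordinal (pY p pp pg : (p < Y.+1)%N)).
  by rewrite /= pp pg /clash_at (negbTE npab) negb_or => /andP.
Qed.

Lemma good_coprime (R J Y M a b s m t : nat) (Z : pred (box R)) (z : box R) :
  (1 < M)%N -> (3 %| M)%N -> (0 < a * b * m)%N -> squarefree (a * b * m) ->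
  (forall p, prime p -> (p %| a * b * m)%N -> (p <= Y)%N) -> admissible M a b s m t ->
  good J Y M a b s m t Z z -> exists p q : eis, p * zu z + q * zv z = 1.
Proof.
move=> M1 M3 g0 sf pY ad gd; have ex := good_exact g0 sf pY gd.
case/and5P: gd => /lat_pred_class[cl la] _ _ nbig _.
apply: (lat_coprime M1 M3 (leqnn _) ad la cl ex) => x y Jxy; apply: contra nbig => /andP[hu hv].
have v0 : zv z != 0.
  apply/eqP => v0; case/and4P: cl => _ _; rewrite v0 /= sub0r dvdzE abszN dvdn1 => /eqP.
  by move: M1; clear; lia.
have j0 : (0 < maxn x y)%N by apply: leq_ltn_trans Jxy.
have := edvd_max_le j0 v0 hv; rewrite geq_max => /andP[hx hy].
rewrite /big_gcd /= v0; apply/existsP.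
by exists (Ordinal (hx : (x < (2 * R).+1)%N), Ordinal (hy : (y < (2 * R).+1)%N)); rewrite /= Jxy hu hv.
Qed.

Definition zeros (p : bipoly) (e : nat -> nat) (R : nat) : pred (box R) :=
  [pred z | fibre_val p e (zu z) (zv z) == 0].

Definition tgood (Y J M R : nat) (p : bipoly) (e : nat -> nat) (x : tup Y) : pred (box R) :=
  good J Y M x.1.1 x.1.2.1 x.1.2.2 x.2.1 x.2.2 (zeros p e (R := R)).

Lemma tadm_admissible (Y M : nat) (x : tup Y) : tadm M x ->
  admissible M x.1.1 x.1.2.1 x.1.2.2 x.2.1 x.2.2.
Proof.
move=> ad; have c := tadm_coprime ad; case/and3P: ad => _ /andP[_ h1] /andP[_ h2].
by rewrite /admissible -/(tg x) c h1 h2.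
Qed.

Lemma box_inj (R : nat) (z z' : box R) : zu z = zu z' -> zv z = zv z' -> z = z'.
Proof.
case: z => [[[a b] c] d]; case: z' => [[[a' b'] c'] d'] [/= h1 h2] [h3 h4].
by rewrite (val_inj h1) (val_inj h2) (val_inj h3) (val_inj h4).
Qed.

Lemma tup_inj (Y : nat) (x y : tup Y) : x.1.1 = y.1.1 :> nat -> x.1.2.1 = y.1.2.1 :> nat ->
  x.1.2.2 = y.1.2.2 :> nat -> x.2.1 = y.2.1 :> nat -> x.2.2 = y.2.2 :> nat -> x = y.
Proof.
case: x => [[a [b s]] [m t]]; case: y => [[a' [b' s']] [m' t']] /=.
by do 5!move/val_inj ->.
Qed.

(** The disjoint union of the good sets, whose boxes vary with the tuple, injects into the points
    counted: the point determines (u, v) and (u, v) determines the tuple. Uniqueness of the tuple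
    tests primes up to J^2 only, hence the bound on g. *)
Lemma count_lower (F : realType) (U : zopen) (p : bipoly) (e : nat -> nat) (A Y J M : nat)
    (Rf : tup Y -> nat) (B : F) :
  zeqs U p -> (forall i, (i < 4)%N -> (0 < e i <= A)%N) ->
  (2 < M)%N -> (3 %| M)%N ->
  (forall x : tup Y, tadm M x -> (tg x <= J ^ 2)%N) ->
  (forall x : tup Y, tadm M x -> 7 * (A ^ 12)%N%:R * (Rf x)%:R ^+ 4 / (tg x)%:R <= B) ->
  (\sum_(x : tup Y | tadm M x && tsqf x) #|tgood J M p e x (R := Rf x)| <= countN U B)%N.
Proof.
move=> Up heA M2 M3 gJ hB.
have he i : (i < 4)%N -> (0 < e i)%N by move=> /heA /andP[].
have M1 : (1 < M)%N by apply: ltn_trans M2.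
under eq_bigr => x _ do rewrite -sum1_card.
pose Q (x : tup Y) (z : box (Rf x)) := z \in tgood J M p e x (R := Rf x).
rewrite (sig_big_dep (fun x : tup Y => tadm M x && tsqf x) Q (fun _ _ => 1%N)) /=.
rewrite sum1_card.
pose f (w : {x : tup Y & box (Rf x)}) := Ppt e (zu (tagged w)) (zv (tagged w)).
have core (x : tup Y) (z : box (Rf x)) : tadm M x && tsqf x && tgood J M p e x z ->
  [/\ exists q q' : eis, q * zu z + q' * zv z = 1,
      exact_type (J ^ 2) M x.1.1 x.1.2.1 x.2.1 (zu z) (zv z),
      in_class M (zu z) (zv z),
      in_lat x.1.1 x.1.2.1 x.1.2.2 x.2.1 x.2.2 (zu z) (zv z) &
      fibre_val p e (zu z) (zv z) != 0].
  move=> /andP[/andP[ad sf] gd]; have g0 := tadm_gt0 ad.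
  have sq := tsqf_squarefree ad sf; have pY q := @tadm_prime_le Y M q x ad.
  have cp := good_coprime M1 M3 g0 sq pY (tadm_admissible ad) gd.
  have ex := good_exact g0 sq pY gd.
  by case/and5P: gd => /lat_pred_class[cl la] _ _ _ nz.
apply: (leq_card_fset_set (f := f)).
- by apply: sub_finite_set (finite_height B) => P [].
- move=> [x z] [x' z'] hw hw'; rewrite /f /= => E.
  have [[q1 [q2 co]] ex cl la _] := core x z hw; have [[q1' [q2' co']] ex' cl' la' _] := core x' z' hw'.
  have [eu ev] := Ppt_inj M2 he cl cl' co co' E.
  move/andP: hw => [/andP[ad sf] _]; move/andP: hw' => [/andP[ad' sf'] _].
  rewrite eu ev in la ex.
  have [e1 e2 e3 e4 e5] := lat_unique M3
    (introT andP (conj (tadm_gt0 ad) (gJ x ad))) (introT andP (conj (tadm_gt0 ad') (gJ x' ad')))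
    (tsqf_squarefree ad sf) (tsqf_squarefree ad' sf')
    (tadm_admissible ad) (tadm_admissible ad') la la' ex ex'.
  have exx : x = x' by exact: tup_inj.
  subst x'; congr existT.
  exact: box_inj.
- move=> [x z] hw; have [[q1 [q2 co]] ex cl la nz] := core x z hw.
  move/andP: hw => [/andP[ad sf] _]; have g0 := tadm_gt0 ad.
  case/and4P: (cl) => c1 c2 c3 c4.
  have v0 : zv z != 0.
    apply/eqP => v0; move: c3; rewrite v0 /= sub0r dvdzE abszN dvdn1 => /eqP.
    by move: M1; clear; lia.
  have k0 : ek (zu z) (zv z) != 0 by apply: (@ek_neq0 M).
  split; first exact: (Ppt_mem he v0 k0 Up nz).
  apply: le_trans (hB x ad); rewrite /f /=.
  have sq := tsqf_squarefree ad sf; have [cM hS hP] := admissibleP (tadm_admissible ad).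
  apply: Ppt_height => //; try by rewrite /= lez_nat ltnW.
  move=> i; apply: lat_dvd hS hP la.
    exact: (squarefree_coprime g0 _ sq).
  by apply: (squarefree_coprime g0 _ sq); rewrite /tg dvdn_mulr.
Qed.

(** * Choice of the parameters and conclusion *)

Lemma choose_scale (R : realType) (B C : R) (g M N : nat) :
  0 < C -> (0 < g)%N -> (0 < M)%N -> (0 < N)%N ->
  C * (M ^ 4 * g ^ 3 * N ^ 4)%N%:R <= B ->
  exists Q : nat, [/\ (N <= Q)%N, C * (M * g * Q)%N%:R ^+ 4 <= B * g%:R &
    B * g%:R <= 16 * C * (M * g * Q)%N%:R ^+ 4].
Proof.
move=> C0 g0 M0 N0 h.
have gR : 0 < g%:R :> R by rewrite ltr0n.
have MR : 0 < M%:R :> R by rewrite ltr0n.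
have B0 : 0 < B by apply: lt_le_trans h; rewrite mulr_gt0 // ltr0n !muln_gt0 ?expn_gt0 M0 g0 N0.
pose r := Num.sqrt (Num.sqrt (B * g%:R / C)).
have r4 : r ^+ 4 = B * g%:R / C.
  rewrite /r -[4%N]/(2 * 2)%N exprM !sqr_sqrtr ?sqrtr_ge0 //.
  by rewrite divr_ge0 ?mulr_ge0 // ltW.
(* The box side is M g times the integral part of t, a multiple of M g as the exact count demands.
   Rounding down loses at most a factor 2, hence 16 in the fourth power. *)
pose t := r / (M * g)%N%:R.
have Mg0 : 0 < (M * g)%N%:R :> R by rewrite ltr0n muln_gt0 M0.
have t0 : 0 <= t by rewrite divr_ge0 ?sqrtr_ge0 // ltW.
have t4 : C * ((M * g)%N%:R * t) ^+ 4 = B * g%:R.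
  by rewrite /t [X in X ^+ 4]mulrC divfK ?gt_eqF // r4 mulrC divfK ?gt_eqF.
have Nt : N%:R <= t.
  rewrite -(@ler_pXn2r _ 4) ?nnegrE //.
  rewrite -(ler_pM2l (_ : 0 < C * (M * g)%N%:R ^+ 4)); last by rewrite mulr_gt0 // exprn_gt0.
  rewrite -[leRHS]mulrA -[X in _ <= C * X]exprMn t4.
  apply: le_trans (ler_wpM2r (ltW gR) h); rewrite le_eqVlt; apply/orP; left; apply/eqP.
  by rewrite !natrM; ring.
have /andP[q1 q2] := truncn_itv t0.
set Q := Num.truncn t in q1 q2; exists Q.
have NQ : (N <= Q)%N by rewrite /Q truncn_ge_nat.
have Q1 : 1 <= Q%:R :> R by rewrite ler1n (leq_trans N0).
clearbody Q t; split=> //.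
  rewrite -t4 natrM; apply: ler_wpM2l; first exact: ltW.
  rewrite ler_pXn2r ?nnegrE ?mulr_ge0 //.
  by apply: ler_wpM2l.
rewrite -t4 [16 * C]mulrC -mulrA; apply: ler_wpM2l; first exact: ltW.
rewrite [leRHS]mulrC; have -> : (M * g * Q)%N%:R ^+ 4 * 16 = ((M * g)%N%:R * (2 * Q%:R)) ^+ 4 :> R.
  by rewrite natrM; ring.
rewrite ler_pXn2r ?nnegrE ?mulr_ge0 //; apply: ler_wpM2l => //.
move: q2; rewrite -natr1; lra.
Qed.

Lemma tg_le (Y : nat) (x : tup Y) : (tg x <= Y ^ 3)%N.
Proof.
have le (i : 'I_Y.+1) : (i <= Y)%N by rewrite -ltnS.
by rewrite /tg (_ : Y ^ 3 = Y * Y * Y)%N ?leq_mul //; ring.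
Qed.

(* B / (C M^4 g) is the expected order of the number of points attached to a
   tuple. *)
Lemma sieve_arith (R : realFieldType) (C B g M J D X i S G : R) :
  0 < C -> 0 < B -> 0 < g -> 0 < M -> 0 < J -> 0 <= D -> J <= X -> 0 <= S -> 0 < i -> 192 * i <= 1 ->
  C * X ^+ 4 <= B * g -> B * g <= 16 * C * X ^+ 4 ->
  5184 * 128 * (M ^+ 4 * g ^+ 2) <= J -> 512 * D * (M ^+ 4 * g ^+ 2) <= J ->
  X ^+ 4 / (M ^+ 4 * g ^+ 2) * (1 - 192 * i - 48 * S) - 5184 * X ^+ 4 / J - 4 * D * X ^+ 3 <= G ->
  B / (C * M ^+ 4) * g^-1 * ((1 - 192 * i) / 16 - 1 / 64 - 48 * S) <= G.
Proof.
move=> C0 B0 g0 M0 J0 D0 JX S0 i0 hi h1 h2 h3 h4; apply: le_trans.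
have X0 : 0 < X by apply: lt_le_trans JX.
have W0 : 0 < M ^+ 4 * g ^+ 2 by rewrite mulr_gt0 // exprn_gt0.
set W := M ^+ 4 * g ^+ 2 in h3 h4 W0 *.
set b := B / (C * M ^+ 4) * g^-1.
have bE : b = B * g / C / W.
  by rewrite /b /W; field; rewrite !gt_eqF // ?exprn_gt0.
have X4 : X ^+ 4 <= B * g / C by rewrite ler_pdivlMr // mulrC.
have X4' : B * g / C <= 16 * X ^+ 4 by rewrite ler_pdivrMr // mulrAC.
have m1 : X ^+ 4 / W <= b by rewrite bE ler_pM2r // invr_gt0.
have m2 : b <= 16 * (X ^+ 4 / W) by rewrite bE mulrA ler_pM2r // invr_gt0.
have V0 : 0 < B * g / C by rewrite divr_gt0 // mulr_gt0.
(* This error and the next one are at most b / 128 each; together they make up the 1 / 64. *)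
have e1 : 5184 * X ^+ 4 / J <= b / 128.
  rewrite ler_pdivrMr // bE (_ : B * g / C / W / 128 * J = (B * g / C) * (J / W / 128)); last by ring.
  rewrite mulrC; apply: ler_pM => //; first by rewrite exprn_ge0 // ltW.
  by rewrite ler_pdivlMr // ler_pdivlMr.
have e2 : 4 * D * X ^+ 3 <= b / 128.
  have : 4 * D * X ^+ 3 * X <= (b / 128) * X; last by rewrite ler_pM2r.
  rewrite bE; apply: (@le_trans _ _ (4 * D * (B * g / C))).
    by rewrite -mulrA -exprSr ler_wpM2l // mulr_ge0.
  rewrite (_ : B * g / C / W / 128 * X = (B * g / C) * (X / W / 128)); last by ring.
  rewrite mulrC; apply: ler_wpM2l; first exact: ltW.
  rewrite ler_pdivlMr // ler_pdivlMr //.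
  by apply: le_trans JX; apply: le_trans h4; rewrite le_eqVlt; apply/orP; left; apply/eqP; ring.
move: (X ^+ 4 / W) b (5184 * X ^+ 4 / J) (4 * D * X ^+ 3) m1 m2 e1 e2 {bE} => m b' x y m1 m2 e1 e2.
have : b' * (1 - 192 * i) <= 16 * m * (1 - 192 * i) by rewrite ler_wpM2r // subr_ge0.
have : m * S <= b' * S by rewrite ler_wpM2r.
lra.
Qed.

(** As g <= Y^3, J is at least k M^4 g^2, with k absorbing the constants of the last two losses, and
    the box is large enough because Q >= J^4. With P >= 10^5, the average proportion (1/16 - 1/64 -
    12 / P)(1 - 13 / P) - 240 / P stays above 1/32. *)
Lemma count_sieve (F : realType) (U : zopen) (p : bipoly) (e : nat -> nat) (A D P M k Y J : nat) (B : F) :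
  zeqs U p -> (forall i, (i < 4)%N -> (0 < e i <= A)%N) ->
  (forall R, (#|zeros p e (R := R)| <= 4 * D * R ^ 3)%N) ->
  10 ^+ 5 <= P%:R :> F -> (2 < M)%N -> (3 %| M)%N ->
  (forall q, prime q -> (q <= P)%N -> (q %| M)%N) ->
  5184 * 128 <= k%:R :> F -> 512 * D%:R <= k%:R :> F -> (0 < Y)%N ->
  J = (k * M ^ 4 * Y ^ 6)%N ->
  7 * (A ^ 12)%N%:R * (M ^ 4 * (Y ^ 3) ^ 3 * (J ^ 4) ^ 4)%N%:R <= B ->
  B / (7 * (A ^ 12)%N%:R * M%:R ^+ 4) / 32 * tsum F Y M predT <= (countN U B)%:R.
Proof.
move=> Up heA hD P5 M2 M3 MP k1 k2 Y0 JE.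
have k0 : (0 < k)%N by rewrite -(ltr0n F); lra.
have P0 : (0 < P)%N by rewrite -(ltr0n F); apply: lt_le_trans P5; rewrite exprn_gt0.
have M0 : (0 < M)%N by apply: leq_trans M2.
have A0 : (0 < A)%N by case/andP: (heA 0%N isT) => h1 h2; exact: leq_trans h2.
have M40 : (0 < M ^ 4)%N by rewrite expn_gt0 M0.
have J0 : (0 < J)%N by rewrite JE 2!muln_gt0 k0 M40 expn_gt0 Y0.
have Y6J : (Y ^ 6 <= J)%N by rewrite JE leq_pmull // muln_gt0 k0.
have JJ2 : (J <= J ^ 2)%N by rewrite -mulnn leq_pmull.
have Y3J : (Y ^ 3 <= J ^ 2)%N by apply: leq_trans JJ2; apply: leq_trans Y6J; rewrite leq_pexp2l.
have YJ : (Y <= J ^ 2)%N by apply: leq_trans Y3J; rewrite -{1}[Y]expn1 leq_pexp2l.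
set C := 7 * _; move=> hB.
have C0 : 0 < C :> F by rewrite mulr_gt0 // ltr0n expn_gt0 A0.
have B0 : 0 < B by apply: lt_le_trans hB; rewrite mulr_gt0 // ltr0n 2!muln_gt0 !expn_gt0 M0 Y0 J0.
have /choice [Qf hQ] : forall x : tup Y, exists Q : nat, tadm M x ->
    [/\ (J ^ 4 <= Q)%N, C * (M * tg x * Q)%N%:R ^+ 4 <= B * (tg x)%:R &
      B * (tg x)%:R <= 16 * C * (M * tg x * Q)%N%:R ^+ 4].
  move=> x; have [ad|] := boolP (tadm M x); last by exists 0%N.
  have [||Q hQ] := @choose_scale F B C (tg x) M (J ^ 4) C0 (tadm_gt0 ad) M0.
  - by rewrite expn_gt0 J0.
  - apply: le_trans hB; rewrite ler_pM2l // ler_nat leq_mul2r leq_mul2l.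
    by rewrite (leq_exp2r _ _ (isT : (0 < 3)%N)) tg_le !orbT.
  by exists Q.
pose Rf (x : tup Y) := (M * tg x * Qf x)%N.
have gJ (x : tup Y) : tadm M x -> (tg x <= J ^ 2)%N.
  by move=> ad; exact: leq_trans (tg_le x) Y3J.
have hR (x : tup Y) : tadm M x -> C * (Rf x)%:R ^+ 4 / (tg x)%:R <= B.
  by move=> ad; have [_ h _] := hQ x ad; rewrite ler_pdivrMr ?ltr0n ?(tadm_gt0 ad).
have cl := @count_lower F U p e A Y J M Rf B Up heA M2 M3 gJ hR.
rewrite -(ler_nat F) natr_sum in cl; apply: le_trans cl.
pose i : F := P%:R^-1.
pose S (x : tup Y) : F := \sum_(q < Y.+1 | prime q && (q %| tg x)%N) (q : nat)%:R^-1.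
pose E := B / (C * M%:R ^+ 4).
have i5 : i <= (10 ^+ 5)^-1 by rewrite lef_pV2 ?posrE ?ltr0n // exprn_gt0.
have i0 : 0 < i by rewrite invr_gt0 ltr0n.
have E0 : 0 < E by rewrite divr_gt0 // mulr_gt0 // exprn_gt0 // ltr0n.
have i192 : 192 * i <= 1 by lra.
have S0 x : 0 <= S x by apply: sumr_ge0 => q _; rewrite invr_ge0.
have key x : tadm M x && tsqf x ->
   E * (tg x)%:R^-1 * ((1 - 192 * i) / 16 - 1 / 64 - 48 * S x) <= #|tgood J M p e x (R := Rf x)|%:R.
  move=> /andP[ad sf]; have g0 := tadm_gt0 ad.
  have [q1 q2 q3] := hQ x ad.
  have g2 : ((tg x) ^ 2 <= Y ^ 6)%N.
    by rewrite -[6%N]/(3 * 2)%N expnM leq_exp2r // tg_le.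
  have gF : M%:R ^+ 4 * (tg x)%:R ^+ 2 <= (M ^ 4 * Y ^ 6)%N%:R :> F.
    by rewrite -!natrX -natrM ler_nat leq_mul2l g2 orbT.
  have JF : J%:R = k%:R * (M ^ 4 * Y ^ 6)%N%:R :> F by rewrite JE -mulnA natrM.
  have W0 : 0 <= M%:R ^+ 4 * (tg x)%:R ^+ 2 :> F by rewrite mulr_ge0 ?exprn_ge0.
  have RJ : (J ^ 4 <= Rf x)%N by apply: leq_trans q1 _; rewrite leq_pmull // muln_gt0 M0.
  apply: (@sieve_arith F C B (tg x)%:R M%:R J%:R D%:R (Rf x)%:R i (S x)) => //.
  - by rewrite ltr0n.
  - by rewrite ltr0n.
  - by rewrite ltr0n.
  - by rewrite ler_nat; apply: leq_trans RJ; rewrite -{1}[J]expn1 leq_pexp2l.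
  - by rewrite JF; apply: ler_pM => //; rewrite mulr_ge0.
  - by rewrite JF; apply: ler_pM => //; rewrite mulr_ge0.
  have := @good_lower F (Rf x) J Y P M x.1.1 x.1.2.1 x.1.2.2 x.2.1 x.2.2 D (zeros p e (R := Rf x)).
  rewrite -/(tg x) -/(S x) -/i => h; apply: h => //.
  - exact: ltnW.
  - exact: (tadm_coprime ad).
  - exact: (tsqf_squarefree ad sf).
  - by rewrite -expnM leq_mul2l q1 orbT.
  - exact: dvdn_mulr.
apply: le_trans (ler_sum _ key).
have s1 := @sqf_lower F Y M P P0 M3 MP; have s2 := @prime_div_upper F Y M P P0 M3 MP.
rewrite -/i in s1 s2.
set T := tsum F Y M predT in s1 s2 *.
have T0 : 0 <= T by apply: sumr_ge0 => x _; rewrite invr_ge0.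
rewrite -mulrA -/E.
under eq_bigr => x _ do rewrite -mulrA.
rewrite -mulr_sumr ler_pM2l //.
under eq_bigr => x _ do rewrite mulrBr mulrCA [_ * (_ - _)]mulrC.
rewrite sumrB -!mulr_sumr.
have s3 : \sum_(x : tup Y | tadm M x && tsqf x) (tg x)%:R^-1 * S x <= 5 * i * T.
  apply: le_trans s2; rewrite big_mkcondr /=; apply: ler_sum => x _.
  by case: ifP => // _; rewrite mulr_ge0 ?invr_ge0 ?S0.
move: (\sum_(x | _) _) (\sum_(x | _) _) s1 s3 => s t s1 s3.
have c1 : 0 <= (1 - 192 * i) / 16 - 1 / 64 by lra.
have := ler_wpM2l c1 s1.
have : i * T <= (10 ^+ 5)^-1 * T by exact: ler_wpM2r.
have : i ^+ 2 * T >= 0 by rewrite mulr_ge0 // sqr_ge0.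
lra.
Qed.

(** K is the integral part of B^(1/n), so K + 1 exceeds B^(1/n). *)
Lemma log_scale (R : realType) (n C : nat) : (0 < n)%N ->
  exists B0 : R, 1 <= B0 /\ forall B, B0 <= B ->
    exists K : nat, [/\ (C <= K)%N, K%:R ^+ n <= B & ln B / n%:R <= ln K.+1%:R].
Proof.
move=> n0; have nR : 0 < n%:R :> R by rewrite ltr0n.
exists (expR (n%:R * C%:R)); split.
  by rewrite -[leLHS]expR0 ler_expR mulr_ge0 // ltW.
move=> B hB; have B0 : 0 < B by apply: lt_le_trans hB; exact: expR_gt0.
pose L := ln B / n%:R.
have EL : expR L ^+ n = B by rewrite -expRM_natl /L mulrC divfK ?gt_eqF // lnK.
have CL : C%:R <= L by rewrite ler_pdivlMr // mulrC -ler_expR lnK.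
have /andP[q1 q2] := truncn_itv (ltW (expR_gt0 L)).
exists (Num.truncn (expR L)); split.
- rewrite truncn_ge_nat ?(ltW (expR_gt0 L)) //.
  by apply: le_trans (expR_ge1Dx L); apply: le_trans CL _; rewrite lerDr.
- by rewrite -EL lerXn2r ?nnegrE // ltW // expR_gt0.
- by rewrite -/L -[leLHS]expRK ler_ln ?posrE ?expR_gt0 ?ltr0n // ltW.
Qed.

(** The exponent of Y is 9 + 6 * 16 = 105, and Y is of order K^2. *)
Lemma scale_pow (M k K Y : nat) : (Y <= 4 * M ^ 2 * K ^ 2)%N ->
  (M ^ 4 * (Y ^ 3) ^ 3 * ((k * M ^ 4 * Y ^ 6) ^ 4) ^ 4 <=
   M ^ 4 * (k * M ^ 4) ^ 16 * (4 * M ^ 2) ^ 105 * K ^ 210)%N.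
Proof.
set z := (k * M ^ 4)%N; set w := (4 * M ^ 2)%N => YK.
have -> : (M ^ 4 * (Y ^ 3) ^ 3 * ((z * Y ^ 6) ^ 4) ^ 4 = M ^ 4 * z ^ 16 * Y ^ 105)%N.
  by rewrite -!expnM expnMn -expnM mulnACA -expnD.
have le : (Y ^ 105 <= w ^ 105 * K ^ (2 * 105))%N by rewrite expnM -expnMn leq_exp2r.
by rewrite -[X in (_ <= X)%N]mulnA; apply: leq_mul le.
Qed.

Theorem theorem1p2 (R : realType) (U : zopen) (hU : zopen_nonempty U) :
  exists c_U B_U : R,
    0 < c_U /\ 1 <= B_U /\
    (forall B : R, B_U <= B -> c_U * (B * ln B ^+ 3) <= (countN U B)%:R).
Proof.
have [p [e [D [Up he hD]]]] := good_fibre hU.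
pose A := (\max_(i < 4) e i)%N.
have heA i : (i < 4)%N -> (0 < e i <= A)%N.
  move=> hi; rewrite he //=; exact: (leq_bigmax (F := fun i : 'I_4 => e i) (Ordinal hi)).
have A0 : (0 < A)%N by have /andP[h1 h2] := heA 0%N isT; exact: leq_trans h2.
have [P P5] : exists P : nat, 10 ^+ 5 <= P%:R :> R.
  by exists (Num.bound (10 ^+ 5 : R)); rewrite ltW // archi_boundP // exprn_ge0.
have P3 : (3 <= P)%N by rewrite -(ler_nat R); apply: le_trans P5; lra.
have [M [M2 MP]] : exists M, (2 < M)%N /\ forall q, (0 < q <= P)%N -> (q %| M)%N.
  by exists P`!%N; split; [exact: leq_trans P3 (fact_geq P) | move=> q; exact: dvdn_fact].
have M3 : (3 %| M)%N by exact: MP.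
have MP' q : prime q -> (q <= P)%N -> (q %| M)%N.
  by move=> /prime_gt0 q0 qP; apply: MP; rewrite q0.
have M0 : (0 < M)%N by apply: leq_trans M2.
have [k hk] : exists k : nat, 5184 * 128 + 512 * D%:R <= k%:R :> R.
  exists (Num.bound (5184 * 128 + 512 * D%:R : R)); rewrite ltW // archi_boundP //.
  by rewrite addr_ge0 // mulr_ge0.
have D0 : 0 <= 512 * D%:R :> R by rewrite mulr_ge0.
have k1 : 5184 * 128 <= k%:R :> R by move: hk D0; lra.
have k2 : 512 * D%:R <= k%:R :> R by move: hk; lra.
have k0 : (0 < k)%N by rewrite -(ltr0n R); apply: lt_le_trans k1; rewrite mulr_gt0.
pose C1 := (M ^ 4 * (k * M ^ 4) ^ 16 * (4 * M ^ 2) ^ 105)%N.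
(* 211 = 210 + 1: the additional power of K absorbs the constant factor. *)
have [BU [BU1 hBU]] := @log_scale R 211 (7 * A ^ 12 * C1) isT.
pose CM : R := 7 * (A ^ 12)%N%:R * M%:R ^+ 4.
have CM0 : 0 < CM by rewrite !mulr_gt0 ?exprn_gt0 ?ltr0n // expn_gt0 A0.
pose ca : R := (2 * M%:R)^-1; pose cb : R := (8 * M%:R ^+ 2)^-1.
have ca0 : 0 < ca by rewrite invr_gt0 mulr_gt0 ?ltr0n.
have cb0 : 0 < cb by rewrite invr_gt0 mulr_gt0 ?exprn_gt0 ?ltr0n.
exists (CM^-1 / 32 * (ca * cb ^+ 2 * 211^-1 ^+ 3)), BU; split.
  have s0 : 0 < 211^-1 :> R by rewrite invr_gt0.
  apply: mulr_gt0; first by rewrite divr_gt0 // invr_gt0.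
  by apply: mulr_gt0; [apply: mulr_gt0 => // |]; apply: exprn_gt0.
split=> // B hB; have [K [KC KB hK]] := hBU B hB.
have C10 : (0 < C1)%N.
  have h : (0 < k * M ^ 4)%N by rewrite muln_gt0 k0 expn_gt0 M0.
  by rewrite 2!muln_gt0 !expn_gt0 h M0 muln_gt0 expn_gt0 M0.
have K0 : (0 < K)%N by apply: leq_trans KC; rewrite 2!muln_gt0 expn_gt0 A0 C10.
(* The smallest Y allowed by [sum_b_lower]. *)
pose Y := ((1 + K * M) ^ 2)%N.
have YK : (Y <= 4 * M ^ 2 * K ^ 2)%N.
  have := muln_gt0 K M; rewrite K0 M0 /Y.
  move: (K * M)%N (mulnC K M) => w wE w0.
  have -> : (4 * M ^ 2 * K ^ 2 = (2 * w) ^ 2)%N by rewrite wE !expnMn mulnA.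
  by rewrite leq_exp2r // mul2n -addnn leq_add2r.
have Y0 : (0 < Y)%N by rewrite expn_gt0.
have B1 : 1 <= B := le_trans BU1 hB.
have B0 : 0 < B by exact: lt_le_trans B1.
have hYB : 7 * (A ^ 12)%N%:R * (M ^ 4 * (Y ^ 3) ^ 3 * ((k * M ^ 4 * Y ^ 6) ^ 4) ^ 4)%N%:R <= B.
  apply: le_trans KB; rewrite -natrM -natrM -natrX ler_nat.
  rewrite -[X in (_ <= K ^ X)%N]/(210.+1)%N expnS.
  apply: leq_trans (leq_mul (leqnn _) (scale_pow k YK)) _.
  by rewrite mulnA leq_mul2r KC orbT.
apply: le_trans (count_sieve Up heA hD P5 M2 M3 MP' k1 k2 Y0 erefl hYB).
have L0 : 0 <= ln B / 211 by rewrite divr_ge0 // ln_ge0.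
have hL : ln B / 211 <= harm R K := le_trans hK (harm_ge_ln R K).
have sa : ca * (ln B / 211) <= sum_a R Y M predT.
  apply: le_trans (sum_a_lower R M0 (_ : (1 + K * M <= Y)%N)).
    by rewrite ler_pM2l.
  by rewrite /Y -mulnn leq_pmull.
have sb : cb * (ln B / 211) <= sum_b R Y M predT.
  apply: le_trans (sum_b_lower R (ltnW M2) (leqnn _)).
  by rewrite ler_pM2l.
rewrite tsumT -/CM.
apply: (@le_trans _ _ (B / CM / 32 * (ca * (ln B / 211) * (cb * (ln B / 211)) * (cb * (ln B / 211))))).
  by rewrite le_eqVlt; apply/orP; left; apply/eqP; ring.
apply: ler_wpM2l; first by rewrite ltW // !divr_gt0.
have [a0 b0] : 0 <= ca * (ln B / 211) /\ 0 <= cb * (ln B / 211) by split; rewrite mulr_ge0 // ltW.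
by apply: ler_pM => //; [rewrite mulr_ge0 | apply: ler_pM].
Qed.
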